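(* Let $\Bbbk$ be a field. For every finite quiver $Q$, the path algebra $\Bbbk Q$ is Morita cancellative.
   Context: $\Bbbk$ is a base field and everything is over $\Bbbk$: all algebras are unital associative $\Bbbk$-algebras. $A[t]$ denotes the polynomial algebra obtained from $A$ by adjoining a central indeterminate. $M(A)$ denotes the category of right $A$-modules. A finite quiver is a directed graph with finitely many vertices and finitely many arrows (loops and multiple arrows allowed); $\Bbbk Q$ is its path algebra. Morita cancellative: $A$ is Morita cancellative if, for every algebra $B$, an equivalence of categories between $M(A[t])$ and $M(B[t])$ implies that $M(A)$ is equivalent to $M(B)$. *)

(* Defs.v *)
From HB Require Import structures.
From mathcomp Require Import all_boot all_order all_algebra.
From mathcomp Require Import finmap.
From mathcomp Require Import boolp.
From mathcomp.multinomials Require Import monalg.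

Set Implicit Arguments.
Unset Strict Implicit.
Unset Printing Implicit Defensive.

Import GRing.Theory.
Local Open Scope ring_scope.

(* Categories; two parallel morphisms are compared with Leibniz equality.     *)

Record category := Category {
  obj :> Type;
  hom : obj -> obj -> Type;
  idm : forall X, hom X X;
  comp : forall X Y Z, hom Y Z -> hom X Y -> hom X Z;
  comp1m : forall X Y (f : hom X Y), comp (idm Y) f = f;
  compm1 : forall X Y (f : hom X Y), comp f (idm X) = f;
  compA : forall X Y Z T (h : hom Z T) (g : hom Y Z) (f : hom X Y),
    comp h (comp g f) = comp (comp h g) f
}.
Arguments idm {c} X.
Arguments comp {c X Y Z} g f.

Record functor (C D : category) := Functor {
  fobj :> C -> D;
  fmap : forall X Y, hom X Y -> hom (fobj X) (fobj Y);
  fmap1 : forall X, fmap (idm X) = idm (fobj X);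
  fmapM : forall X Y Z (g : hom Y Z) (f : hom X Y),
    fmap (comp g f) = comp (fmap g) (fmap f)
}.
Arguments fmap {C D} F {X Y} f : rename.

Definition idF (C : category) : functor C C :=
  @Functor C C (fun X => X) (fun _ _ f => f)
    (fun _ => erefl) (fun _ _ _ _ _ => erefl).

Section CompFunctor.
Variables (C D E : category) (G : functor D E) (F : functor C D).

Fact compF1 (X : C) : fmap G (fmap F (idm X)) = idm (G (F X)).
Proof. by rewrite !fmap1. Qed.

Fact compFM (X Y Z : C) (g : hom Y Z) (f : hom X Y) :
  fmap G (fmap F (comp g f)) = comp (fmap G (fmap F g)) (fmap G (fmap F f)).
Proof. by rewrite !fmapM. Qed.

Definition compF : functor C E :=
  @Functor C E (fun X => G (F X)) (fun _ _ f => fmap G (fmap F f)) compF1 compFM.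

End CompFunctor.

Definition nat_isomorphic (C D : category) (F G : functor C D) : Prop :=
  exists (eta : forall X : C, hom (F X) (G X))
         (theta : forall X : C, hom (G X) (F X)),
  [/\ forall (X Y : C) (f : hom X Y),
        comp (eta Y) (fmap F f) = comp (fmap G f) (eta X),
      forall X : C, comp (theta X) (eta X) = idm (F X)
    & forall X : C, comp (eta X) (theta X) = idm (G X)].

Definition quasi_inverse (C D : category) (F : functor C D) (G : functor D C) :
  Prop := nat_isomorphic (compF G F) (idF C) /\ nat_isomorphic (compF F G) (idF D).

Definition equivalent (C D : category) : Prop :=
  exists (F : functor C D) (G : functor D C), quasi_inverse F G.

Section Modules.
Variable R : nzRingType.
Implicit Types M N P Q : lmodType R.

Lemma linear_ext M N (f g : {linear M -> N}) : f =1 g -> f = g.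
Proof.
case: f g => [f cf] [g cg] /= /funext fg; case: _ / fg cg => cg.
congr GRing.Linear.Pack; case: cf cg => [[a1] [b1]] [[a2] [b2]].
by rewrite (Prop_irrelevance a1 a2) (Prop_irrelevance b1 b2).
Qed.

Definition lin_id M : {linear M -> M} := idfun.
Definition lin_comp M N P (g : {linear N -> P}) (f : {linear M -> N}) :
  {linear M -> P} := g \o f.

Fact lin_comp1m M N (f : {linear M -> N}) : lin_comp (lin_id N) f = f.
Proof. exact: linear_ext. Qed.

Fact lin_compm1 M N (f : {linear M -> N}) : lin_comp f (lin_id M) = f.
Proof. exact: linear_ext. Qed.

Fact lin_compA M N P Q (h : {linear P -> Q}) (g : {linear N -> P})
    (f : {linear M -> N}) :
  lin_comp h (lin_comp g f) = lin_comp (lin_comp h g) f.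
Proof. exact: linear_ext. Qed.

Definition leftMod : category :=
  @Category (lmodType R) (fun M N => {linear M -> N}) lin_id lin_comp
    lin_comp1m lin_compm1 lin_compA.

End Modules.

(* Right A-modules are left modules over the converse ring A^c, for which     *)
(* a *: x is the right action x a.                                            *)
Definition rightMod (A : nzRingType) : category := leftMod A^c.

Section LinearFunctors.
Variable k : fieldType.

(* The k-linear structure on the hom-spaces of a right module category:       *)
(* lin_lcomb c f g is c f + g, with c acting on N through its image in A.     *)
Section LinearCombination.
Variables (A : algType k) (M N : lmodType A^c) (c : k).
Variables (f g : {linear M -> N}).

Definition lin_lcomb_fun (x : M) : N := (c%:A : A^c) *: f x + g x.

Fact lin_lcomb_is_linear : linear lin_lcomb_fun.
Proof.
move=> a x y; rewrite /lin_lcomb_fun !linearP !scalerDr !scalerA.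
have -> : (c%:A : A^c) * a = a * (c%:A : A^c).
  by rewrite [LHS](_ : _ = (a : A) * c%:A) // [RHS](_ : _ = c%:A * (a : A)) //
             mulr_algr mulr_algl.
by rewrite addrACA.
Qed.

HB.instance Definition _ :=
  GRing.isLinear.Build A^c M N *:%R lin_lcomb_fun lin_lcomb_is_linear.

Definition lin_lcomb : {linear M -> N} := lin_lcomb_fun.

End LinearCombination.

Definition klinear (A B : algType k) (F : functor (rightMod A) (rightMod B)) :
  Prop :=
  forall (M N : lmodType A^c) (c : k) (f g : {linear M -> N}),
    fmap F (lin_lcomb c f g : @hom (rightMod A) M N) =
    lin_lcomb c (fmap F (f : @hom (rightMod A) M N))
                (fmap F (g : @hom (rightMod A) M N)).

Definition linearly_equivalent (A B : algType k) : Prop :=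
  exists (F : functor (rightMod A) (rightMod B))
         (G : functor (rightMod B) (rightMod A)),
    [/\ klinear F, klinear G & quasi_inverse F G].

End LinearFunctors.

(* {poly A} is canonically an algebra over A only; polyAlg A is the same ring *)
(* regarded as an algebra over the base field.                                *)
Definition polyAlg (k : fieldType) (A : algType k) : Type := {poly A}.

Section PolyAlg.
Variables (k : fieldType) (A : algType k).
Implicit Types (c : k) (p q : {poly A}).

HB.instance Definition _ := GRing.NzRing.on (polyAlg A).

Definition polyAlg_scale c (p : polyAlg A) : polyAlg A :=
  c%:A *: (p : {poly A}).

Fact polyAlg_scaleA c d (p : polyAlg A) :
  polyAlg_scale c (polyAlg_scale d p) = polyAlg_scale (c * d) p.
Proof. by rewrite /polyAlg_scale scalerA mulr_algl scalerA. Qed.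

Fact polyAlg_scale1 : left_id 1 polyAlg_scale.
Proof. by move=> p; rewrite /polyAlg_scale !scale1r. Qed.

Fact polyAlg_scaleDr : right_distributive polyAlg_scale +%R.
Proof. by move=> c p q; apply: scalerDr. Qed.

Fact polyAlg_scaleDl (p : polyAlg A) :
  {morph polyAlg_scale^~ p : c d / c + d}.
Proof. by move=> c d; rewrite /polyAlg_scale !scalerDl. Qed.

HB.instance Definition _ := GRing.Zmodule_isLmodule.Build k (polyAlg A)
  polyAlg_scaleA polyAlg_scale1 polyAlg_scaleDr polyAlg_scaleDl.

Fact polyAlg_scaleAl c (p q : polyAlg A) : c *: (p * q) = (c *: p) * q.
Proof. exact: (@scalerAl A {poly A}). Qed.

HB.instance Definition _ :=
  GRing.Lmodule_isLalgebra.Build k (polyAlg A) polyAlg_scaleAl.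

Fact polyAlg_scaleAr c (p q : polyAlg A) : c *: (p * q) = p * (c *: q).
Proof.
apply/polyP=> i.
rewrite [LHS](_ : _ = (c%:A *: ((p : {poly A}) * q))`_i) //.
rewrite [RHS](_ : _ = ((p : {poly A}) * (c%:A *: (q : {poly A})))`_i) //.
rewrite coefZ !coefM mulr_sumr; apply: eq_bigr => j _.
by rewrite coefZ !mulr_algl scalerAr.
Qed.

HB.instance Definition _ :=
  GRing.Lalgebra_isAlgebra.Build k (polyAlg A) polyAlg_scaleAr.

End PolyAlg.

Definition morita_cancellative (k : fieldType) (A : algType k) : Prop :=
  forall B : algType k,
    equivalent (rightMod (polyAlg A)) (rightMod (polyAlg B)) ->
    equivalent (rightMod A) (rightMod B).

(* The same property in the 2-category of k-linear categories.                *)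
Definition linearly_morita_cancellative (k : fieldType) (A : algType k) : Prop :=
  forall B : algType k,
    linearly_equivalent (polyAlg A) (polyAlg B) -> linearly_equivalent A B.

(* The vertex set is nonempty because rings are nontrivial in MathComp (the   *)
(* path algebra of the empty quiver is the zero ring).                        *)
Record quiver := Quiver {
  vertex : finType;
  arrow : finType;
  source : arrow -> vertex;
  target : arrow -> vertex;
  vertex_gt0 : (0 < #|vertex|)%N
}.

Section Walks.
Variable Q : quiver.

Fixpoint is_walk (v : vertex Q) (s : seq (arrow Q)) : bool :=
  if s is a :: s' then (source a == v) && is_walk (target a) s' else true.

(* A path is its starting vertex with its list of arrows in order of          *)
(* traversal; the empty list gives the trivial path at that vertex.           *)
Definition walk := {p : vertex Q * seq (arrow Q) | is_walk p.1 p.2}.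
HB.instance Definition _ := Choice.on walk.

Definition walk_start (p : walk) : vertex Q := (val p).1.
Definition walk_arrows (p : walk) : seq (arrow Q) := (val p).2.
Definition walk_end (p : walk) : vertex Q :=
  last (walk_start p) (map (@target Q) (walk_arrows p)).

Definition trivial_walk (v : vertex Q) : walk :=
  exist (fun p => is_walk p.1 p.2) (v, [::]) isT.

(* Concatenation: p first, then q (junk value p when they do not compose).    *)
Definition walk_cat (p q : walk) : walk :=
  insubd p (walk_start p, walk_arrows p ++ walk_arrows q).

Lemma is_walk_cat v s t :
  is_walk v (s ++ t) = is_walk v s && is_walk (last v (map (@target Q) s)) t.
Proof. by elim: s v => //= a s IHs v; rewrite IHs andbA. Qed.

Lemma val_walk_cat p q : walk_end p = walk_start q ->
  val (walk_cat p q) = (walk_start p, walk_arrows p ++ walk_arrows q).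
Proof.
move=> pq; rewrite val_insubd /= is_walk_cat (valP p) /=.
by rewrite -/(walk_end p) pq (valP q).
Qed.

Lemma walk_start_cat p q : walk_end p = walk_start q ->
  walk_start (walk_cat p q) = walk_start p.
Proof. by move=> pq; rewrite {1}/walk_start val_walk_cat. Qed.

Lemma walk_arrows_cat p q : walk_end p = walk_start q ->
  walk_arrows (walk_cat p q) = walk_arrows p ++ walk_arrows q.
Proof. by move=> pq; rewrite {1}/walk_arrows val_walk_cat. Qed.

Lemma walk_end_cat p q : walk_end p = walk_start q ->
  walk_end (walk_cat p q) = walk_end q.
Proof.
move=> pq; rewrite /walk_end walk_start_cat // walk_arrows_cat // map_cat.
by rewrite last_cat -/(walk_end p) pq.
Qed.

Lemma walk_inj p q :
  walk_start p = walk_start q -> walk_arrows p = walk_arrows q -> p = q.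
Proof.
by move=> e1 e2; apply: val_inj; apply/eqP; rewrite -pair_eqE /= -/(walk_start p)
  -/(walk_arrows p) e1 e2 !eqxx.
Qed.

Lemma walk_catA p q r : walk_end p = walk_start q -> walk_end q = walk_start r ->
  walk_cat p (walk_cat q r) = walk_cat (walk_cat p q) r.
Proof.
move=> pq qr; apply: walk_inj.
  by rewrite !walk_start_cat ?walk_end_cat.
by rewrite !walk_arrows_cat ?walk_end_cat ?walk_start_cat // catA.
Qed.

Lemma walk_cat1l p : walk_cat (trivial_walk (walk_start p)) p = p.
Proof. by apply: walk_inj; rewrite ?walk_start_cat ?walk_arrows_cat. Qed.

Lemma walk_cat1r p : walk_cat p (trivial_walk (walk_end p)) = p.
Proof. by apply: walk_inj; rewrite ?walk_start_cat ?walk_arrows_cat ?cats0. Qed.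

End Walks.

Definition pathAlg (k : fieldType) (Q : quiver) : Type := {malg k[walk Q]}.

Section PathAlg.
Variables (k : fieldType) (Q : quiver).

Local Notation PA := {malg k[walk Q]}.
Implicit Types (c d : k) (p q r : walk Q) (g h : PA).

HB.instance Definition _ := GRing.Lmodule.on (pathAlg k Q).

Definition walk_mul c p q : PA :=
  if walk_end p == walk_start q then << c *g walk_cat p q >> else 0.

Definition path_mul_def g h : PA :=
  \sum_(p <- msupp g) \sum_(q <- msupp h) walk_mul (g@_p * h@_q) p q.
Fact path_mul_key : unit. Proof. by []. Qed.
Definition path_mul := locked_with path_mul_key path_mul_def.
Canonical path_mul_unlockable := [unlockable fun path_mul].

Definition path_one : PA := \sum_(v : vertex Q) << trivial_walk v >>.

Lemma walk_mul0 p q : walk_mul 0 p q = 0.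
Proof. by rewrite /walk_mul monalgU0 if_same. Qed.

Lemma walk_mulD c d p q : walk_mul (c + d) p q = walk_mul c p q + walk_mul d p q.
Proof. by rewrite /walk_mul monalgUD; case: ifP => _; rewrite ?addr0. Qed.

Lemma path_mulw (d1 d2 : {fset walk Q}) g h :
    (msupp g `<=` d1)%fset -> (msupp h `<=` d2)%fset ->
  path_mul g h = \sum_(p <- d1) \sum_(q <- d2) walk_mul (g@_p * h@_q) p q.
Proof.
move=> le_d1 le_d2; rewrite unlock (big_fset_incl _ le_d1) /=.
  apply/eq_bigr=> p _; apply/big_fset_incl => // q _ /mcoeff_outdom ->.
  by rewrite mulr0 walk_mul0.
move=> p _ /mcoeff_outdom gp.
by rewrite big1 // => q _; rewrite gp mul0r walk_mul0.
Qed.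

Lemma path_mulDl : left_distributive path_mul +%R.
Proof.
move=> g1 g2 h; set d := (msupp g1 `|` msupp g2)%fset.
rewrite (@path_mulw d (msupp h)) ?msuppD_le // (@path_mulw d (msupp h) g1) //;
  last exact: fsubsetUl.
rewrite (@path_mulw d (msupp h) g2) //; last exact: fsubsetUr.
rewrite -big_split; apply: eq_bigr => p _; rewrite -big_split.
by apply: eq_bigr => q _; rewrite mcoeffD mulrDl walk_mulD.
Qed.

Lemma path_mulDr : right_distributive path_mul +%R.
Proof.
move=> g h1 h2; set d := (msupp h1 `|` msupp h2)%fset.
rewrite (@path_mulw (msupp g) d) ?msuppD_le // (@path_mulw (msupp g) d g h1) //;
  last exact: fsubsetUl.
rewrite (@path_mulw (msupp g) d g h2) //; last exact: fsubsetUr.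
rewrite -big_split; apply: eq_bigr => p _; rewrite -big_split.
by apply: eq_bigr => q _; rewrite mcoeffD mulrDr walk_mulD.
Qed.

Lemma path_mul0l h : path_mul 0 h = 0.
Proof. by rewrite unlock msupp0 big_seq_fset0. Qed.

Lemma path_mul0r g : path_mul g 0 = 0.
Proof. by rewrite unlock big1 // => p _; rewrite msupp0 big_seq_fset0. Qed.

Lemma path_mul_suml (I : Type) (s : seq I) (F : I -> PA) h :
  path_mul (\sum_(i <- s) F i) h = \sum_(i <- s) path_mul (F i) h.
Proof.
exact: (big_morph (path_mul^~ h) (fun _ _ => path_mulDl _ _ _) (path_mul0l h)).
Qed.

Lemma path_mul_sumr (I : Type) (s : seq I) (F : I -> PA) g :
  path_mul g (\sum_(i <- s) F i) = \sum_(i <- s) path_mul g (F i).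
Proof.
exact: (big_morph (path_mul g) (fun _ _ => path_mulDr _ _ _) (path_mul0r g)).
Qed.

Lemma path_mulUU c d p q :
  path_mul << c *g p >> << d *g q >> = walk_mul (c * d) p q.
Proof. by rewrite (path_mulw msuppU_le msuppU_le) !big_seq_fset1 !mcoeffUU. Qed.

Lemma malg_additive_ext (f1 f2 : PA -> PA) :
    {morph f1 : g h / g + h} -> {morph f2 : g h / g + h} ->
    (forall c p, f1 << c *g p >> = f2 << c *g p >>) ->
  f1 =1 f2.
Proof.
have morph0 (f : PA -> PA) : {morph f : g h / g + h} -> f 0 = 0.
  by move=> fD; apply: (addrI (f 0)); rewrite -fD !addr0.
move=> f1D f2D f12 g; rewrite (monalgE g).
rewrite (big_morph f1 f1D (morph0 _ f1D)) (big_morph f2 f2D (morph0 _ f2D)).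
by apply: eq_bigr => p _; apply: f12.
Qed.

Lemma path_mulUA c d e p q r :
  path_mul << c *g p >> (path_mul << d *g q >> << e *g r >>) =
  path_mul (path_mul << c *g p >> << d *g q >>) << e *g r >>.
Proof.
rewrite [X in path_mul _ X = _](path_mulUU d e q r).
rewrite [X in _ = path_mul X _](path_mulUU c d p q) /walk_mul.
case: (eqVneq (walk_end p) (walk_start q)) => [pq|npq];
  case: (eqVneq (walk_end q) (walk_start r)) => [qr|nqr].
- rewrite [LHS]path_mulUU [RHS]path_mulUU /walk_mul.
  by rewrite (walk_start_cat qr) (walk_end_cat pq) pq qr !eqxx mulrA walk_catA.
- rewrite [LHS]path_mul0r [RHS]path_mulUU /walk_mul (walk_end_cat pq).
  by rewrite (negbTE nqr).
- rewrite [LHS]path_mulUU [RHS]path_mul0l /walk_mul (walk_start_cat qr).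
  by rewrite (negbTE npq).
- by rewrite [LHS]path_mul0r [RHS]path_mul0l.
Qed.

Lemma path_mulA : associative path_mul.
Proof.
move=> g1 g2 g3; move: g1.
apply: malg_additive_ext => [g h|g h|c p].
- exact: path_mulDl.
- by rewrite (path_mulDl g h g2) (path_mulDl _ _ g3).
move: g2; apply: malg_additive_ext => [g h|g h|d q].
- by rewrite (path_mulDl g h g3) (path_mulDr _ (path_mul g g3)).
- by rewrite (path_mulDr _ g h) (path_mulDl _ _ g3).
move: g3; apply: malg_additive_ext => [g h|g h|e r].
- by rewrite [X in path_mul _ X = _](path_mulDr _ g h) [LHS]path_mulDr.
- exact: path_mulDr.
exact: path_mulUA.
Qed.

Lemma path_mul1l : left_id path_one path_mul.
Proof.
apply: malg_additive_ext => [g h|//|c p]; first exact: path_mulDr.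
rewrite path_mul_suml (bigD1 (walk_start p)) //= big1 => [|v nv].
  by rewrite [LHS]addr0 [LHS]path_mulUU /walk_mul eqxx mul1r walk_cat1l.
by rewrite path_mulUU /walk_mul (negbTE nv).
Qed.

Lemma path_mul1r : right_id path_one path_mul.
Proof.
apply: malg_additive_ext => [g h|//|c p]; first exact: path_mulDl.
rewrite path_mul_sumr (bigD1 (walk_end p)) //= big1 => [|v nv].
  by rewrite [LHS]addr0 [LHS]path_mulUU /walk_mul eqxx mulr1 walk_cat1r.
by rewrite path_mulUU /walk_mul eq_sym (negbTE nv).
Qed.

Lemma path_one_neq0 : path_one != 0.
Proof.
have /card_gt0P[v _] := vertex_gt0 Q.
apply/eqP => /(congr1 (mcoeff (trivial_walk v))) /eqP.
rewrite mcoeff0 raddf_sum (bigD1 v) //= big1 => [|w nw].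
  by rewrite addr0 mcoeffUU oner_eq0.
rewrite mcoeffU; case: eqP => // /(congr1 (@walk_start Q)).
by rewrite /walk_start /= => wv; rewrite wv eqxx in nw.
Qed.

HB.instance Definition _ := GRing.Zmodule_isNzRing.Build (pathAlg k Q)
  path_mulA path_mul1l path_mul1r path_mulDl path_mulDr path_one_neq0.

Lemma pathAlg_ME (g h : pathAlg k Q) : g * h = path_mul g h. Proof. by []. Qed.

Lemma walk_mulZ c d p q : walk_mul (c * d) p q = c *: walk_mul d p q.
Proof.
rewrite /walk_mul; case: (walk_end p == walk_start q); last by rewrite [RHS]scaler0.
apply/malgP => r; rewrite [LHS]mcoeffU [RHS]mcoeffZ.
by rewrite [X in _ = c * X]mcoeffU mulrnAr.
Qed.

Lemma path_scaleAl c (g h : pathAlg k Q) : c *: (g * h) = (c *: g) * h.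
Proof.
rewrite !pathAlg_ME (@path_mulw (msupp g) (msupp h) (c *: g)) ?msuppZ_le //.
rewrite (path_mulw (fsubset_refl (msupp g)) (fsubset_refl (msupp h))).
rewrite scaler_sumr; apply: eq_bigr => p _; rewrite scaler_sumr.
by apply: eq_bigr => q _; rewrite mcoeffZ -mulrA [RHS]walk_mulZ.
Qed.

HB.instance Definition _ :=
  GRing.Lmodule_isLalgebra.Build k (pathAlg k Q) path_scaleAl.

Lemma path_scaleAr c (g h : pathAlg k Q) : c *: (g * h) = g * (c *: h).
Proof.
rewrite !pathAlg_ME (@path_mulw (msupp g) (msupp h) g (c *: h)) ?msuppZ_le //.
rewrite (path_mulw (fsubset_refl (msupp g)) (fsubset_refl (msupp h))).
rewrite scaler_sumr; apply: eq_bigr => p _; rewrite scaler_sumr.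
by apply: eq_bigr => q _; rewrite mcoeffZ mulrCA [RHS]walk_mulZ.
Qed.

HB.instance Definition _ :=
  GRing.Lalgebra_isAlgebra.Build k (pathAlg k Q) path_scaleAr.

End PathAlg.

(* Main.v *)
From HB Require Import structures.
From mathcomp Require Import all_boot all_order all_algebra.
From mathcomp Require Import finmap.
From mathcomp Require Import boolp zify.
From mathcomp.multinomials Require Import monalg.
Require Import Defs.

(** An equivalence F from the modules over A[t] to the modules over B[t], with A
    the path algebra of Q, is additive because it preserves biproducts, and
    natural endomorphisms of the identity are the elements of the center. Hence
    F induces a ring isomorphism Phi : Z(B)[t] -> Z(A)[t] that is compatible
    with the actions on modules (equivalence_poly_center). The modules over B
    are the modules over B[t] killed by t, so they are equivalent to the modules
    over A[t] killed by S = Phi(t), which are the modules over A[t]/(S). It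
    suffices that A[t]/(S) is isomorphic to A. What is constructed is a pair of
    morphisms sg : A -> A[t] and th : A[t] -> A with th o sg = id, th S = 0 and
    f - sg (th f) in S A[t] for every f (split_quotient, cancel_equivalent).

    Both morphisms are built one connected component of Q at a time. A central
    element of A is constant on a component unless the component is an oriented
    cycle, and then it is a polynomial in the sum x of the cycles based at its
    vertices (acyclic_central, cyclic_central). With e the idempotent of the
    component, this gives e Z(A) = D with D = k or D = k[x]. Idempotents of a
    polynomial ring are constant, so Phi carries a factor C of Z(B) into D[t],
    and D[t] = C[s] where s is the component of S (component_presentation).

    If D = k, then C = k and s has degree one in t (line_coordinate).

    If D = k[x], then C[s] = k[x,t], and this is cancellation for the plane
    (plane_coordinate_subring): evaluating C at the origin gives a surjection
    k[x,t] = C[s] -> k[s], whose kernel is principal by the lemma of Gauss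
    (ker_principal). Its generator h divides a nonzero element of C, hence lies
    in C, and descent on the degree gives C = k[h]. So (h, s) is a coordinate
    system of the plane. For a cycle of length one the splitting sends the loop
    to h(loop, t).

    For a longer cycle no such substitution respects the vertices, and x itself
    has to be shown to lie in C. Call two nonzero modules twins if they have no
    common nonzero submodule and every central element is either zero on both or
    injective on both. Two vertices of the cycle give twins killed by x.
    Conversely, twins supported on the cycle are killed by x: where x acts
    injectively, nonzero elements fixed by the same vertex have the same
    annihilator (twin_cycle_sum). Being twins is invariant under equivalences,
    in particular under the automorphisms t -> t + b of B[t] with b central.
    Hence, for q the preimage of x under Phi, all the images of q(t + b) are
    divisible by x (translated_cycle_sum). As C is infinite, q is then constant
    on the factor C (const_of_translates), which means that x lies in C. *)

Set Implicit Arguments.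
Unset Strict Implicit.
Unset Printing Implicit Defensive.

Import GRing.Theory.
Local Open Scope ring_scope.

(** * Kernels of morphisms from k[x,t] to k[S] *)
Section PolynomialKernels.
Variable k : fieldType.
Local Notation D := {poly k}.
Local Notation D2 := {poly {poly k}}.

Lemma polyC_dvd_coefs (p : D) (f : D2) :
  (forall i, p %| f`_i) -> exists g, f = p%:P * g.
Proof.
move=> pf; exists (\poly_(i < size f) (f`_i %/ p)).
apply/polyP=> i; rewrite coefCM coef_poly; case: ltnP => [_|/leq_sizeP->//].
  by rewrite mulrC divpK.
by rewrite mulr0.
Qed.

(** The lemma of Gauss, proved with the first coefficients of f and of g that
    p does not divide. *)
Lemma irreducible_dvd_coefsM (p : D) (f g : D2) :
    irreducible_poly p -> (forall i, p %| (f * g)`_i) ->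
  (forall i, p %| f`_i) \/ (forall i, p %| g`_i).
Proof.
move=> irr_p pfg; apply: contrapT => /not_orP[/existsNP nf /existsNP ng].
have nf' : exists i, ~~ (p %| f`_i) by case: nf => i /negP; exists i.
have ng' : exists i, ~~ (p %| g`_i) by case: ng => i /negP; exists i.
case: (ex_minnP nf') => i pfi mini; case: (ex_minnP ng') => j pgj minj.
have ltij : (i < (i + j).+1)%N by rewrite ltnS leq_addr.
move: (pfg (i + j)%N); rewrite coefM (bigD1 (Ordinal ltij)) //= addKn.
rewrite dvdp_addl; last first.
  apply: (big_ind (fun x => p %| x)) => [|x y px py|l li].
  - exact: dvdp0.
  - exact: dvdp_add.
  have [lti|leil] := ltnP l i.
    apply: dvdp_mulr; case: (boolP (p %| f`_l)) => // /mini.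
    by rewrite leqNgt lti.
  apply: dvdp_mull; case: (boolP (p %| g`_(i + j - l))) => // /minj.
  have : (l != i :> nat) by apply: contraNneq li => il; apply/eqP/val_inj.
  by have := ltn_ord l; lia.
by rewrite Gauss_dvdpr ?irreducible_poly_coprime // (negbTE pgj).
Qed.

Lemma exists_irreducible_dvd (d : D) :
  (1 < size d)%N -> exists2 p, irreducible_poly p & p %| d.
Proof.
move=> d1; have ex : exists n, `[< exists2 p : D, (1 < size p)%N & p %| d /\ size p = n >].
  by exists (size d); apply/asboolP; exists d.
case: (ex_minnP ex) => n /asboolP[p p1 [pd sp]] minn.
exists p => //; split=> // q q1 qp; rewrite -dvdp_size_eqp //.
have p0 : p != 0 by rewrite -size_poly_gt0 (ltn_trans _ p1).
have q0 : q != 0 by apply: contraTneq qp => ->; rewrite dvd0p.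
rewrite eqn_leq (dvdp_leq p0 qp) /= sp; apply: minn; apply/asboolP; exists q.
  by rewrite ltn_neqAle eq_sym q1 size_poly_gt0.
by split=> //; apply: dvdp_trans pd.
Qed.

(** Division by a primitive h may be checked after multiplication by a constant
    d: the irreducible factors of d divide h q, hence q, and are removed one by
    one. No fraction field appears. *)
Lemma primitive_dvd (d : D) (f h q : D2) :
    (forall p, irreducible_poly p -> ~ forall i, p %| h`_i) ->
  d != 0 -> d%:P * f = h * q -> exists g, f = h * g.
Proof.
move=> prim_h; have [n] := ubnP (size d); elim: n => // n IHn in d q *.
move=> dn d0 df; have [/size1_polyC dc|/exists_irreducible_dvd] := leqP (size d) 1.
  set c := d`_0 in dc; exists (c^-1%:P%:P * q).
  by rewrite mulrCA -df dc mulrA -!polyCM mulVf ?mul1r // -polyC_eq0 -dc.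
case=> p irr_p /dvdpP[e de].
have p0 : p != 0 by apply: irredp_neq0.
have [i|/(prim_h _ irr_p)//|/polyC_dvd_coefs[g qg]] :=
    @irreducible_dvd_coefsM p h q irr_p.
  by rewrite -df coefCM de dvdp_mulr ?dvdp_mull.
have e0 : e != 0 by apply: contraNneq d0 => e0; rewrite de e0 mul0r.
apply: (IHn e g) => //.
  move: dn; rewrite de size_mul // ltnS; case: irr_p => p1 _.
  by apply: leq_trans; case: (size p) p1 => [|[|m]] // _; rewrite !addnS /= ltnS leq_addr.
apply: (@mulfI D2 p%:P); first by rewrite polyC_eq0.
by rewrite mulrA -polyCM mulrC [p * e]mulrC -de mulrC df qg mulrCA.
Qed.

Variable psi : {rmorphism D2 -> D}.
Hypothesis psiC : forall a : k, psi a%:P%:P = a%:P.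

Let alpha := psi 'X%:P.
Let beta := psi 'X.

Lemma morph_polyC (c : D) : psi c%:P = c \Po alpha.
Proof.
rewrite -{1}(coefK c) poly_def !rmorph_sum /= comp_polyE; apply: eq_bigr => i _.
by rewrite -mul_polyC !rmorphM psiC !rmorphXn /= mul_polyC.
Qed.

Lemma morph_polyE f : psi f = \sum_(i < size f) (f`_i \Po alpha) * beta ^+ i.
Proof.
rewrite -{1}(coefK f) poly_def !rmorph_sum /=; apply: eq_bigr => i _.
by rewrite -mul_polyC rmorphM rmorphXn /= morph_polyC.
Qed.

(** The variable of k[S] is integral over k[alpha] when alpha is not constant,
    hence so is beta; an equation of integrality is an element of the kernel. *)
Lemma ker_neq0 : (1 < size alpha)%N -> exists2 f, f != 0 & psi f = 0.
Proof.
move=> alpha1.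
have lc0 : lead_coef alpha != 0.
  by rewrite lead_coef_eq0 -size_poly_gt0 (ltn_trans _ alpha1).
pose F : {rmorphism D -> D} := comp_poly alpha.
have intX : integralOver F 'X.
  pose P := (lead_coef alpha)^-1%:P%:P * (map_poly polyC alpha - 'X%:P : D2).
  have sm : size (map_poly polyC alpha : D2) = size alpha.
    by rewrite size_map_inj_poly ?polyC0 //; apply: polyC_inj.
  have lm : lead_coef (map_poly polyC alpha - 'X%:P : D2) = (lead_coef alpha)%:P.
    rewrite lead_coefDl ?lead_coef_map_inj ?polyC0 //; first exact: polyC_inj.
    by rewrite size_polyN size_polyC sm polyX_eq0.
  exists P.
    by rewrite monicE /P lead_coefM lead_coefC lm -polyCM mulVf.
  rewrite /root /P rmorphM /= hornerM map_polyC /= hornerC.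
  rewrite rmorphB /= map_polyC /= hornerD hornerN hornerC comp_polyX.
  rewrite -map_poly_comp (eq_map_poly (g := polyC)); last first.
    by move=> c /=; rewrite comp_polyC.
  by rewrite -/(alpha \Po 'X) comp_polyXr subrr mulr0.
have : integralOver F beta.
  rewrite -(comp_polyXr beta); apply: integral_horner => //.
  apply/integral_poly => i; rewrite coef_map /= -[(beta`_i)%:P](comp_polyC _ alpha).
  exact: (integral_id F).
case=> f mf rf; exists f; first exact: monic_neq0.
move/rootP: rf; rewrite horner_coef morph_polyE size_map_poly_id0; last first.
  by rewrite (eqP mf) /= comp_polyC oner_eq0.
by under eq_bigr do rewrite coef_map /=.
Qed.

(** If alpha is a constant a, the kernel is generated by x - a. Otherwise it is
    generated by an element of least degree in t whose leading coefficient has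
    least degree: pseudo-division leaves no remainder, and the choice of the
    leading coefficient makes the element primitive. *)
Lemma ker_principal : (exists f, 1 < size (psi f))%N ->
  exists2 h, h != 0 & forall f, psi f = 0 <-> exists g, f = h * g.
Proof.
case=> f0 psif0; have [alpha1|alpha1] := leqP (size alpha) 1.
  have alphaC := size1_polyC alpha1; set a := alpha`_0 in alphaC.
  have psiE f : psi f = map_poly (horner_eval a) f \Po beta.
    rewrite morph_polyE comp_polyE.
    rewrite (big_ord_widen _ (fun i => (f`_i \Po alpha) * beta ^+ i) (leqnn _)).
    have le := size_poly (size f) (fun i => (horner_eval a) f`_i).
    rewrite -[map_poly _ f]/(\poly_(i < size f) horner_eval a f`_i).
    rewrite [RHS](big_ord_widen _ (fun i => _`_i *: beta ^+ i) le).
    rewrite big_mkcond [RHS]big_mkcond; apply: eq_bigr => i _ /=.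
    rewrite ltn_ord coef_poly ltn_ord alphaC comp_polyCr -mul_polyC.
    case: ltnP => // si.
    have : (\poly_(i < size f) horner_eval a f`_i)`_i = 0 by apply/leq_sizeP/si.
    by rewrite coef_poly ltn_ord /horner_eval => ->; rewrite mul0r.
  have beta1 : (1 < size beta)%N.
    rewrite ltnNge; apply: contraTN psif0 => /size1_polyC betaC.
    by rewrite psiE betaC comp_polyCr -leqNgt size_polyC_leq1.
  exists ('X - a%:P)%:P; first by rewrite polyC_eq0 polyXsubC_eq0.
  move=> f; split=> [psif|[g ->]]; last first.
    by rewrite rmorphM morph_polyC alphaC comp_polyCr hornerXsubC subrr mul0r.
  apply: polyC_dvd_coefs => i; rewrite dvdp_XsubCl; apply/rootP.
  have /(congr1 (fun g : D => g`_i)) : map_poly (horner_eval a) f = 0.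
    by apply/eqP; rewrite -(comp_poly_eq0 _ beta1) -psiE psif.
  by rewrite coef_map coef0.
pose K n m := `[< exists f : D2, [/\ f != 0, psi f = 0, size f = n & size (lead_coef f) = m] >].
have exK : exists n, `[< exists m, K n m >].
  have [f f1 psif] := ker_neq0 alpha1; exists (size f); apply/asboolP.
  by exists (size (lead_coef f)); apply/asboolP; exists f.
case: (ex_minnP exK) => n /asboolP exm minn; case: (ex_minnP exm) => m.
move/asboolP=> [h [h0 psih sh lh]] minm; exists h => // f.
split=> [psif|[g ->]]; last by rewrite rmorphM psih mul0r.
have := Pdiv.WeakIdomain.divp_eq f h.
set l := _ ^+ _; set q := _ %/ _; set r := _ %% _ => def_f.
have psir : psi r = 0.
  apply/eqP; have /(congr1 psi)/eqP := def_f.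
  by rewrite -mul_polyC rmorphD !rmorphM psif psih !mulr0 add0r eq_sym.
have r0 : r = 0.
  apply/eqP; case: eqP => // /eqP rN0.
  have : (size r < n)%N by rewrite -sh Pdiv.CommonIdomain.ltn_modp.
  suff /minn : `[< exists m, K (size r) m >] by lia.
  by apply/asboolP; exists (size (lead_coef r)); apply/asboolP; exists r.
apply: (@primitive_dvd l _ _ q).
- move=> p irr_p /polyC_dvd_coefs[g hg].
  have p0 : p != 0 by apply: irredp_neq0.
  have g0 : g != 0 by apply: contraNneq h0 => g0; rewrite hg g0 mulr0.
  have psig : psi g = 0.
    apply/eqP; move/eqP: psih; rewrite hg rmorphM mulf_eq0 morph_polyC.
    by rewrite comp_poly_eq0 // (negbTE p0).
  have lcg : lead_coef g != 0 by rewrite lead_coef_eq0.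
  have := minm (size (lead_coef g)); rewrite -lh hg lead_coefM lead_coefC.
  rewrite size_mul //; case: irr_p => p1 _.
  have -> : K n (size (lead_coef g)).
    apply/asboolP; exists g; split=> //; rewrite -sh hg mul_polyC.
    by rewrite size_scale.
  move/(_ isT); case: (size p) p1 => [|[|u]] // _.
  by rewrite !addSn /= ltnNge leq_addl.
- by rewrite expf_neq0 // lead_coef_eq0.
- by rewrite mul_polyC def_f r0 addr0 mulrC.
Qed.

End PolynomialKernels.

(** * Coordinates on the line and on the plane *)
(** With f = id this inverts a bijective morphism; in general it factors f
    through a subring that contains its image. *)
Lemma rmorph_lift (R S T : nzRingType) (i : {rmorphism S -> T})
    (f : {rmorphism R -> T}) :
    injective i -> (forall x, exists y, i y = f x) ->
  exists g : {rmorphism R -> S}, forall x, i (g x) = f x.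
Proof.
move=> inj_i /choice[g gE].
have gB : zmod_morphism g by move=> x y; apply: inj_i; rewrite rmorphB !gE rmorphB.
have gM : monoid_morphism g.
  by split=> [|x y]; apply: inj_i; rewrite ?rmorph1 ?rmorphM !gE ?rmorph1 ?rmorphM.
pose gA := GRing.isZmodMorphism.Build R S g gB.
pose gR := GRing.isMonoidMorphism.Build R S g gM.
pose G : {rmorphism R -> S} := HB.pack g gA gR.
by exists G.
Qed.

Section Substitution.
Variable k : fieldType.
Local Notation D := {poly k}.
Local Notation D2 := {poly {poly k}}.

(** The outer variable 'X is t and the inner variable 'X%:P is x, so subst2 a b f
    is f(a, b), and subst1 h p is p(h). *)
Definition subst2 (a b : D) : D2 -> D := horner_eval b \o map_poly (comp_poly a).
Definition subst1 (h : D2) : D -> D2 := horner_eval h \o map_poly (polyC \o polyC).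
HB.instance Definition _ (a b : D) := GRing.RMorphism.on (subst2 a b).
HB.instance Definition _ h := GRing.RMorphism.on (subst1 h).

Lemma subst2C a b (c : k) : subst2 a b c%:P%:P = c%:P.
Proof. by rewrite /subst2 /= map_polyC /horner_eval /= hornerC comp_polyC. Qed.
Lemma subst2Y a b : subst2 a b 'X%:P = a.
Proof. by rewrite /subst2 /= map_polyC /horner_eval /= hornerC comp_polyX. Qed.
Lemma subst2X a b : subst2 a b 'X = b.
Proof. by rewrite /subst2 /= map_polyX /horner_eval /= hornerX. Qed.
Lemma subst1C h (c : k) : subst1 h c%:P = c%:P%:P.
Proof. by rewrite /subst1 /= map_polyC /horner_eval /= hornerC. Qed.
Lemma subst1X h : subst1 h 'X = h.
Proof. by rewrite /subst1 /= map_polyX /horner_eval /= hornerX. Qed.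

Lemma subst1_MXaddC h p (c : k) :
  subst1 h (p * 'X + c%:P) = subst1 h p * h + c%:P%:P.
Proof.
rewrite [LHS]rmorphD rmorphM; congr (_ * _ + _); first exact: subst1X.
exact: subst1C.
Qed.

(** The central factor e is meant for idempotents: morphisms into a product of
    rings are compared on one factor of the product. *)
Lemma eq_rmorph_poly (R : nzRingType) (e : R) (f g : {rmorphism D -> R}) :
    (forall x, e * x = x * e) -> (forall a, e * f a%:P = e * g a%:P) ->
    e * f 'X = e * g 'X ->
  forall p, e * f p = e * g p.
Proof.
move=> ce fgC fgX; elim/poly_ind => [|p c IHp]; first by rewrite !rmorph0.
rewrite !rmorphD !rmorphM !mulrDr fgC; congr (_ + _).
by rewrite mulrA IHp ce -mulrA fgX mulrA -ce mulrA.
Qed.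

Lemma eq_rmorph_poly2 (R : nzRingType) (e : R) (f g : {rmorphism D2 -> R}) :
    (forall x, e * x = x * e) -> (forall a, e * f a%:P%:P = e * g a%:P%:P) ->
    e * f 'X%:P = e * g 'X%:P -> e * f 'X = e * g 'X ->
  forall p, e * f p = e * g p.
Proof.
move=> ce fgC fgY fgX; elim/poly_ind => [|p c IHp]; first by rewrite !rmorph0.
rewrite !rmorphD !rmorphM !mulrDr; congr (_ + _).
  by rewrite mulrA IHp ce -mulrA fgX mulrA -ce mulrA.
exact: (@eq_rmorph_poly R e (f \o polyC) (g \o polyC) ce fgC fgY).
Qed.

Lemma morph_subst2 (f : {rmorphism D2 -> D}) :
  (forall a, f a%:P%:P = a%:P) -> f =1 subst2 (f 'X%:P) (f 'X).
Proof.
move=> fC p; have := @eq_rmorph_poly2 D 1 f (subst2 (f 'X%:P) (f 'X)).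
move=> /(_ _ _ _ _ p); rewrite !mul1r; apply=> [x|a||].
- by rewrite mul1r mulr1.
- by rewrite !mul1r fC; apply/esym/subst2C.
- exact/esym/subst2Y.
- exact/esym/subst2X.
Qed.

End Substitution.

Section PolynomialSubrings.
Variables (C : comNzRingType) (T : idomainType) (Psi : {rmorphism {poly C} -> T}).
Hypothesis inj_Psi : injective Psi.

Lemma size_mul_subring (p q : {poly C}) : p * q != 0 -> size (p * q) = (size p + size q).-1.
Proof.
have neq0 r : r != 0 -> Psi r != 0 by rewrite -(inj_eq inj_Psi) rmorph0.
move=> pq0; rewrite size_proper_mul //.
have p0 : p != 0 by apply: contraNneq pq0 => ->; rewrite mul0r.
have q0 : q != 0 by apply: contraNneq pq0 => ->; rewrite mulr0.
rewrite -polyC_eq0 -(inj_eq inj_Psi) rmorph0 polyCM rmorphM mulf_neq0 //.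
  by apply: neq0; rewrite polyC_eq0 lead_coef_eq0.
by apply: neq0; rewrite polyC_eq0 lead_coef_eq0.
Qed.

(** Degrees add up for products in C[s] because it embeds in a domain. *)
Lemma const_factor (p q : {poly C}) c : c != 0 -> p * q = c%:P -> exists2 a, p = a%:P & a != 0.
Proof.
move=> c0 pq; have pq0 : p * q != 0 by rewrite pq polyC_eq0.
have p0 : p != 0 by apply: contraNneq pq0 => ->; rewrite mul0r.
have q0 : q != 0 by apply: contraNneq pq0 => ->; rewrite mulr0.
have := size_mul_subring pq0; rewrite pq size_polyC c0 => /= sz.
have /size1_polyC pC : (size p <= 1)%N.
  move: p0 q0 sz; rewrite -!size_poly_gt0.
  by case: (size p) => // n; case: (size q) => // m _ _; rewrite addSn addnS; case: n.
by exists p`_0 => //; rewrite -polyC_eq0 -pC.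
Qed.

Lemma const_unit (g : {rmorphism T -> {poly C}}) (x y : T) :
  x * y = 1 -> exists c, g x = c%:P.
Proof.
move=> xy; have gxy : g x * g y = 1%:P by rewrite -rmorphM xy rmorph1.
by have [c gc _] := const_factor (oner_neq0 C) gxy; exists c.
Qed.

Lemma split_const p : exists u, Psi p = Psi (p`_0)%:P + Psi 'X * u.
Proof.
exists (Psi (drop_poly 1 p)); rewrite -rmorphM -rmorphD; congr (Psi _).
apply/polyP=> i; rewrite coefD coefC coefXM coef_drop_poly.
by case: i => [|i] /=; rewrite ?addr0 // add0r addn1.
Qed.

End PolynomialSubrings.

Section LineCoordinate.
Variables (k : fieldType) (C : comNzRingType) (Psi : {rmorphism {poly C} -> {poly k}}).
Hypothesis inj_Psi : injective Psi.
Hypothesis surj_Psi : forall f, exists p, Psi p = f.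

(** Evaluation of C at the origin gives a morphism k[t] = C[s] -> k[s] over k
    that hits s. It is given by a nonconstant polynomial, hence is injective, so
    it identifies C with k. The root b of s is then the image of t modulo s. *)
Lemma line_coordinate : exists b : k,
  (Psi 'X).[b] = 0 /\ exists u, 'X - b%:P = Psi 'X * u.
Proof.
have [g gK] := rmorph_lift (f := idfun) inj_Psi surj_Psi.
have Psi_g f : Psi (g f) = f by exact: gK.
have g_Psi p : g (Psi p) = p by apply: inj_Psi; rewrite Psi_g.
pose ev : {rmorphism C -> k} := horner_eval 0 \o Psi \o polyC.
have gC a : exists2 c, g a%:P = c%:P & ev c = a.
  have [-> | a0] := eqVneq a 0; first by exists 0; rewrite ?rmorph0.
  have aV : a%:P * a^-1%:P = 1 :> {poly k} by rewrite -polyCM divff.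
  have [c gc] := const_unit inj_Psi g aV; exists c => //.
  by rewrite /ev /= -gc Psi_g /horner_eval hornerC.
pose psi : {rmorphism {poly k} -> {poly k}} := map_poly ev \o g.
have psiC a : psi a%:P = a%:P.
  by have [c gc ec] := gC a; rewrite /psi /= gc map_polyC; congr _%:P.
have psi_comp f : psi f = f \Po psi 'X.
  elim/poly_ind: f => [|f c IHf]; first by rewrite rmorph0 comp_poly0.
  by rewrite rmorphD rmorphM IHf psiC comp_poly_MXaddC.
have psiX1 : (1 < size (psi 'X))%N.
  rewrite ltnNge; apply/negP => /size1_polyC psiX.
  have : psi (Psi 'X) = 'X by rewrite /psi /= g_Psi map_polyX.
  rewrite psi_comp psiX comp_polyCr => /(congr1 (size \o @polyseq _)) /=.
  by rewrite size_polyX size_polyC; case: (_ != 0).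
have inj_psi f : psi f = 0 -> f = 0.
  by move/eqP; rewrite psi_comp comp_poly_eq0 // => /eqP.
have PsiC c : Psi c%:P = (ev c)%:P.
  apply/eqP; rewrite -subr_eq0; apply/eqP/inj_psi.
  by rewrite rmorphB psiC /psi /= g_Psi map_polyC subrr.
pose th : {rmorphism {poly k} -> k} := ev \o horner_eval 0 \o g.
have thC a : th a%:P = a.
  by have [c gc ec] := gC a; rewrite -[RHS]ec /th /= gc /horner_eval hornerC.
have thE f : th f = f.[th 'X].
  elim/poly_ind: f => [|f c IHf]; first by rewrite rmorph0 horner0.
  by rewrite rmorphD rmorphM IHf thC hornerMXaddC.
exists (th 'X); split.
  by rewrite -thE -[RHS](rmorph0 ev) /th /= g_Psi /horner_eval hornerX.
have [u Xu] := split_const Psi (g 'X); exists u; move: Xu.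
rewrite Psi_g PsiC => {1}->; rewrite -horner_coef0 addrAC subrr add0r //.
Qed.

End LineCoordinate.

Section PlaneDegree.
Variable k : fieldType.
Local Notation D2 := {poly {poly k}}.

(** The degree in t plus the degree in x of the leading coefficient: a degree
    that is additive on products and vanishes on the elements of k only. *)
Definition bideg (f : D2) := ((size f).-1 + (size (lead_coef f)).-1)%N.

Lemma bidegM f g : f != 0 -> g != 0 -> bideg (f * g) = (bideg f + bideg g)%N.
Proof.
move=> f0 g0; rewrite /bideg lead_coefM !size_mul ?lead_coef_eq0 //.
have lf : lead_coef f != 0 by rewrite lead_coef_eq0.
have lg : lead_coef g != 0 by rewrite lead_coef_eq0.
move: f0 g0 lf lg; rewrite -4!size_poly_gt0.
case: (size f) => // a; case: (size g) => // b.
case: (size (lead_coef f)) => // c; case: (size (lead_coef g)) => // d _ _ _ _.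
by rewrite !addSn !addnS /= addnACA.
Qed.

Lemma bideg_subC f (a : k) : (bideg (f - a%:P%:P) <= bideg f)%N.
Proof.
rewrite /bideg; have [/size1_polyC ->|f1] := leqP (size f) 1.
  rewrite -polyCB !lead_coefC !size_polyC; set c := f`_0.
  have : (size (c - a%:P)%R <= maxn (size c) 1)%N.
    rewrite (leq_trans (size_polyD _ _)) // size_polyN geq_max leq_maxl /=.
    by rewrite leq_max size_polyC leq_b1 orbT.
  have b0 (b : bool) : b.-1 = 0%N by case: b.
  by rewrite !b0 !add0n; case: (size c) => [|[|m]]; case: (size _) => [|[|n]].
have sa : (size (- a%:P%:P : D2) < size f)%N.
  by rewrite size_polyN (leq_ltn_trans _ f1) // size_polyC leq_b1.
by rewrite size_polyDl // lead_coefDl.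
Qed.

Lemma bideg0P f : bideg f = 0%N -> exists a : k, f = a%:P%:P.
Proof.
move=> /eqP; rewrite addn_eq0 -!subn1 !subn_eq0 => /andP[/size1_polyC fC].
by rewrite fC lead_coefC => /size1_polyC->; exists (f`_0)`_0.
Qed.

End PlaneDegree.

Section PlaneCoordinate.
Variable k : fieldType.
Local Notation D := {poly k}.
Local Notation D2 := {poly {poly k}}.
Variables (C : comNzRingType) (Psi : {rmorphism {poly C} -> D2}).
Hypothesis inj_Psi : injective Psi.
Hypothesis surj_Psi : forall f, exists p, Psi p = f.

(** C is a polynomial ring k[h]: the elements of C that vanish at the origin are
    killed by the evaluation C[s] -> k[s] at the origin, so they are multiples of
    the generator h of its kernel, and the quotient is in C again and has lower
    degree. The pair (a, b) is the image of (x, t) modulo s, written as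
    polynomials in h. *)
Lemma plane_coordinate_subring : exists (h : D2) (a b : D),
  [/\ subst2 a b h = 'X, subst2 a b (Psi 'X) = 0,
      forall f, exists u, f - subst1 h (subst2 a b f) = Psi 'X * u,
      forall c, exists p, Psi c%:P = subst1 h p &
      [/\ injective (subst1 h), (0 < bideg h)%N & exists y, Psi y%:P = h]].
Proof.
have [g gK] := rmorph_lift (f := idfun) inj_Psi surj_Psi.
have Psi_g f : Psi (g f) = f by exact: gK.
have g_Psi p : g (Psi p) = p by apply: inj_Psi; rewrite Psi_g.
pose ev : {rmorphism C -> k} := horner_eval 0 \o horner_eval 0 \o Psi \o polyC.
have gC a : exists2 c, g a%:P%:P = c%:P & ev c = a.
  have [-> | a0] := eqVneq a 0; first by exists 0; rewrite ?rmorph0.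
  have aV : a%:P%:P * a^-1%:P%:P = 1 :> D2 by rewrite -!polyCM divff.
  have [c gc] := const_unit inj_Psi g aV; exists c => //.
  by rewrite /ev /= -gc Psi_g /horner_eval !hornerC.
pose psi : {rmorphism D2 -> D} := map_poly ev \o g.
have psiC a : psi a%:P%:P = a%:P.
  by have [c gc ec] := gC a; rewrite /psi /= gc map_polyC; congr _%:P.
have psi_Psi p : psi (Psi p) = map_poly ev p by rewrite /psi /= g_Psi.
have [|h h0 ker_h] := ker_principal psiC.
  by exists (Psi 'X); rewrite psi_Psi map_polyX size_polyX.
have psih : psi h = 0 by apply/ker_h; exists 1; rewrite mulr1.
(* The generator h divides the leading coefficient c of its expansion in s,
   because c is killed as well; a factor of an element of C lies in C. *)
have [y hy] : exists y, h = Psi y%:P.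
  have : g h != 0 by apply: contraNneq h0 => gh; rewrite -(Psi_g h) gh rmorph0.
  rewrite -lead_coef_eq0; set c := lead_coef _ => c0.
  have [] : exists q, Psi c%:P = h * q.
    apply/ker_h; rewrite psi_Psi map_polyC /=.
    have /(congr1 (fun q : D => q`_(size (g h)).-1)) := psih.
    by rewrite /psi /= coef_map coef0 -lead_coefE => evc; congr _%:P.
  move=> q /(congr1 g); rewrite g_Psi rmorphM => /esym/(const_factor inj_Psi c0).
  by case=> y gh _; exists y; rewrite -gh Psi_g.
have h_deg : (0 < bideg h)%N.
  rewrite lt0n; apply/eqP => /bideg0P[a ha]; move: h0; rewrite ha !polyC_eq0.
  by rewrite -(polyC_eq0 a) -psiC -ha psih eqxx.
have C_h c : exists p, Psi c%:P = subst1 h p.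
  have [n] := ubnP (bideg (Psi c%:P)); elim: n => // n IHn in c *.
  rewrite ltnS => cn; set a := ev c.
  have [q hq] : exists q, Psi c%:P - a%:P%:P = h * q.
    by apply/ker_h; rewrite rmorphB psi_Psi map_polyC psiC subrr.
  have [|q0] := eqVneq q 0.
    move=> q0; exists a%:P; rewrite subst1C.
    by apply/eqP; rewrite -subr_eq0 hq q0 mulr0.
  have [d gd ed] := gC a.
  have cd0 : c - d != 0.
    apply: contraTneq q0 => cd; rewrite negbK.
    have : h * q = 0 by rewrite -hq -(Psi_g a%:P%:P) gd -rmorphB -polyCB cd rmorph0.
    by move/eqP; rewrite mulf_eq0 (negbTE h0).
  have gqh : g q * g h = (c - d)%:P.
    by rewrite -rmorphM mulrC -hq rmorphB g_Psi gd polyCB.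
  have [c1 gq _] := const_factor inj_Psi cd0 gqh.
  have qc1 : q = Psi c1%:P by rewrite -gq Psi_g.
  have [|p qp] := IHn c1.
    rewrite -qc1; have := bideg_subC (Psi c%:P) a; rewrite hq bidegM //.
    by move: cn h_deg; lia.
  by exists (p * 'X + a%:P); rewrite subst1_MXaddC -qp -qc1 mulrC -hq subrK.
have psi_h p : psi (subst1 h p) = (p.[0])%:P.
  elim/poly_ind: p => [|p c IHp]; first by rewrite !rmorph0 horner0.
  by rewrite subst1_MXaddC rmorphD rmorphM psih psiC hornerMXaddC !mulr0 !add0r.
have inj_h : injective (subst1 h).
  apply/raddf_inj; elim/poly_ind => [//|p c IHp] ph.
  have {}ph : subst1 h (p * 'X + c%:P) = 0 by exact: ph.
  have := psi_h (p * 'X + c%:P); rewrite ph rmorph0 hornerMXaddC mulr0 add0r.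
  move/esym/eqP; rewrite polyC_eq0 => /eqP c0; move: ph; rewrite subst1_MXaddC c0 !polyC0 addr0.
  by move/eqP; rewrite mulf_eq0 (negbTE h0) orbF => /eqP/IHp ->; rewrite mul0r addr0.
pose kap : {rmorphism D2 -> D2} := Psi \o polyC \o horner_eval 0 \o g.
have kapE f : kap f = Psi ((g f)`_0)%:P by rewrite /kap /= /horner_eval horner_coef0.
have [th thE] : exists th : {rmorphism D2 -> D}, forall f, subst1 h (th f) = kap f.
  apply: rmorph_lift => // f; rewrite kapE.
  by have [p ->] := C_h (g f)`_0; exists p.
have thC a : th a%:P%:P = a%:P.
  apply: inj_h; rewrite thE kapE; have [c gc _] := gC a.
  by rewrite gc coefC -gc Psi_g subst1C.
have thE2 := morph_subst2 thC.
exists h, (th 'X%:P), (th 'X); split=> //; last by split=> //; exists y.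
- rewrite -thE2; apply: inj_h; rewrite thE kapE hy g_Psi coefC.
  by rewrite -hy; apply/esym/subst1X.
- by rewrite -thE2; apply: inj_h; rewrite thE kapE g_Psi coefX polyC0 !rmorph0.
move=> f; rewrite -thE2 thE kapE; have [u fu] := split_const Psi (g f).
by exists u; rewrite -{1}(Psi_g f) fu addrAC subrr add0r.
Qed.

(** The condition fixY is the case of cycles of length at least two, in which x
    must be preserved. As x is a polynomial in h and has degree one, h and x are
    then related by an affine substitution, which turns h into x. *)
Lemma plane_coordinate (fixY : Prop) :
    (fixY -> exists c, Psi c%:P = 'X%:P) ->
  exists (h : D2) (a b : D),
  [/\ subst2 a b h = 'X, subst2 a b (Psi 'X) = 0,
      exists u, subst1 h a - 'X%:P = Psi 'X * u,
      exists u, subst1 h b - 'X = Psi 'X * u &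
      fixY -> h = 'X%:P /\ a = 'X].
Proof.
move=> CY; have [h [a [b [hX s0 retr C_h [inj_h h_deg _]]]]] := plane_coordinate_subring.
have aY : exists u, subst1 h a - 'X%:P = Psi 'X * u.
  have [u Yu] := retr 'X%:P; exists (- u).
  by rewrite mulrN -Yu subst2Y opprB.
have bX : exists u, subst1 h b - 'X = Psi 'X * u.
  by have [u Xu] := retr 'X; exists (- u); rewrite mulrN -Xu subst2X opprB.
have [/CY[c cY]|nfix] := pselect fixY; last by exists h, a, b; split.
have [p Yp] := C_h c.
have {Yp} Yp : 'X%:P = subst1 h p by rewrite -cY Yp.
have ap : a = p.
  have p1 : subst2 a b (subst1 h p) = p.
    rewrite -[RHS]comp_polyXr -hX; elim/poly_ind: (p) => [|q d IHq].
      by rewrite comp_poly0 !rmorph0.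
    rewrite subst1_MXaddC comp_poly_MXaddC [LHS]rmorphD [X in X + _]rmorphM.
    by congr (_ * _ + _); [exact: IHq | exact: subst2C].
  by rewrite -[RHS]p1 -Yp subst2Y.
(* Degrees are additive and h has positive degree, so x = p(h) forces p to be
   affine. *)
have [e [d [e0 pE]]] : exists e d : k, e != 0 /\ p = e%:P * 'X + d%:P.
  have := Yp; rewrite -(poly_take_drop 1 p); set q := drop_poly 1 p.
  have -> : take_poly 1 p = (p`_0)%:P.
    by apply/polyP=> i; rewrite coef_take_poly coefC; case: i.
  rewrite expr1 addrC subst1_MXaddC; set d := p`_0 => /eqP.
  rewrite -subr_eq => /eqP/esym Yd.
  have Yd1 : bideg ('X%:P - d%:P%:P) = 1%N.
    by rewrite -polyCB /bideg lead_coefC size_polyC polyXsubC_eq0 size_XsubC.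
  have q0 : subst1 h q != 0.
    apply/eqP => q0; move: Yd1; rewrite -Yd q0 mul0r /bideg lead_coef0.
    by rewrite !size_poly0.
  have h0 : h != 0 by apply: contraTneq h_deg => ->; rewrite /bideg lead_coef0 !size_poly0.
  move: Yd1; rewrite -Yd bidegM // => hq.
  have /bideg0P[e qe] : bideg (subst1 h q) = 0%N by move: hq h_deg; lia.
  have {}qe : q = e%:P by apply: inj_h; rewrite qe; apply/esym/subst1C.
  exists e, d; split; last by rewrite qe.
  by apply: contraNneq q0 => e0; rewrite qe e0 polyC0 rmorph0.
pose w : D := e^-1%:P * ('X - d%:P).
have hw : h = w%:P.
  rewrite /w polyCM polyCB Yp pE subst1_MXaddC.
  have -> : subst1 h e%:P = e%:P%:P by exact: subst1C.
  by rewrite addrK mulrA -!polyCM mulVf // mul1r.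
exists 'X%:P, 'X, (b \Po w); split=> //.
- by rewrite subst2Y.
- have -> : subst2 'X (b \Po w) (Psi 'X) = subst2 a b (Psi 'X) \Po w.
    have := @eq_rmorph_poly2 k D 1 (subst2 'X (b \Po w)) (comp_poly w \o subst2 a b).
    move=> /(_ _ _ _ _ (Psi 'X)); rewrite !mul1r /=; apply=> [x|x||].
    + by rewrite mulrC.
    + by rewrite !mul1r !subst2C comp_polyC.
    + rewrite !subst2Y ap pE comp_polyD comp_polyM comp_polyX !comp_polyC.
      by rewrite /w mulrA -polyCM divff // mul1r subrK.
    + by rewrite !subst2X.
  by rewrite s0 comp_poly0.
- by exists 0; rewrite subst1X subrr mulr0.
have -> : subst1 'X%:P (b \Po w) = subst1 h b; last exact: bX.
rewrite hw; have cl (q : D) : subst1 'X%:P q = q%:P.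
  elim/poly_ind: q => [|q r IHq]; first exact: rmorph0.
  by rewrite subst1_MXaddC IHq polyCD polyCM.
rewrite cl; elim/poly_ind: (b) => [|q r IHq].
  by rewrite comp_poly0; apply/esym; exact: rmorph0.
by rewrite comp_poly_MXaddC subst1_MXaddC -IHq polyCD polyCM.
Qed.

End PlaneCoordinate.

(** * Polynomials that divide their translates *)
Section TranslationInvariance.
Variable k : fieldType.
Local Notation D2 := {poly {poly k}}.
Variables (C : comNzRingType) (Psi : {rmorphism {poly C} -> D2}).
Hypothesis inj_Psi : injective Psi.
Hypothesis surj_Psi : forall f, exists p, Psi p = f.

(** If q divides q(T + c), then both are equal since they have the same degree
    and leading coefficient. So q - q(0) vanishes at every c in C, which is an
    infinite set because it contains the powers of the coordinate h. *)
Lemma const_of_translates (q : {poly C}) :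
    (forall c, exists u, Psi (q \Po ('X + c%:P)) = Psi q * u) ->
  exists c, q = c%:P.
Proof.
have [h [a [b [_ _ _ _ [inj_h _ [y yh]]]]]] := plane_coordinate_subring inj_Psi surj_Psi.
move=> trans_q; have [q0|q0] := eqVneq q 0; first by exists 0.
pose i : {rmorphism C -> D2} := Psi \o polyC.
have inj_i : injective i by apply: inj_comp => //; apply: polyC_inj.
have i0 : i 0 = 0 by rewrite rmorph0.
pose Q := map_poly i q.
have szQ : size Q = size q by rewrite /Q size_map_inj_poly.
have Q0 : Q != 0 by rewrite -size_poly_eq0 szQ size_poly_eq0.
have Q_trans c : Q \Po ('X + (i c)%:P) = Q.
  have [u qu] := trans_q c; have [v vu] := surj_Psi u.
  have {}qu : q \Po ('X + c%:P) = q * v by apply: inj_Psi; rewrite rmorphM vu.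
  have Qu : Q \Po ('X + (i c)%:P) = Q * map_poly i v.
    rewrite -rmorphM -qu /= map_comp_poly rmorphD /= map_polyX map_polyC.
    by [].
  have szX : size ('X + (i c)%:P) = 2%N.
    by rewrite size_XaddC.
  have := size_comp_poly2 Q szX; rewrite Qu.
  have [V0|V0] := eqVneq (map_poly i v) 0.
    by rewrite V0 mulr0 size_poly0 => /esym/eqP; rewrite size_poly_eq0 (negbTE Q0).
  rewrite size_mul // => sz.
  have /size1_polyC VC : (size (map_poly i v) <= 1)%N.
    move: sz Q0 V0; rewrite -!size_poly_gt0.
    case: (size Q) => // n; case: (size _) => // m.
    by rewrite addSn addnS /= => /eqP; rewrite -[X in _ == X]addn0 -addSn eqn_add2l; case: m.
  have := lead_coef_comp Q (q := 'X + (i c)%:P); rewrite szX => /(_ isT).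
  rewrite Qu VC lead_coefM lead_coefXaddC expr1n lead_coefC.
  move/mulfI; rewrite lead_coef_eq0 => /(_ Q0) ->; by rewrite mulr1.
have root_Q c : root (Q - (Q`_0)%:P) (i c).
  rewrite /root hornerD hornerN hornerC -[in Q`_0](Q_trans c) -horner_coef0.
  by rewrite horner_comp hornerD hornerX hornerC add0r subrr.
(* More roots than the degree allows: the powers of h. *)
pose rs := [seq i (y ^+ n) | n <- iota 0 (size Q)].
have uniq_rs : uniq rs.
  rewrite map_inj_uniq ?iota_uniq // => m n /=.
  rewrite !rmorphXn /= yh => hmn.
  have : subst1 h 'X^m = subst1 h 'X^n.
    transitivity (h ^+ m); last first.
      by rewrite hmn; rewrite [RHS]rmorphXn; congr (_ ^+ _); apply/esym/subst1X.
    by rewrite [LHS]rmorphXn; congr (_ ^+ _); apply/subst1X.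
  by move/inj_h/(congr1 (size \o @polyseq _)); rewrite /= !size_polyXn => -[].
have : Q - (Q`_0)%:P = 0.
  apply/eqP/negP => /negP nz; have := max_poly_roots nz.
  move=> /(_ rs _ uniq_rs); rewrite size_map size_iota => H.
  have : (size Q < size (Q - (Q`_0)%:P)%R)%N by apply: H; apply/allP => _ /mapP[n _ ->].
  rewrite ltnNge (leq_trans (size_polyD _ _)) // geq_max leqnn size_polyN.
  by rewrite (leq_trans (size_polyC_leq1 _)) // size_poly_gt0.
move/eqP; rewrite subr_eq0 => /eqP QC; exists q`_0.
apply/size1_polyC; rewrite -szQ QC; exact: size_polyC_leq1.
Qed.
End TranslationInvariance.

(** * Factors cut out by idempotents *)
Section ImageRing.
Variables (Z : nzRingType) (T : comNzRingType) (j : {rmorphism Z -> T}).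

Definition image_pred : {pred T} := fun y => `[< exists z, j z = y >].

Fact image_pred_subring : subring_closed image_pred.
Proof.
split=> [|x y /asboolP[a <-] /asboolP[b <-]|x y /asboolP[a <-] /asboolP[b <-]].
- by apply/asboolP; exists 1; rewrite rmorph1.
- by apply/asboolP; exists (a - b); rewrite rmorphB.
- by apply/asboolP; exists (a * b); rewrite rmorphM.
Qed.
HB.instance Definition _ := GRing.isSubringClosed.Build T image_pred image_pred_subring.

Definition image_ring := {y : T | y \in image_pred}.
HB.instance Definition _ := SubChoice.on image_ring.
HB.instance Definition _ := [SubChoice_isSubComNzRing of image_ring by <:].

Lemma image_ring_surj : exists2 p : {rmorphism Z -> image_ring},
  forall z, val (p z) = j z & forall c, exists z, p z = c.
Proof.
have [p pE] : exists p : {rmorphism Z -> image_ring}, forall z, val (p z) = j z.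
  apply: rmorph_lift; first exact: val_inj.
  by move=> z; have jz : j z \in image_pred by [apply/asboolP; exists z]; exists (Sub (j z) jz).
exists p => // c; have /asboolP[z zc] := valP c.
by exists z; apply: val_inj; rewrite pE.
Qed.

End ImageRing.

(** C is the image of Z. The condition on the kernel says that j(t) is
    transcendental over C. *)
Lemma corner_presentation (Z T : comNzRingType) (j : {rmorphism {poly Z} -> T}) :
    (forall p, j p = 0 -> forall i, j (p`_i)%:P = 0) ->
  exists (C : comNzRingType) (r : {rmorphism Z -> C}) (Psi : {rmorphism {poly C} -> T}),
  [/\ injective Psi, forall p, Psi (map_poly r p) = j p & forall c, exists z, r z = c].
Proof.
move=> ker_j; pose i : {rmorphism Z -> T} := j \o polyC.
have [r rE r_surj] := image_ring_surj i.
pose v : {rmorphism image_ring i -> T} := val.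
pose Psi : {rmorphism {poly (image_ring i)} -> T} := horner_eval (j 'X) \o map_poly v.
have PsiX : Psi 'X = j 'X.
  exact: etrans (congr1 (horner_eval (j 'X)) (map_polyX v)) (hornerX _).
have PsiC c : Psi c%:P = val c.
  exact: etrans (congr1 (horner_eval (j 'X)) (map_polyC v c)) (hornerC _ _).
have PsiE p : Psi (map_poly r p) = j p.
  elim/poly_ind: p => [|p c IHp]; first by rewrite !rmorph0.
  rewrite !rmorphD !rmorphM IHp; congr (_ * _ + _).
    exact: etrans (congr1 Psi (map_polyX r)) PsiX.
  exact: etrans (congr1 Psi (map_polyC r c)) (etrans (PsiC _) (rE c)).
exists (image_ring i), r, Psi; split=> //.
apply: raddf_inj => q; have [p <-] : exists p, map_poly r p = q.
  have [s sK] := choice r_surj; exists (\poly_(l < size q) s q`_l).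
  apply/polyP=> l; rewrite coef_map coef_poly /=.
  by case: ltnP => [_|/leq_sizeP->//]; rewrite ?sK ?rmorph0.
move=> /(etrans (esym (PsiE p)))/ker_j jp; apply/polyP=> l; rewrite coef_map coef0 /=.
by apply: val_inj; rewrite rE /i /= jp.
Qed.

(** An idempotent without constant term is divisible by every power of the
    variable, hence zero; this applies to the products of e with 1 - c and of
    1 - e with c, for c the constant term of e. *)
Lemma idempotent_poly_const (R : comNzRingType) (e : {poly R}) :
  e * e = e -> exists2 c, e = c%:P & c * c = c.
Proof.
have nil0 (f : {poly R}) : f * f = f -> f`_0 = 0 -> f = 0.
  move=> ff f0; have fX : f = drop_poly 1 f * 'X.
    rewrite -{1}(poly_take_drop 1 f) expr1; have -> : take_poly 1 f = 0.
      by apply/polyP => i; rewrite coef_take_poly coef0; case: i.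
    by rewrite add0r.
  have fn n : f = f ^+ n.+1 by elim: n => // n IHn; rewrite exprS -IHn ff.
  apply/polyP => i; rewrite coef0 (fn i) {1}fX exprMn coefMXn.
  by rewrite ltnS leqnn.
move=> ee; set c := e`_0; have cc : c * c = c by rewrite /c -coef0M ee.
exists c => //; have e1 : (1 - c%:P) * e = 0.
  apply: nil0; last by rewrite coef0M coefB coef1 coefC mulrBl mul1r cc subrr.
  rewrite mulrACA ee; congr (_ * _).
  by rewrite mulrBl mul1r mulrBr mulr1 -polyCM cc subrr subr0.
have e2 : c%:P * (1 - e) = 0.
  apply: nil0; last by rewrite coef0M coefB coef1 coefC mulrBr mulr1 cc subrr.
  rewrite mulrACA -polyCM cc; congr (_ * _).
  by rewrite mulrBl mul1r mulrBr mulr1 ee subrr subr0.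
move/eqP: e1; rewrite mulrBl mul1r subr_eq0 => /eqP ->.
by move/eqP: e2; rewrite mulrBr mulr1 subr_eq0 => /eqP <-.
Qed.

Section Components.
Variables (Z' Z : comNzRingType) (Phi : {rmorphism {poly Z'} -> {poly Z}}).
Hypothesis inj_Phi : injective Phi.
Hypothesis surj_Phi : forall f, exists p, Phi p = f.

Section Presentation.
Variables (T : comNzRingType) (rho : {rmorphism Z -> T}) (e : Z).
Hypothesis ee : e * e = e.
Hypothesis rho_e : rho e = 1.
Hypothesis ker_rho : forall z, rho z = 0 -> e * z = 0.
Hypothesis surj_rho : forall t, exists z, rho z = t.

(** Under Phi the idempotent e corresponds to a constant idempotent of Z'[t], so
    the kernel of Z'[t] -> T[t] is generated by an element of Z' and is closed
    under taking coefficients. *)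
Lemma component_presentation :
  exists (C : comNzRingType) (r : {rmorphism Z' -> C}) (Psi : {rmorphism {poly C} -> {poly T}}),
  [/\ injective Psi, forall f, exists p, Psi p = f,
      forall p, Psi (map_poly r p) = map_poly rho (Phi p) & forall c, exists z, r z = c].
Proof.
pose j : {rmorphism {poly Z'} -> {poly T}} := map_poly rho \o Phi.
have j_surj f : exists p, j p = f.
  have [s sK] := choice surj_rho; have [p pE] := surj_Phi (\poly_(l < size f) s f`_l).
  exists p; rewrite /j /= pE; apply/polyP => l; rewrite coef_map coef_poly /=.
  by case: ltnP => [_|/leq_sizeP->//]; rewrite ?sK ?rmorph0.
have [C [r [Psi [inj_Psi PsiE r_surj]]]] : exists (C : comNzRingType)
    (r : {rmorphism Z' -> C}) (Psi : {rmorphism {poly C} -> {poly T}}),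
    [/\ injective Psi, forall p, Psi (map_poly r p) = j p & forall c, exists z, r z = c].
  apply: corner_presentation => p jp i.
  have [e1 e1E] := surj_Phi e%:P.
  have [c ec _] : exists2 c, e1 = c%:P & c * c = c.
    by apply: idempotent_poly_const; apply: inj_Phi; rewrite rmorphM e1E -polyCM ee.
  have ker_j q : j q = 0 -> e%:P * Phi q = 0.
    move=> jq; apply/polyP => l; rewrite coefCM coef0; apply: ker_rho.
    by have /(congr1 (fun q : {poly T} => q`_l)) := jq; rewrite /j /= coef_map coef0.
  have cp : c%:P * p = 0 by apply: inj_Phi; rewrite rmorphM -ec e1E ker_j ?rmorph0.
  have : e%:P * Phi (p`_i)%:P = 0.
    rewrite -e1E -rmorphM ec -polyCM -coefCM cp coef0 polyC0.
    exact: rmorph0.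
  move/(congr1 (map_poly rho)); rewrite rmorphM rmorph0.
  by rewrite [X in X * _](map_polyC rho) /= rho_e mul1r.
exists C, r, Psi; split=> // f; have [p <-] := j_surj f.
by exists (map_poly r p).
Qed.

End Presentation.

Lemma component_line (k : fieldType) (rho : {rmorphism Z -> k}) (e : Z) :
    e * e = e -> rho e = 1 -> (forall z, rho z = 0 -> e * z = 0) ->
    (forall t, exists z, rho z = t) ->
  exists b : k, (map_poly rho (Phi 'X)).[b] = 0 /\
    exists u, 'X - b%:P = map_poly rho (Phi 'X) * u.
Proof.
move=> ee re kr sr.
have [C [r [Psi [inj_Psi surj_Psi PsiE _]]]] := component_presentation ee re kr sr.
by rewrite -PsiE map_polyX; apply: line_coordinate.
Qed.

(** The last hypothesis is the form in which twin modules give information on x: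
    the translates of its preimage p are divisible by x. *)
Lemma component_plane (k : fieldType) (rho : {rmorphism Z -> {poly k}}) (e : Z)
    (x : Z) (p : {poly Z'}) (fixY : Prop) :
    e * e = e -> rho e = 1 -> (forall z, rho z = 0 -> e * z = 0) ->
    (forall t, exists z, rho z = t) ->
    rho x = 'X -> Phi p = x%:P ->
    (fixY -> forall b, exists u, map_poly rho (Phi (p \Po ('X + b%:P))) = 'X%:P * u) ->
  exists (h : {poly {poly k}}) (a b : {poly k}),
  [/\ subst2 a b h = 'X, subst2 a b (map_poly rho (Phi 'X)) = 0,
      exists u, subst1 h a - 'X%:P = map_poly rho (Phi 'X) * u,
      exists u, subst1 h b - 'X = map_poly rho (Phi 'X) * u &
      fixY -> h = 'X%:P /\ a = 'X].
Proof.
move=> ee re kr sr rx px trans_p.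
have [C [r [Psi [inj_Psi surj_Psi PsiE r_surj]]]] := component_presentation ee re kr sr.
have PsiX : Psi 'X = map_poly rho (Phi 'X) by rewrite -PsiE map_polyX.
rewrite -PsiX; apply: plane_coordinate => // /trans_p {}trans_p.
have pY : Psi (map_poly r p) = 'X%:P by rewrite PsiE px map_polyC /= rx.
have [|c pc] := @const_of_translates _ _ _ inj_Psi surj_Psi (map_poly r p).
  move=> c; have [b <-] := r_surj c; have [u tu] := trans_p b.
  exists u; rewrite pY -tu -PsiE map_comp_poly rmorphD /= map_polyX map_polyC.
  by [].
by exists c; rewrite -pc.
Qed.

End Components.

(** * Equivalences of categories *)
Lemma quasi_inverse_sym (C D : category) (F : functor C D) (G : functor D C) :
  quasi_inverse F G -> quasi_inverse G F.
Proof. by case. Qed.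

Definition mono (E : category) (X Y : E) (f : hom X Y) :=
  forall (W : E) (g h : hom W X), comp f g = comp f h -> g = h.

(** In a module category this singles out zero morphisms without mentioning the
    additive structure (constant_homP). *)
Definition constant_hom (E : category) (X Y : E) (f : hom X Y) :=
  forall (W : E) (g h : hom W X), comp f g = comp f h.

Section Equivalences.
Variables (C D : category) (F : functor C D) (G : functor D C).
Hypothesis FG : quasi_inverse F G.

Lemma equivalence_faithful (X Y : C) (f g : hom X Y) : fmap F f = fmap F g -> f = g.
Proof.
case: FG => -[eta [theta [nat_eta _ eta_theta]]] _ Ffg.
have def h : h = comp (comp (eta Y) (fmap G (fmap F h))) (theta X).
  by have := nat_eta X Y h => /= ->; rewrite -compA eta_theta compm1.
by rewrite (def f) (def g) Ffg.
Qed.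
End Equivalences.

Section EquivalencesFull.
Variables (C D : category) (F : functor C D) (G : functor D C).
Hypothesis FG : quasi_inverse F G.

Lemma equivalence_full (X Y : C) (h : hom (F X) (F Y)) : exists f : hom X Y, fmap F f = h.
Proof.
case: (FG) => -[eta [theta [nat_eta theta_eta eta_theta]]] _.
exists (comp (comp (eta Y) (fmap G h)) (theta X)).
apply: (equivalence_faithful (quasi_inverse_sym FG)).
set f := comp _ (theta X).
have := nat_eta X Y f => /= /(congr1 (comp (theta Y))).
rewrite compA theta_eta comp1m => ->.
by rewrite /f -!compA theta_eta compm1 compA theta_eta comp1m.
Qed.

Lemma equivalence_essentially_surjective (Y : D) :
  exists (u : hom (F (G Y)) Y) (v : hom Y (F (G Y))),
    comp u v = idm Y /\ comp v u = idm (F (G Y)).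
Proof.
case: FG => _ [eta [theta [_ te et]]]; exists (eta Y), (theta Y).
by split; [exact: et | exact: te].
Qed.

(** Every object is isomorphic to one in the image of F, so cancellation
    properties of morphisms into F X may be tested on morphisms in the image. *)
Lemma equivalence_precomp (X : C) (Y : D) (g h : hom Y (F X)) :
  exists (u : hom (F (G Y)) Y) (v : hom Y (F (G Y))) (g' h' : hom (G Y) X),
  [/\ comp u v = idm Y, comp g u = fmap F g' & comp h u = fmap F h'].
Proof.
have [u [v [uv _]]] := equivalence_essentially_surjective Y.
have [g' gE] := equivalence_full (comp g u).
have [h' hE] := equivalence_full (comp h u).
by exists u, v, g', h'.
Qed.

Lemma equivalence_mono (X Y : C) (f : hom X Y) : mono f -> mono (fmap F f).
Proof.
move=> mf W g h fgh; have [u [v [g' [h' [uv gE hE]]]]] := equivalence_precomp g h.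
rewrite -[g]compm1 -[h]compm1 -uv !compA gE hE; congr (comp (fmap F _) v).
by apply/mf/(equivalence_faithful FG); rewrite !fmapM -gE -hE !compA fgh.
Qed.

Lemma equivalence_constant (X Y : C) (f : hom X Y) :
  constant_hom f -> constant_hom (fmap F f).
Proof.
move=> cf W g h; have [u [v [g' [h' [uv gE hE]]]]] := equivalence_precomp g h.
rewrite -[g]compm1 -[h]compm1 -uv !compA -!(compA _ _ u) gE hE.
by rewrite -!fmapM (cf _ g' h').
Qed.

End EquivalencesFull.

Section Linear.
Variables (R : nzRingType) (M N : lmodType R).

Definition mk_linear (f : M -> N) (f_lin : linear f) : {linear M -> N} :=
  HB.pack f (GRing.isLinear.Build R M N *:%R f f_lin).
Definition lin_add (f g : {linear M -> N}) : {linear M -> N} := f \+ g.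
Definition lin_zero : {linear M -> N} := \0.
End Linear.

Lemma constant_homP (R : nzRingType) (M N : lmodType R) (f : @hom (leftMod R) M N) :
  constant_hom f <-> f = lin_zero M N.
Proof.
split=> [cf | -> W g h]; last exact: linear_ext.
have := cf M (lin_id M) (lin_zero M M) => ff; apply: linear_ext => x.
have : (comp f (lin_id M) : {linear M -> N}) x = (comp f (lin_zero M M) : {linear M -> N}) x.
  by rewrite ff.
by rewrite /= linear0.
Qed.
Section Additivity.
Variables (R S : nzRingType)
  (F : functor (leftMod R) (leftMod S)) (G : functor (leftMod S) (leftMod R)).
Hypothesis FG : quasi_inverse F G.
Implicit Types M N : lmodType R.

Lemma equivalence_zero M N :
  fmap F (lin_zero M N : @hom (leftMod R) M N) = lin_zero (F M) (F N).
Proof. by apply/constant_homP/(equivalence_constant FG)/constant_homP. Qed.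

(** The sum of f and g is the composite of (f, g) : M -> N + N with the sum of
    the two projections. F preserves zero morphisms, so the sum of the projections
    may be compared on the two injections, which remain jointly epimorphic under
    F. *)
Lemma equivalence_add M N (f g : @hom (leftMod R) M N) :
  fmap F (lin_add f g : @hom (leftMod R) M N) = lin_add (fmap F f) (fmap F g).
Proof.
pose N2 : lmodType R := (N * N)%type.
have fst_lin : linear (fst : N2 -> N) by [].
have snd_lin : linear (snd : N2 -> N) by [].
have inl_lin : linear (fun x => (x, 0) : N2).
  by move=> a x y; congr (_, _); rewrite /= scaler0 addr0.
have inr_lin : linear (fun x => (0, x) : N2).
  by move=> a x y; congr (_, _); rewrite /= scaler0 addr0.
have fg_lin : linear (fun x => (f x, g x) : N2).
  by move=> a x y; congr (_, _); rewrite linearP.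
pose p1 : @hom (leftMod R) N2 N := mk_linear fst_lin.
pose p2 : @hom (leftMod R) N2 N := mk_linear snd_lin.
pose i1 : @hom (leftMod R) N N2 := mk_linear inl_lin.
pose i2 : @hom (leftMod R) N N2 := mk_linear inr_lin.
pose fg : @hom (leftMod R) M N2 := mk_linear fg_lin.
(* Fullness replaces Y by an object in the image of F, where the two injections
   of the biproduct can be used. *)
have epi (Y : lmodType S) (u v : @hom (leftMod S) (F N2) Y) :
    comp u (fmap F i1) = comp v (fmap F i1) -> comp u (fmap F i2) = comp v (fmap F i2) -> u = v.
  move=> uv1 uv2; have [a [b [ab ba]]] := equivalence_essentially_surjective FG Y.
  have [u' uE] := equivalence_full FG (comp b u : hom (F N2) (F (G Y))).
  have [v' vE] := equivalence_full FG (comp b v : hom (F N2) (F (G Y))).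
  rewrite -[u]comp1m -[v]comp1m -ab -!compA -uE -vE; congr (comp a (fmap F _)).
  have e1 : comp u' i1 = comp v' i1.
    by apply: (equivalence_faithful FG); rewrite !fmapM uE vE -!compA uv1.
  have e2 : comp u' i2 = comp v' i2.
    by apply: (equivalence_faithful FG); rewrite !fmapM uE vE -!compA uv2.
  apply: linear_ext => -[x y].
  have -> : (x, y) = i1 x + i2 y :> N2 by congr (_, _); rewrite /= ?addr0 ?add0r.
  rewrite !linearD; congr (_ + _).
    exact: (congr1 (fun h : {linear N -> G Y} => h x) e1).
  exact: (congr1 (fun h : {linear N -> G Y} => h y) e2).
have F12 : fmap F (lin_add p1 p2 : @hom (leftMod R) N2 N) = lin_add (fmap F p1) (fmap F p2).
  apply: epi.
    rewrite -fmapM (_ : comp _ i1 = idm (N : leftMod R)); last first.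
      by apply: linear_ext => x /=; rewrite addr0.
    rewrite fmap1; apply: linear_ext => x /=.
    have /(congr1 (fun h : {linear _ -> _} => h x)) /= := esym (fmapM F p1 i1).
    have /(congr1 (fun h : {linear _ -> _} => h x)) /= := esym (fmapM F p2 i1).
    rewrite (_ : lin_comp p2 i1 = lin_zero N N) ?equivalence_zero; last exact: linear_ext.
    rewrite (_ : lin_comp p1 i1 = idm (N : leftMod R)) ?fmap1; last exact: linear_ext.
    by move=> /= -> ->; rewrite addr0.
  rewrite -fmapM (_ : comp _ i2 = idm (N : leftMod R)); last first.
    by apply: linear_ext => x /=; rewrite add0r.
  rewrite fmap1; apply: linear_ext => x /=.
  have /(congr1 (fun h : {linear _ -> _} => h x)) /= := esym (fmapM F p1 i2).
  have /(congr1 (fun h : {linear _ -> _} => h x)) /= := esym (fmapM F p2 i2).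
  rewrite (_ : lin_comp p1 i2 = lin_zero N N) ?equivalence_zero; last exact: linear_ext.
  rewrite (_ : lin_comp p2 i2 = idm (N : leftMod R)) ?fmap1; last exact: linear_ext.
  by move=> /= -> ->; rewrite add0r.
have -> : lin_add f g = comp (lin_add p1 p2 : @hom (leftMod R) N2 N) fg by apply: linear_ext.
rewrite fmapM F12; apply: linear_ext => x /=; congr (_ + _).
  have /(congr1 (fun h : {linear _ -> _} => h x)) /= := esym (fmapM F p1 fg).
  by rewrite (_ : lin_comp p1 fg = f) //; apply: linear_ext.
have /(congr1 (fun h : {linear _ -> _} => h x)) /= := esym (fmapM F p2 fg).
by rewrite (_ : lin_comp p2 fg = g) //; apply: linear_ext.
Qed.
End Additivity.

(** * Centers of module categories *)
Section Center.
Variable R : nzRingType.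

Definition center_pred : {pred R} := fun z => `[< forall x, z * x = x * z >].

Fact center_subring : subring_closed center_pred.
Proof.
split=> [|x y /asboolP cx /asboolP cy|x y /asboolP cx /asboolP cy];
  apply/asboolP => z.
- by rewrite mul1r mulr1.
- by rewrite mulrBl mulrBr cx cy.
- by rewrite -mulrA cy mulrA cx mulrA.
Qed.
HB.instance Definition _ := GRing.isSubringClosed.Build R center_pred center_subring.

Definition center := {z : R | z \in center_pred}.
HB.instance Definition _ := SubChoice.on center.
HB.instance Definition _ := [SubChoice_isSubNzRing of center by <:].

Lemma centerP (z : center) (x : R) : val z * x = x * val z.
Proof. by have /asboolP := valP z. Qed.

Fact center_mulC : commutative (@GRing.mul center).
Proof. by move=> x y; apply: val_inj; rewrite !rmorphM centerP. Qed.
HB.instance Definition _ := GRing.PzRing_hasCommutativeMul.Build center center_mulC.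

Definition center_val : {rmorphism center -> R} := val.

Definition mk_center (z : R) (cz : forall x, z * x = x * z) : center :=
  Sub z (introT (asboolP _) cz).

Lemma mk_centerE z cz : val (@mk_center z cz) = z. Proof. exact: SubK. Qed.

Fact center_act_linear (z : center) (M : lmodType R) : linear (fun x : M => (val z : R) *: x).
Proof. by move=> a x y; rewrite scalerDr !scalerA centerP. Qed.

Definition center_act (z : center) (M : lmodType R) : {linear M -> M} :=
  mk_linear (@center_act_linear z M).

Arguments center_act : clear implicits.

Lemma center_actE z M x : center_act z M x = (val z : R) *: x. Proof. by []. Qed.

Lemma center_act_inj (y z : center) :
  (forall M, center_act y M = center_act z M) -> y = z.
Proof.
move=> yz; apply: val_inj.
have := congr1 (fun h : {linear R^o -> R^o} => h 1) (yz R^o).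
by rewrite /= /GRing.scale /= !mulr1.
Qed.

(** Naturality along the maps R -> M, r |-> r m, shows that a natural
    endomorphism is determined by its value at 1. *)
Lemma natural_endo_center (tau : forall M : lmodType R, {linear M -> M}) :
    (forall (M N : lmodType R) (h : {linear M -> N}) x, h (tau M x) = tau N (h x)) ->
  exists z : center, forall M, tau M = center_act z M.
Proof.
move=> nat_tau.
have ev_lin (M : lmodType R) (m : M) : linear (fun r : R^o => r *: m).
  by move=> a x y; rewrite scalerDl scalerA.
have tauE (M : lmodType R) (m : M) : tau M m = (tau R^o 1 : R) *: m.
  by have := nat_tau _ _ (mk_linear (ev_lin M m)) 1; rewrite /= scale1r => ->.
have cz x : (tau R^o 1 : R) * x = x * (tau R^o 1 : R).
  have xx : x *: (1 : R^o) = x by exact: mulr1.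
  have zx : tau R^o (x *: (1 : R^o)) = x *: tau R^o 1 by rewrite linearZ.
  by have := tauE R^o x; rewrite -{1}xx zx.
exists (mk_center cz) => M; apply: linear_ext => m.
by rewrite center_actE mk_centerE tauE.
Qed.
End Center.
Arguments center_act {R} z M.

Section CenterTransport.
Variables (R S : nzRingType)
  (F : functor (leftMod R) (leftMod S)) (G : functor (leftMod S) (leftMod R)).
Hypothesis FG : quasi_inverse F G.

Lemma equivalence_center_exists (z : center S) : exists y : center R,
  forall M : lmodType R, fmap F (center_act y M : @hom (leftMod R) M M) = center_act z (F M).
Proof.
have [tau tauE] : exists tau : forall M : lmodType R, {linear M -> M},
    forall M, fmap F (tau M : @hom (leftMod R) M M) = center_act z (F M).
  have h (M : lmodType R) :=
    cid (equivalence_full FG (center_act z (F M) : @hom (leftMod S) (F M) (F M))).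
  by exists (fun M => projT1 (h M)) => M; exact: projT2 (h M).
have [|y yE] := @natural_endo_center R tau.
  move=> M N h x.
  suff : comp (h : @hom (leftMod R) M N) (tau M) = comp (tau N : @hom (leftMod R) N N) h.
    by move/(congr1 (fun h : {linear M -> N} => h x)).
  apply: (equivalence_faithful FG); rewrite !fmapM !tauE; apply: linear_ext => m /=.
  by rewrite linearZ.
by exists y => M; rewrite -yE tauE.
Qed.
End CenterTransport.

Section CenterIso.
Variables (R S : nzRingType)
  (F : functor (leftMod R) (leftMod S)) (G : functor (leftMod S) (leftMod R)).
Hypothesis FG : quasi_inverse F G.

(** F is full and faithful, so the action of z on the modules F M comes from a
    natural endomorphism of the identity, which is the action of a central
    element of R. *)
Lemma equivalence_center :
  exists phi : {rmorphism center S -> center R},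
  [/\ injective phi, forall y, exists z, phi z = y &
      forall z (M : lmodType R),
        fmap F (center_act (phi z) M : @hom (leftMod R) M M) = center_act z (F M)].
Proof.
have /choice[f fE] := equivalence_center_exists FG.
have uniq z y : (forall M : lmodType R,
    fmap F (center_act y M : @hom (leftMod R) M M) = center_act z (F M)) -> f z = y.
  move=> yE; apply: center_act_inj => M; apply: (equivalence_faithful FG).
  by rewrite fE yE.
have fD : zmod_morphism f.
  move=> x y; apply: uniq => M.
  have -> : center_act (f x - f y) M = lin_add (center_act (f x) M) (center_act (- f y) M).
    by apply: linear_ext => m; rewrite /= scalerBl scaleNr.
  have FN : fmap F (center_act (- f y) M : @hom (leftMod R) M M) = center_act (- y) (F M).
    have := equivalence_add FG (center_act (f y) M) (center_act (- f y) M).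
    rewrite (_ : lin_add _ _ = lin_zero M M); last first.
      by apply: linear_ext => m; rewrite /= scaleNr subrr.
    rewrite (equivalence_zero FG) fE => /(congr1 (fun h : {linear _ -> _} => (h : F M -> F M))) e.
    apply: linear_ext => m; have := congr1 (fun h => h m) e => /= /esym/eqP.
    by rewrite addrC addr_eq0 => /eqP ->; rewrite scaleNr.
  rewrite (equivalence_add FG) fE FN; apply: linear_ext => m.
  by rewrite /= scalerBl scaleNr.
have f1M : monoid_morphism f.
  split=> [|x y]; apply: uniq => M.
    rewrite (_ : center_act 1 M = idm (M : leftMod R)); last first.
      by apply: linear_ext => m; rewrite /= scale1r.
    by rewrite fmap1; apply: linear_ext => m; rewrite /= scale1r.
  rewrite (_ : center_act (f x * f y) M =
    comp (center_act (f x) M : @hom (leftMod R) M M) (center_act (f y) M)); last first.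
    by apply: linear_ext => m; rewrite /= scalerA.
  by rewrite fmapM !fE; apply: linear_ext => m; rewrite /= scalerA.
pose phi : {rmorphism center S -> center R} := HB.pack f
  (GRing.isZmodMorphism.Build _ _ f fD) (GRing.isMonoidMorphism.Build _ _ f f1M).
have fsurj y : exists z, f z = y.
  have [z zE] := equivalence_center_exists (quasi_inverse_sym FG) y.
  exists z; apply: uniq => M.
  apply: (equivalence_faithful (quasi_inverse_sym FG)); rewrite zE.
  have [[e [t [nat_e te' _]]] _] := FG.
  have nat_y := nat_e M M (center_act y M).
  have : fmap G (fmap F (center_act y M : @hom (leftMod R) M M)) =
    comp (t M) (comp (center_act y M : @hom (leftMod R) M M) (e M)).
    apply: etrans (congr1 (comp (t M)) nat_y).
    by apply: esym; rewrite compA te' comp1m.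
  move=> ->; apply: linear_ext => m /=.
  rewrite linearZ; congr (_ *: _).
  exact: (congr1 (fun h : {linear G (F M) -> G (F M)} => h m) (te' M)).
exists phi; split=> // x y fxy; apply: center_act_inj => N.
have [u [v [uv vu]]] := equivalence_essentially_surjective FG N.
have e : center_act x (F (G N)) = center_act y (F (G N)).
  by rewrite -!fE; congr (fmap F (center_act _ _)).
apply: linear_ext => n /=.
have un : u (v n) = n by have := congr1 (fun h : {linear N -> N} => h n) uv.
have un_act (z : center S) : (val z : S) *: n = u ((val z : S) *: v n) by rewrite linearZ un.
rewrite (un_act x) (un_act y); congr (u _).
by have := congr1 (fun h : {linear F (G N) -> F (G N)} => h (v n)) e.
Qed.
End CenterIso.

(** * Restriction of scalars and split quotients *)
Definition restr (A R : nzRingType) (f : {rmorphism A -> R}) (M : lmodType R) : Type := M.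

Section RestrictionOfScalars.
Variables (A R : nzRingType) (f : {rmorphism A -> R}) (M : lmodType R).

HB.instance Definition _ := GRing.Zmodule.on (restr f M).
Definition restr_scale (a : A) (x : restr f M) : restr f M := f a *: (x : M).
Fact restr_scaleA a b x : restr_scale a (restr_scale b x) = restr_scale (a * b) x.
Proof. by rewrite /restr_scale scalerA rmorphM. Qed.
Fact restr_scale1 : left_id 1 restr_scale.
Proof. by move=> x; rewrite /restr_scale rmorph1 scale1r. Qed.
Fact restr_scaleDr : right_distributive restr_scale +%R.
Proof. by move=> a x y; apply: scalerDr. Qed.
Fact restr_scaleDl x : {morph restr_scale^~ x : a b / a + b}.
Proof. by move=> a b; rewrite /restr_scale rmorphD scalerDl. Qed.
HB.instance Definition _ := GRing.Zmodule_isLmodule.Build A (restr f M)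
  restr_scaleA restr_scale1 restr_scaleDr restr_scaleDl.

Lemma restr_scaleE (a : A) (x : restr f M) : a *: x = (f a *: (x : M)).
Proof. by []. Qed.
End RestrictionOfScalars.

Section RestrictionFunctor.
Variables (A R : nzRingType) (f : {rmorphism A -> R}).

Fact restr_hom_linear (M N : lmodType R) (h : {linear M -> N}) :
  linear (h : restr f M -> restr f N).
Proof. by move=> a x y; rewrite !restr_scaleE; exact: linearP. Qed.

Definition restr_hom (M N : lmodType R) (h : {linear M -> N}) :
  {linear restr f M -> restr f N} := mk_linear (@restr_hom_linear M N h).

Fact restr_hom1 (M : lmodType R) : restr_hom (lin_id M) = lin_id (restr f M).
Proof. exact: linear_ext. Qed.

Fact restr_homM (M N P : lmodType R) (g : {linear N -> P}) (h : {linear M -> N}) :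
  restr_hom (lin_comp g h) = lin_comp (restr_hom g) (restr_hom h).
Proof. exact: linear_ext. Qed.

Definition restr_functor : functor (leftMod R) (leftMod A) :=
  @Functor (leftMod R) (leftMod A) (fun M => restr f M : lmodType A)
    restr_hom restr_hom1 restr_homM.

End RestrictionFunctor.

(** R/zR is isomorphic to A through th, and sg is a section of the quotient
    map. *)
Definition split_quotient (A R : nzRingType) (sg : {rmorphism A -> R})
    (th : {rmorphism R -> A}) (z : center R) : Prop :=
  [/\ cancel sg th, th (val z) = 0 &
      forall r, exists u, r - sg (th r) = val z * u].

Section SplitQuotient.
Variables (A R : nzRingType) (sg : {rmorphism A -> R}) (th : {rmorphism R -> A}) (z : center R).
Hypothesis quo : split_quotient sg th z.

(** On a module killed by z the elements r and sg (th r) act alike, so the module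
    is recovered from its restriction to A. *)
Lemma split_quotient_act (M : lmodType R) (r : R) (m : M) :
  center_act z M = lin_zero M M -> sg (th r) *: m = r *: m.
Proof.
case: quo => _ _ ker zM; have [u ru] := ker r; apply/esym/eqP.
rewrite -subr_eq0 -scalerBl ru -scalerA.
by have := congr1 (fun h : {linear M -> M} => h (u *: m)) zM; rewrite /= => ->.
Qed.

Lemma killed_restr_linear (M : lmodType R) :
  center_act z M = lin_zero M M -> linear (id : restr th (restr sg M) -> M).
Proof.
move=> zM r x y; change (sg (th r) *: (x : M) + (y : M) = r *: (x : M) + (y : M)).
by rewrite split_quotient_act.
Qed.

Lemma killed_restr_linearV (M : lmodType R) :
  center_act z M = lin_zero M M -> linear (id : M -> restr th (restr sg M)).
Proof.
move=> zM r x y; change (r *: (x : M) + (y : M) = sg (th r) *: (x : M) + (y : M)).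
by rewrite split_quotient_act.
Qed.

Lemma retract_restr_linear (M : lmodType A) : linear (id : restr sg (restr th M) -> M).
Proof.
case: quo => sgK _ _ a x y.
change (th (sg a) *: (x : M) + (y : M) = a *: (x : M) + (y : M)).
by rewrite sgK.
Qed.

Lemma retract_restr_linearV (M : lmodType A) : linear (id : M -> restr sg (restr th M)).
Proof.
case: quo => sgK _ _ a x y.
change (a *: (x : M) + (y : M) = th (sg a) *: (x : M) + (y : M)).
by rewrite sgK.
Qed.

Lemma center_act_restr (M : lmodType A) :
  center_act z (restr th M) = lin_zero (restr th M) (restr th M).
Proof.
case: quo => _ thz _; apply: linear_ext => m.
change (th (val z) *: (m : M) = 0); by rewrite thz scale0r.
Qed.

End SplitQuotient.

Section QuotientEquivalence.
Variables (R1 R2 : nzRingType)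
  (F : functor (leftMod R1) (leftMod R2)) (G : functor (leftMod R2) (leftMod R1)).
Hypothesis FG : quasi_inverse F G.
Variables (z1 : center R1) (z2 : center R2).
Hypothesis Fz : forall M : lmodType R1,
  fmap F (center_act z1 M : @hom (leftMod R1) M M) = center_act z2 (F M).
Variables (A1 A2 : nzRingType) (sg1 : {rmorphism A1 -> R1}) (th1 : {rmorphism R1 -> A1})
  (sg2 : {rmorphism A2 -> R2}) (th2 : {rmorphism R2 -> A2}).
Hypothesis quo1 : split_quotient sg1 th1 z1.
Hypothesis quo2 : split_quotient sg2 th2 z2.

Definition quotient_functor : functor (leftMod A1) (leftMod A2) :=
  compF (restr_functor sg2) (compF F (restr_functor th1)).
Definition quotient_functorV : functor (leftMod A2) (leftMod A1) :=
  compF (restr_functor sg1) (compF G (restr_functor th2)).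

(** The modules over A1 are the modules over R1 killed by z1, and F carries these
    to the modules killed by z2; on them, restriction along sg2 followed by
    restriction along th2 changes nothing. *)
Lemma quotient_functorK :
  nat_isomorphic (compF quotient_functorV quotient_functor) (idF (leftMod A1)).
Proof.
have [[eta [theta [nat_eta te et]]] _] := FG.
have zN (M : lmodType A1) : center_act z2 (F (restr th1 M)) = lin_zero _ _.
  by rewrite -Fz (center_act_restr quo1) (equivalence_zero FG).
pose kp M : @hom (leftMod R2) _ _ := mk_linear (killed_restr_linear quo2 (zN M)).
pose kpV M : @hom (leftMod R2) _ _ := mk_linear (killed_restr_linearV quo2 (zN M)).
pose rt M : @hom (leftMod A1) _ _ := mk_linear (retract_restr_linear quo1 (M := M)).
pose rtV M : @hom (leftMod A1) _ _ := mk_linear (retract_restr_linearV quo1 (M := M)).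
pose mid M : @hom (leftMod R1) _ _ := comp (eta (restr th1 M)) (fmap G (kp M)).
pose midV M : @hom (leftMod R1) _ _ := comp (fmap G (kpV M)) (theta (restr th1 M)).
exists (fun M => comp (rt M) (fmap (restr_functor sg1) (mid M))).
exists (fun M => comp (fmap (restr_functor sg1) (midV M)) (rtV M)).
have midK M : comp (midV M) (mid M) = idm _.
  rewrite /mid /midV compA -(compA _ (theta _)) te compm1 -fmapM -fmap1.
  by congr (fmap G _); apply: linear_ext.
have kpK M : comp (kp M) (kpV M) = idm (F (restr th1 M)) by exact: linear_ext.
have GkpK M : comp (fmap G (kp M)) (fmap G (kpV M)) = idm _.
  by rewrite -fmap1 -kpK fmapM.
have midVK M : comp (mid M) (midV M) = idm _.
  by rewrite /mid /midV -(compA (eta _)) (compA (fmap G (kp M))) GkpK comp1m et.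
have rtK M : comp (rtV M) (rt M) = idm _ by exact: linear_ext.
have rtVK M : comp (rt M) (rtV M) = idm (M : leftMod A1) by exact: linear_ext.
have smidK M := etrans (esym (fmapM (restr_functor sg1) (midV M) (mid M)))
  (etrans (congr1 (fmap (restr_functor sg1)) (midK M)) (fmap1 (restr_functor sg1) _)).
have smidVK M := etrans (esym (fmapM (restr_functor sg1) (mid M) (midV M)))
  (etrans (congr1 (fmap (restr_functor sg1)) (midVK M)) (fmap1 (restr_functor sg1) _)).
split.
- move=> M N f.
  have midN : comp (mid N) (fmap G (fmap (restr_functor th2)
        (fmap (restr_functor sg2) (fmap F (fmap (restr_functor th1) f))))) =
      comp (fmap (restr_functor th1) f) (mid M).
    rewrite /mid -compA -fmapM compA -nat_eta -compA -fmapM.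
    congr (comp _ (fmap G _)); exact: linear_ext.
  have FN := etrans (esym (fmapM (restr_functor sg1) _ _))
    (etrans (congr1 (fmap (restr_functor sg1)) midN) (fmapM (restr_functor sg1) _ _)).
  rewrite -[LHS]compA [X in comp _ X]FN compA [RHS]compA.
  by congr (comp _ _); exact: linear_ext.
- move=> M.
  rewrite -(compA (fmap (restr_functor sg1) (midV M))) (compA (rtV M)) rtK comp1m.
  exact: smidK.
move=> M; rewrite -(compA (rt M)) (compA (fmap (restr_functor sg1) (mid M))).
by rewrite [X in comp (rt M) (comp X _)]smidVK comp1m rtVK.
Qed.
End QuotientEquivalence.

Section QuotientEquivalenceInverse.
Variables (R1 R2 : nzRingType)
  (F : functor (leftMod R1) (leftMod R2)) (G : functor (leftMod R2) (leftMod R1)).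
Hypothesis FG : quasi_inverse F G.
Variables (z1 : center R1) (z2 : center R2).
Hypothesis Fz : forall M : lmodType R1,
  fmap F (center_act z1 M : @hom (leftMod R1) M M) = center_act z2 (F M).
Variables (A1 A2 : nzRingType) (sg1 : {rmorphism A1 -> R1}) (th1 : {rmorphism R1 -> A1})
  (sg2 : {rmorphism A2 -> R2}) (th2 : {rmorphism R2 -> A2}).
Hypothesis quo1 : split_quotient sg1 th1 z1.
Hypothesis quo2 : split_quotient sg2 th2 z2.

Lemma center_act_inverse (N : lmodType R2) :
  fmap G (center_act z2 N : @hom (leftMod R2) N N) = center_act z1 (G N).
Proof.
have [_ [eta [theta [nat_eta te et]]]] := FG.
apply: (equivalence_faithful FG); rewrite Fz.
have nat := nat_eta N N (center_act z2 N).
have : fmap F (fmap G (center_act z2 N : @hom (leftMod R2) N N)) =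
    comp (theta N) (comp (center_act z2 N : @hom (leftMod R2) N N) (eta N)).
  apply: etrans (congr1 (comp (theta N)) nat).
  by apply: esym; rewrite compA te comp1m.
move=> ->; apply: linear_ext => m /=; rewrite linearZ; congr (_ *: _).
exact: (congr1 (fun h : {linear F (G N) -> F (G N)} => h m) (te N)).
Qed.

Lemma quotient_equivalence :
  quasi_inverse (quotient_functor F th1 sg2) (quotient_functorV G sg1 th2).
Proof.
split; first exact: (quotient_functorK FG Fz quo1 quo2).
exact: (quotient_functorK (quasi_inverse_sym FG) center_act_inverse quo2 quo1).
Qed.
End QuotientEquivalenceInverse.

(** * Twin modules *)
(** Distinct vertices of an oriented cycle give such modules
    (vertex_module_twin). Only the category enters the definition: monomorphisms,
    zero morphisms and the action of the center. *)
Definition twin (R : nzRingType) (M N : leftMod R) : Prop :=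
  [/\ idm M <> lin_zero M M, idm N <> lin_zero N N,
      forall z : center R,
        (center_act z M = lin_zero M M /\ center_act z N = lin_zero N N) \/
        (mono (center_act z M : hom M M) /\ mono (center_act z N : hom N N)) &
      forall (X : leftMod R) (f : hom X M) (g : hom X N),
        mono f -> mono g -> idm X = lin_zero X X].

Section TwinInvariance.
Variables (R S : nzRingType)
  (F : functor (leftMod R) (leftMod S)) (G : functor (leftMod S) (leftMod R)).
Hypothesis FG : quasi_inverse F G.

Lemma equivalence_reflects_mono (M N : leftMod R) (f : hom M N) : mono (fmap F f) -> mono f.
Proof.
move=> mf W g h fgh; apply: (equivalence_faithful FG); apply: mf.
by rewrite -!fmapM fgh.
Qed.

Lemma equivalence_idm_neq0 (M : leftMod R) :
  idm M <> lin_zero M M -> idm (F M) <> lin_zero (F M) (F M).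
Proof.
move=> M0 FM0; apply: M0; apply: (equivalence_faithful FG).
by rewrite fmap1 (equivalence_zero FG).
Qed.

Lemma equivalence_twin (M N : leftMod R) : twin M N -> twin (F M) (F N).
Proof.
case=> M0 N0 dich noX; split; [exact: equivalence_idm_neq0..| |].
  move=> z; have [phi [_ _ phiE]] := equivalence_center FG.
  have [[zM zN]|[zM zN]] := dich (phi z).
    by left; rewrite -!phiE zM zN !(equivalence_zero FG).
  by right; rewrite -!phiE; split; exact: (equivalence_mono FG).
move=> X f g mf mg.
have [u [v [uv vu]]] := equivalence_essentially_surjective FG X.
have mu : mono u.
  by move=> W p q /(congr1 (comp v)); rewrite !compA vu !comp1m.
have [f' fE] := equivalence_full FG (comp f u).
have [g' gE] := equivalence_full FG (comp g u).
have mcomp (Y : leftMod S) (q : hom X Y) : mono q -> mono (comp q u).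
  by move=> mq W a b; rewrite -!compA => /mq/mu.
have X0 : idm (G X) = lin_zero (G X) (G X).
  by apply: (noX _ f' g'); apply: equivalence_reflects_mono; rewrite ?fE ?gE; exact: mcomp.
have : idm (F (G X)) = lin_zero _ _ by rewrite -fmap1 X0 (equivalence_zero FG).
move=> FX0; rewrite -uv -[u]compm1 FX0; apply: linear_ext => x.
by rewrite /= linear0.
Qed.
End TwinInvariance.

Lemma restr_quasi_inverse (A R : nzRingType) (f : {rmorphism A -> R}) (g : {rmorphism R -> A}) :
  cancel f g -> cancel g f -> quasi_inverse (restr_functor f) (restr_functor g).
Proof.
have half (U V : nzRingType) (p : {rmorphism U -> V}) (q : {rmorphism V -> U}) :
    cancel q p ->
    nat_isomorphic (compF (restr_functor q) (restr_functor p)) (idF (leftMod V)).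
  move=> qK; have lin (M : lmodType V) : linear (id : restr q (restr p M) -> M).
    move=> a x y; change (p (q a) *: (x : M) + (y : M) = a *: (x : M) + (y : M)).
    by rewrite qK.
  have linV (M : lmodType V) : linear (id : M -> restr q (restr p M)).
    move=> a x y; change (a *: (x : M) + (y : M) = p (q a) *: (x : M) + (y : M)).
    by rewrite qK.
  exists (fun M => mk_linear (lin M)), (fun M => mk_linear (linV M)).
  by split=> *; exact: linear_ext.
by move=> fK gK; split; exact: half.
Qed.

(** * Module categories over polynomial rings *)
Section ConverseMorphism.
Variables (A R : nzRingType) (f : {rmorphism A -> R}).
Definition conv_morph : A^c -> R^c := f.
Fact conv_morph_zmod : zmod_morphism conv_morph.
Proof. by move=> x y; exact: (rmorphB f x y). Qed.
Fact conv_morph_monoid : monoid_morphism conv_morph.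
Proof. by split=> [|x y]; [exact: (rmorph1 f) | exact: (rmorphM f y x)]. Qed.
HB.instance Definition _ := GRing.isZmodMorphism.Build A^c R^c conv_morph conv_morph_zmod.
HB.instance Definition _ := GRing.isMonoidMorphism.Build A^c R^c conv_morph conv_morph_monoid.
Definition conv : {rmorphism A^c -> R^c} := conv_morph.
End ConverseMorphism.

Section CenterPoly.
Variable R : nzRingType.
Local Notation cval := (@center_val R).

Fact center_poly_central (p : {poly center R}) (x : {poly R}^c) :
  (map_poly cval p : {poly R}^c) * x = x * (map_poly cval p : {poly R}^c).
Proof.
change ((x : {poly R}) * map_poly cval p = map_poly cval p * (x : {poly R})).
apply/polyP => i; rewrite coefM coefMr; apply: eq_bigr => j _.
by rewrite coef_map; apply/esym/centerP.
Qed.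

(** Right modules over R[t] are left modules over the converse ring, which has
    the same central elements; those are the polynomials with central
    coefficients. *)
Definition center_poly (p : {poly center R}) : center {poly R}^c :=
  mk_center (center_poly_central p).

Lemma center_polyE p : val (center_poly p) = map_poly cval p.
Proof. exact: mk_centerE. Qed.

Fact center_poly_zmod : zmod_morphism center_poly.
Proof.
move=> p q; apply: val_inj; rewrite center_polyE rmorphB.
apply: etrans (esym (rmorphB (@center_val {poly R}^c) _ _)).
by congr (_ - _); apply/esym/center_polyE.
Qed.
Fact center_poly_monoid : monoid_morphism center_poly.
Proof.
split=> [|p q]; apply: val_inj; rewrite center_polyE ?rmorph1 //.
rewrite [p * q]mulrC rmorphM.
apply: etrans (esym (rmorphM (@center_val {poly R}^c) _ _)).
by congr (_ * _); apply/esym/center_polyE.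
Qed.
HB.instance Definition _ := GRing.isZmodMorphism.Build _ _ center_poly center_poly_zmod.
HB.instance Definition _ := GRing.isMonoidMorphism.Build _ _ center_poly center_poly_monoid.

Lemma center_poly_inj : injective center_poly.
Proof.
move=> p q /(congr1 val); rewrite !center_polyE => pq.
apply/polyP => i; apply: val_inj.
by have /(congr1 (fun f : {poly R} => f`_i)) := pq; rewrite !coef_map.
Qed.

Lemma center_poly_surj z : exists p, center_poly p = z.
Proof.
have cz i (x : R) : (val z : {poly R})`_i * x = x * (val z : {poly R})`_i.
  have := centerP z x%:P; rewrite /GRing.mul /= => e.
  have {e}e : x%:P * (val z : {poly R}) = (val z : {poly R}) * x%:P by exact: e.
  move/(congr1 (fun f : {poly R} => f`_i)): e.
  by rewrite coefCM coefMC.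
exists (\poly_(i < size (val z : {poly R})) mk_center (cz i)).
apply: val_inj; rewrite center_polyE; apply/polyP => i.
rewrite coef_map coef_poly; case: ltnP => [_|/leq_sizeP->//]; exact: mk_centerE.
Qed.

Section Translation.
Variable b : center R.

Fact translation_comm : commr_rmorph (polyC : R -> {poly R}) ('X + (val b)%:P).
Proof.
move=> x; rewrite /GRing.comm mulrDl mulrDr commr_polyX; congr (_ + _).
by rewrite -!polyCM; congr _%:P; exact: centerP.
Qed.

(** The automorphism t -> t + b, the identity on R. *)
Definition translation : {poly R} -> {poly R} := horner_morph translation_comm.
HB.instance Definition _ := GRing.RMorphism.on translation.

Lemma translationC x : translation x%:P = x%:P.
Proof. exact: horner_morphC. Qed.
Lemma translationX : translation 'X = 'X + (val b)%:P.
Proof. exact: horner_morphX. Qed.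

Lemma translation_MXaddC f x :
  translation (f * 'X + x%:P) = translation f * ('X + (val b)%:P) + x%:P.
Proof.
rewrite [LHS]rmorphD rmorphM; congr (_ * _ + _); first exact: translationX.
exact: translationC.
Qed.

Lemma translation_center p :
  translation (map_poly cval p) = map_poly cval (p \Po ('X + b%:P)).
Proof.
elim/poly_ind: p => [|p c IHp]; first by rewrite comp_poly0 !rmorph0.
have mapMXaddC q u (v : {poly R}) : map_poly cval u = v ->
    map_poly cval (q * u + c%:P) = map_poly cval q * v + (val c)%:P.
  move=> uv; rewrite rmorphD rmorphM; congr (_ * _ + _); first exact: uv.
  exact: map_polyC.
rewrite comp_poly_MXaddC (mapMXaddC p _ 'X) ?map_polyX // translation_MXaddC IHp.
rewrite (mapMXaddC _ _ ('X + (val b)%:P)) // rmorphD; congr (_ + _).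
  exact: map_polyX.
exact: map_polyC.
Qed.
End Translation.

Lemma translationK b : cancel (translation b) (translation (- b)).
Proof.
elim/poly_ind => [|p c IHp]; first by rewrite !rmorph0.
rewrite translation_MXaddC [LHS]rmorphD rmorphM.
congr (_ * _ + _); [exact: IHp | | exact: translationC].
rewrite [LHS]rmorphD; apply: etrans (congr2 +%R (translationX _) (translationC _ _)) _.
by rewrite -addrA -polyCD rmorphN addNr polyC0 addr0.
Qed.
End CenterPoly.

Section PolyEquivalence.
Variables (A B : nzRingType).
Variables (F : functor (leftMod {poly A}^c) (leftMod {poly B}^c))
  (G : functor (leftMod {poly B}^c) (leftMod {poly A}^c)).
Hypothesis FG : quasi_inverse F G.

Lemma equivalence_poly_center :
  exists Phi : {rmorphism {poly center B} -> {poly center A}},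
  [/\ injective Phi, forall f, exists p, Phi p = f &
      forall p (M : lmodType {poly A}^c),
        fmap F (center_act (center_poly (Phi p)) M : hom (M : leftMod _) M) =
        center_act (center_poly p) (F M)].
Proof.
have [phi [inj_phi surj_phi phiE]] := equivalence_center FG.
have [|Phi PhiE] := rmorph_lift (f := phi \o center_poly (R := B)) (@center_poly_inj A).
  by move=> p; exact: center_poly_surj.
exists Phi; split=> [p q|f|p M].
- move/(congr1 (center_poly (R := A))); rewrite !PhiE => /inj_phi.
  exact: center_poly_inj.
- have [z zE] := surj_phi (center_poly f).
  have [p pE] := center_poly_surj z; exists p; apply: center_poly_inj.
  by rewrite PhiE -zE -pE.
by have := PhiE p => /= ->; exact: phiE.
Qed.

Variable Phi : {rmorphism {poly center B} -> {poly center A}}.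
Hypothesis FPhi : forall p (M : lmodType {poly A}^c),
  fmap F (center_act (center_poly (Phi p)) M : hom (M : leftMod _) M) =
  center_act (center_poly p) (F M).

(** The modules are carried to B[t], twisted there by the automorphism t -> t + b
    and carried back. Equations between actions are used, rather than actions on
    elements, because G (F M) and M are different modules. *)
Lemma translated_twin (b : center B) (M N : leftMod {poly A}^c) :
    twin M N -> exists M' N', twin M' N' /\ forall p q,
  center_act (center_poly (Phi p)) M' = center_act (center_poly (Phi q)) M' <->
  center_act (center_poly (Phi (p \Po ('X + b%:P)))) M =
  center_act (center_poly (Phi (q \Po ('X + b%:P)))) M.
Proof.
move=> twMN.
pose t := conv (translation b).
pose tV := conv (translation (- b)).
have tK : cancel t tV by exact: translationK.
have tVK : cancel tV t by have := @translationK B (- b); rewrite opprK; exact.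
have TT := restr_quasi_inverse (f := t) (g := tV) tK tVK.
exists (G (restr t (F M))), (G (restr t (F N))); split.
  apply: (equivalence_twin (quasi_inverse_sym FG)).
  have := equivalence_twin TT (equivalence_twin FG twMN); exact.
move=> p q.
have GE := center_act_inverse FG (fun M => FPhi _ M).
rewrite -!GE.
have actE r (y : F M) : center_act (center_poly r) (restr t (F M)) y =
    center_act (center_poly (r \Po ('X + b%:P))) (F M) y.
  change (t (val (center_poly r)) *: y = (val (center_poly (r \Po ('X + b%:P)))) *: y).
  by rewrite !center_polyE; congr (_ *: _); exact: translation_center.
split=> [/(equivalence_faithful (quasi_inverse_sym FG)) pq|pq].
  apply: (equivalence_faithful FG); rewrite !FPhi; apply: linear_ext => y.
  rewrite -!actE; exact: (congr1 (fun h : {linear restr t (F M) -> restr t (F M)} => h y) pq).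
congr (fmap G _); apply: linear_ext => y.
rewrite [LHS]actE [RHS]actE -!FPhi; by rewrite pq.
Qed.

End PolyEquivalence.

Lemma restr_lcomb (k : fieldType) (A R : algType k) (f : {rmorphism A -> R})
    (M N : lmodType R^c) (c : k) (u v : {linear M -> N}) :
    f c%:A = c%:A ->
  restr_hom (conv f) (lin_lcomb c u v) =
  lin_lcomb c (restr_hom (conv f) u) (restr_hom (conv f) v).
Proof.
move=> fc; apply: linear_ext => x.
change ((c%:A : R^c) *: u x + v x = (f c%:A : R^c) *: u x + v x).
by rewrite fc.
Qed.

Section Cancellation.
Variables (k : fieldType) (A B : algType k).
Variables (F : functor (rightMod (polyAlg A)) (rightMod (polyAlg B)))
  (G : functor (rightMod (polyAlg B)) (rightMod (polyAlg A))).
Hypothesis FG : quasi_inverse F G.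
Variables (z : center {poly A}^c) (sg : {rmorphism A -> {poly A}}) (th : {rmorphism {poly A} -> A}).
Hypothesis Fz : forall M : lmodType {poly A}^c,
  fmap F (center_act z M : @hom (rightMod (polyAlg A)) M M) =
  center_act (center_poly 'X : center {poly B}^c) (F M).
Hypothesis quo : split_quotient (conv sg) (conv th) z.

Let ev0 : {rmorphism {poly B} -> B} := coefp 0.
Let inc : {rmorphism B -> {poly B}} := polyC.

(** B is the quotient of B[t] by t. *)
Lemma poly_split_quotient :
  split_quotient (conv inc) (conv ev0) (center_poly 'X : center {poly B}^c).
Proof.
split=> [x||r].
- by change (((x : B)%:P)`_0 = x); rewrite coefC.
- by rewrite center_polyE map_polyX; change (('X : {poly B})`_0 = 0); rewrite coefX.
exists (drop_poly 1 (r : {poly B})); rewrite center_polyE map_polyX.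
change ((r : {poly B}) - ((r : {poly B})`_0)%:P = drop_poly 1 (r : {poly B}) * 'X).
apply/polyP => i; rewrite coefB coefC coefMX coef_drop_poly.
by case: i => [|i] /=; rewrite ?subrr // subr0 addn1.
Qed.

(** Modules over A are modules over A[t] killed by z, which F carries to modules
    over B[t] killed by t. *)
Lemma cancel_equivalent : equivalent (rightMod A) (rightMod B).
Proof.
exists (quotient_functor F (conv th) (conv inc)),
  (quotient_functorV G (conv sg) (conv ev0)).
exact: (quotient_equivalence FG Fz quo poly_split_quotient).
Qed.

Hypothesis sgC : forall c : k, sg c%:A = c%:A%:P.
Hypothesis thC : forall c : k, th (c%:A%:P) = c%:A.

Lemma cancel_linearly_equivalent :
  klinear F -> klinear G -> linearly_equivalent A B.
Proof.
move=> kF kG.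
exists (quotient_functor F (conv th) (conv inc)),
  (quotient_functorV G (conv sg) (conv ev0)).
have algC (R : algType k) c : (c%:A : polyAlg R) = (c%:A%:P : {poly R}).
  by change (c%:A *: (1 : {poly R}) = c%:A%:P); rewrite alg_polyC.
split; last exact: (quotient_equivalence FG Fz quo poly_split_quotient).
  move=> M N c f g.
  have thc : (th : {rmorphism polyAlg A -> A}) c%:A = c%:A by rewrite algC thC.
  have incc : (inc : {rmorphism B -> polyAlg B}) c%:A = c%:A by rewrite algC.
  apply: etrans (restr_lcomb _ _ incc); congr restr_hom.
  apply: etrans (kF _ _ _ _ _); congr (fmap F _); exact: restr_lcomb.
move=> M N c f g.
have evc : (ev0 : {rmorphism polyAlg B -> B}) c%:A = c%:A.
  by rewrite algC; change ((c%:A%:P : {poly B})`_0 = c%:A); rewrite coefC.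
have sgc : (sg : {rmorphism A -> polyAlg A}) c%:A = c%:A by rewrite algC sgC.
apply: etrans (restr_lcomb _ _ sgc); congr restr_hom.
by apply: etrans (kG _ _ _ _ _); congr (fmap G _); exact: restr_lcomb.
Qed.
End Cancellation.

(** * Bases of path algebras *)
(** The algebra of Q presented by its basis of walks, where word v s is zero
    unless s is a walk from v. Only this presentation is used below, so that
    conversion never unfolds the finitely supported functions behind it. *)
Record path_basis (k : fieldType) (Q : quiver) (A : algType k) := PathBasis {
  word : vertex Q -> seq (arrow Q) -> A;
  coef : vertex Q -> seq (arrow Q) -> A -> k;
  coef_linear : forall v s (c : k) x y, coef v s (c *: x + y) = c * coef v s x + coef v s y;
  coef_word : forall v s w t, coef v s (word w t) = ((v == w) && (s == t) && is_walk w t)%:R;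
  coef_inj : forall x y, (forall v s, coef v s x = coef v s y) -> x = y;
  word_span : forall P : A -> Prop,
    (forall x y, P x -> P y -> P (x + y)) ->
    (forall (c : k) v s, P (c *: word v s)) -> forall x, P x;
  wordM : forall v s w t, word v s * word w t =
    if last v (map (@target Q) s) == w then word v (s ++ t) else 0;
  sum_word_nil : \sum_v word v [::] = 1;
  word_ext : forall (R : lmodType k) (f : vertex Q -> seq (arrow Q) -> R),
    exists2 ext : A -> R, forall (c : k) x y, ext (c *: x + y) = c *: ext x + ext y &
      forall v s, is_walk v s -> ext (word v s) = f v s
}.

Section PathAlgebraBasis.
Variables (k : fieldType) (Q : quiver).
Local Notation A := (pathAlg k Q).
Local Notation V := (vertex Q).
Local Notation E := (arrow Q).
Local Notation tgt v s := (last v (map (@target Q) s)).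

Definition walk_word (v : V) (s : seq E) : A :=
  if insub (v, s) is Some p then << (p : walk Q) >> else 0.

Definition walk_coef (v : V) (s : seq E) (x : A) : k :=
  if insub (v, s) is Some p then (x : {malg k[walk Q]})@_(p : walk Q) else 0.

Lemma walk_wordE (p : walk Q) : walk_word (walk_start p) (walk_arrows p) = << p >>.
Proof.
rewrite /walk_word; have -> : (walk_start p, walk_arrows p) = val p.
  by rewrite /walk_start /walk_arrows; case: (val p).
by rewrite valK.
Qed.

Lemma walk_coefE (p : walk Q) (x : A) :
  walk_coef (walk_start p) (walk_arrows p) x = (x : {malg k[walk Q]})@_p.
Proof.
rewrite /walk_coef; have -> : (walk_start p, walk_arrows p) = val p.
  by rewrite /walk_start /walk_arrows; case: (val p).
by rewrite valK.
Qed.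

Fact walk_coef_is_scalar v s : scalar (walk_coef v s).
Proof.
move=> c x y; rewrite /walk_coef; case: insub => [p|]; last by rewrite mulr0 addr0.
by rewrite mcoeffD mcoeffZ.
Qed.
HB.instance Definition _ v s :=
  GRing.isLinear.Build k A k *%R (walk_coef v s) (@walk_coef_is_scalar v s).

Lemma walk_coef0 v s : walk_coef v s 0 = 0.
Proof. exact: linear0. Qed.

Lemma walk_coef_word v s w t :
  walk_coef v s (walk_word w t) = ((v == w) && (s == t) && is_walk w t)%:R.
Proof.
rewrite /walk_word; case: insubP => [p /= wt pE|/negbTE -> ]; last first.
  by rewrite andbF walk_coef0.
rewrite wt andbT /walk_coef; case: insubP => [q /= vs qE|nvs].
  by rewrite mcoeffU -val_eqE /= pE qE -xpair_eqE eq_sym.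
case: eqP => //= vw; case: eqP => //= st; move: nvs; rewrite /= vw st wt //.
Qed.

Lemma walk_coef_inj (x y : A) : (forall v s, walk_coef v s x = walk_coef v s y) -> x = y.
Proof. by move=> xy; apply/malgP => p; rewrite -!walk_coefE. Qed.

Lemma walk_wordM v s w t :
  walk_word v s * walk_word w t = if tgt v s == w then walk_word v (s ++ t) else 0.
Proof.
rewrite /walk_word; case: (insubP _ (v, s)) => [p vs pE|/= nvs]; last first.
  rewrite mul0r (@insubN _ _ _ (v, s ++ t)); first by case: ifP.
  by rewrite /= is_walk_cat (negbTE nvs).
case: (insubP _ (w, t)) => [q wt qE|/= nwt]; last first.
  rewrite mulr0; case: eqP => // vw; rewrite insubN //=.
  by rewrite is_walk_cat vw (negbTE nwt) andbF.
rewrite /= in vs wt; rewrite pathAlg_ME [LHS]path_mulUU mulr1 /walk_mul.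
have -> : walk_end p = tgt v s by rewrite /walk_end /walk_start /walk_arrows pE.
have -> : walk_start q = w by rewrite /walk_start qE.
case: eqP => // vw; case: insubP => [r _ rE|/=]; last first.
  by rewrite is_walk_cat vs vw wt.
congr (mkmalgU _ 1); apply: val_inj; rewrite rE val_walk_cat.
  by rewrite /walk_start /walk_arrows pE qE.
by rewrite /walk_end /walk_start /walk_arrows pE qE.
Qed.

Lemma pathAlg_ind (P : A -> Prop) :
    (forall x y, P x -> P y -> P (x + y)) -> (forall (c : k) v s, P (c *: walk_word v s)) ->
  forall x, P x.
Proof.
move=> PD PW x; rewrite (monalgE x).
have P0 : P 0 by have [v _] := card_gt0P (vertex_gt0 Q); rewrite -(scale0r (walk_word v [::])).
apply: big_ind => // p _.
suff -> : << x@_p *g p >> = x@_p *: walk_word (walk_start p) (walk_arrows p) by [].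
rewrite walk_wordE; apply/malgP => q; rewrite [LHS]mcoeffU [RHS]mcoeffZ.
by rewrite [X in _ = _ * X]mcoeffU mulr_natr.
Qed.

Lemma walk_sum_word_nil : \sum_v walk_word v [::] = 1.
Proof.
rewrite [RHS](_ : _ = path_one k Q) //; apply: eq_bigr => v _.
exact: (walk_wordE (trivial_walk v)).
Qed.

Lemma walk_word_ext (R : lmodType k) (f : V -> seq E -> R) :
  exists2 ext : A -> R, forall (c : k) (x y : A), ext (c *: x + y) = c *: ext x + ext y &
    forall v s, is_walk v s -> ext (walk_word v s) = f v s.
Proof.
pose g (p : walk Q) := f (walk_start p) (walk_arrows p).
pose ext (x : {malg k[walk Q]}) := \sum_(p <- msupp x) x@_p *: g p.
have extw (d : {fset walk Q}) x : (msupp x `<=` d)%fset -> ext x = \sum_(p <- d) x@_p *: g p.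
  move=> le_d; rewrite /ext; apply/big_fset_incl => // p _ /mcoeff_outdom ->.
  exact: scale0r.
exists ext => [c x y|v s vs].
  set d := (msupp (x : {malg k[walk Q]}) `|` msupp (y : {malg k[walk Q]}))%fset.
  rewrite (@extw d x) ?fsubsetUl // (@extw d y) ?fsubsetUr // (@extw d).
    rewrite scaler_sumr -big_split; apply: eq_bigr => p _ /=.
    by rewrite mcoeffD mcoeffZ scalerDl scalerA.
  by apply: fsubset_trans (msuppD_le _ _) _; apply: fsetSU; exact: msuppZ_le.
rewrite /walk_word; case: insubP => [p _ pE|/negP//].
rewrite (@extw [fset p]%fset) ?msuppU_le // big_seq_fset1 mcoeffUU scale1r.
by rewrite /g /walk_start /walk_arrows pE.
Qed.

Lemma pathAlg_basis : path_basis Q (pathAlg k Q).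
Proof.
exists walk_word walk_coef.
- exact: walk_coef_is_scalar.
- exact: walk_coef_word.
- exact: walk_coef_inj.
- exact: pathAlg_ind.
- exact: walk_wordM.
- exact: walk_sum_word_nil.
- exact: walk_word_ext.
Defined.

End PathAlgebraBasis.

Arguments coef_inj {k Q A} p x y _.
Arguments word_span {k Q A} p P _ _ x.
Arguments coef_linear {k Q A} p v s c x y.
Arguments word_ext {k Q A} p {R} f.
Arguments sum_word_nil {k Q A} p.
Arguments wordM {k Q A} p v s w t.
Arguments coef_word {k Q A} p v s w t.

Section PathBasisTheory.
Variables (k : fieldType) (Q : quiver) (A : algType k) (W : path_basis Q A).
Local Notation V := (vertex Q).
Local Notation E := (arrow Q).
Local Notation tgt v s := (last v (map (@target Q) s)).
Local Notation word := (word W).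
Local Notation coef := (coef W).

Lemma wcoefD v s (x y : A) : coef v s (x + y) = coef v s x + coef v s y.
Proof. by have := coef_linear W v s 1 x y; rewrite scale1r mul1r. Qed.
Lemma wcoef0 v s : coef v s 0 = 0.
Proof. by apply: (addrI (coef v s 0)); rewrite -wcoefD !addr0. Qed.
Lemma wcoefZ v s (c : k) (x : A) : coef v s (c *: x) = c * coef v s x.
Proof. by have := coef_linear W v s c x 0; rewrite !addr0 wcoef0 addr0. Qed.
Lemma wcoefN v s (x : A) : coef v s (- x) = - coef v s x.
Proof. by rewrite -scaleN1r wcoefZ mulN1r. Qed.
Lemma wcoef_sum v s (I : Type) (r : seq I) (P : pred I) (F : I -> A) :
  coef v s (\sum_(i <- r | P i) F i) = \sum_(i <- r | P i) coef v s (F i).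
Proof. exact: (big_morph (coef v s) (wcoefD v s) (wcoef0 v s)). Qed.

Lemma word_eq0 v s : ~~ is_walk v s -> word v s = 0.
Proof.
move=> nvs; apply: (coef_inj W) => w t.
by rewrite coef_word (negbTE nvs) andbF wcoef0.
Qed.

Lemma coef_notwalk v s x : ~~ is_walk v s -> coef v s x = 0.
Proof.
move=> nvs; elim/(word_span W): x => [x y xs ys|c w t]; first by rewrite wcoefD xs ys addr0.
rewrite wcoefZ coef_word; case: eqP => [<-|_] /=; last by rewrite mulr0.
by case: eqP => [<-|_] /=; rewrite ?(negbTE nvs) mulr0.
Qed.

Definition vx (v : V) : A := word v [::].
Definition ar (a : E) : A := word (source a) [:: a].

Lemma arE e : ar e = word (source e) [:: e]. Proof. by []. Qed.
Lemma sum_vx : \sum_v vx v = 1. Proof. exact: (sum_word_nil W). Qed.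

Lemma vxM v w : vx v * vx w = if v == w then vx v else 0.
Proof. exact: (wordM W). Qed.

Lemma word_cons v a s : word v (a :: s) = if source a == v then ar a * word (target a) s else 0.
Proof.
case: eqP => [<-|/eqP/negbTE nv]; last by rewrite word_eq0 //= nv.
by rewrite wordM /= eqxx.
Qed.

Lemma vx_word v w s : vx v * word w s = if v == w then word w s else 0.
Proof. by rewrite wordM; case: eqP => //= ->. Qed.

Lemma word_vx v s w : word v s * vx w = if tgt v s == w then word v s else 0.
Proof. by rewrite wordM cats0. Qed.

Lemma vx_ar v a : vx v * ar a = if v == source a then ar a else 0.
Proof. exact: vx_word. Qed.
Lemma ar_vx v a : ar a * vx v = if target a == v then ar a else 0.
Proof. exact: word_vx. Qed.

Lemma pathAlg_gen (P : A -> Prop) :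
    (forall x y, P x -> P y -> P (x + y)) -> (forall (c : k) x, P x -> P (c *: x)) ->
    (forall x y, P x -> P y -> P (x * y)) ->
    (forall v, P (vx v)) -> (forall a, P (ar a)) ->
  forall x, P x.
Proof.
move=> PD PZ PM PV PA; apply: (word_span W) => // c v s; apply: (PZ).
elim: s v => [//|a s IHs] v; rewrite word_cons; case: ifP => _; first exact: PM.
by rewrite -(scale0r (vx v)); apply: PZ.
Qed.

Lemma coef_vxM v w s (x : A) : coef w s (vx v * x) = if v == w then coef w s x else 0.
Proof.
elim/(word_span W): x => [x y Hx Hy|c u t].
  by rewrite mulrDr !wcoefD Hx Hy; case: ifP; rewrite ?addr0.
rewrite -scalerAr vx_word wcoefZ wcoefZ; case: (eqVneq v u) => [<-|nvu].
  case: eqP => // /eqP nvw; rewrite coef_word eq_sym (negbTE nvw).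
  by rewrite mulr0.
rewrite wcoef0 mulr0; case: eqP => // <-; rewrite coef_word (negbTE nvu).
by rewrite mulr0.
Qed.

Lemma coef_Mvx v w s (x : A) : coef w s (x * vx v) = if tgt w s == v then coef w s x else 0.
Proof.
elim/(word_span W): x => [x y Hx Hy|c u t].
  by rewrite mulrDl !wcoefD Hx Hy; case: ifP; rewrite ?addr0.
rewrite -scalerAl word_vx wcoefZ wcoefZ (fun_if (coef w s)) wcoef0 coef_word.
case: (eqVneq w u) => [<-|]; last by rewrite /= !if_same mulr0 if_same.
case: (eqVneq s t) => [<-|]; last by rewrite /= !if_same mulr0 if_same.
by case: ifP; rewrite ?mulr0.
Qed.

Lemma coef_arM_nil a v (x : A) : coef v [::] (ar a * x) = 0.
Proof.
elim/(word_span W): x => [x y Hx Hy|c u t]; first by rewrite mulrDr wcoefD Hx Hy addr0.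
rewrite -scalerAr wordM wcoefZ (fun_if (coef v [::])) wcoef0 coef_word.
by rewrite andbF if_same mulr0.
Qed.

Lemma coef_arM a v b s (x : A) :
  coef v (b :: s) (ar a * x) =
  if (a == b) && (source a == v) then coef (target a) s x else 0.
Proof.
elim/(word_span W): x => [x y Hx Hy|c u t].
  by rewrite mulrDr !wcoefD Hx Hy; case: ifP; rewrite ?addr0.
rewrite -scalerAr wordM wcoefZ wcoefZ (fun_if (coef v (b :: s))) wcoef0 coef_word /=.
rewrite coef_word eqxx eqseq_cons [b == a]eq_sym [v == source a]eq_sym.
case: (eqVneq a b) => _ /=; last by rewrite andbF if_same mulr0.
case: (eqVneq (source a) v) => _ /=; last by rewrite if_same mulr0.
by case: eqP => [->|_] /=; rewrite ?mulr0 ?andbT.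
Qed.

Lemma coef_Mar a v s b (x : A) :
  coef v (rcons s b) (x * ar a) =
  if (b == a) && is_walk v (rcons s a) then coef v s x else 0.
Proof.
elim/(word_span W): x => [x y Hx Hy|c u t].
  by rewrite mulrDl !wcoefD Hx Hy; case: ifP; rewrite ?addr0.
rewrite -scalerAl wordM wcoefZ wcoefZ (fun_if (coef v _)) wcoef0 coef_word.
rewrite cats1 eqseq_rcons coef_word -!cats1 !is_walk_cat /=.
case: (eqVneq b a) => _ /=; last by rewrite !andbF if_same mulr0.
case: (eqVneq v u) => [vu|_] /=; last by rewrite if_same mulr0 if_same.
case: (eqVneq s t) => [st|_] /=; last by rewrite if_same mulr0 if_same.
rewrite -vu -st [_ == source a]eq_sym; case: (is_walk v s); case: (source a == _) => //=;
  by rewrite ?mulr0.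
Qed.

(** The one-dimensional representation at v on which all arrows act by zero. *)
Definition head_coef (v : V) : A -> k := coef v [::].
Fact head_coef_zmod v : zmod_morphism (head_coef v).
Proof. by move=> x y; rewrite /head_coef wcoefD wcoefN. Qed.
Fact head_coef_monoid v : monoid_morphism (head_coef v).
Proof.
split.
  rewrite /head_coef -sum_vx wcoef_sum (bigD1 v) //= big1 => [|w nw].
    by rewrite coef_word !eqxx addr0.
  by rewrite coef_word eq_sym (negbTE nw).
move=> x y; rewrite /head_coef; elim/(word_span W): x => [x1 x2 H1 H2|c u t].
  by rewrite mulrDl !wcoefD mulrDl H1 H2.
rewrite -scalerAl wcoefZ wcoefZ -mulrA; congr (_ * _).
case: t => [|a t]; rewrite coef_word.
  by rewrite -[word u [::]]/(vx u) coef_vxM eq_sym andbT; case: eqP; rewrite ?mul1r ?mul0r.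
rewrite word_cons andbF mul0r; case: ifP => _; last by rewrite mul0r wcoef0.
by rewrite -mulrA coef_arM_nil.
Qed.
HB.instance Definition _ v := GRing.isZmodMorphism.Build A k (head_coef v) (head_coef_zmod v).
HB.instance Definition _ v := GRing.isMonoidMorphism.Build A k (head_coef v) (head_coef_monoid v).

End PathBasisTheory.

Section UniversalProperty.
Variables (k : fieldType) (Q : quiver) (A R : algType k) (W : path_basis Q A).
Variables (fv : vertex Q -> R) (fa : arrow Q -> R).
Hypothesis fvM : forall v w, fv v * fv w = if v == w then fv v else 0.
Hypothesis fv1 : \sum_v fv v = 1.
Hypothesis fva : forall a, fv (source a) * fa a = fa a.
Hypothesis fav : forall a, fa a * fv (target a) = fa a.

Lemma fv_prod v s : is_walk v s ->
  fv v * (\prod_(a <- s) fa a) * fv (last v (map (@target Q) s)) = fv v * \prod_(a <- s) fa a.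
Proof.
elim: s v => [|a s IHs] v /=; first by rewrite big_nil mulr1 fvM eqxx.
case/andP => /eqP <- /IHs; rewrite big_cons.
set e := fv (last _ _); set p := \prod_(_ <- _) _ => IH.
by rewrite -{1}(fav a) -[fa a * _ * p]mulrA !mulrA -[X in X * e]mulrA
  -[_ * (_ * p) * e]mulrA IH !mulrA -[fv _ * fa a * _]mulrA fav.
Qed.

Section Multiplicative.
Variable ext : A -> R.
Hypothesis ext_linear : forall (c : k) x y, ext (c *: x + y) = c *: ext x + ext y.
Hypothesis ext_word : forall v s, is_walk v s ->
  ext (word W v s) = fv v * \prod_(a <- s) fa a.

Lemma path_extD x y : ext (x + y) = ext x + ext y.
Proof. by have := ext_linear 1 x y; rewrite !scale1r. Qed.
Lemma path_ext0 : ext 0 = 0.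
Proof. by apply: (addrI (ext 0)); rewrite -path_extD !addr0. Qed.
Lemma path_extZ c x : ext (c *: x) = c *: ext x.
Proof. by have := ext_linear c x 0; rewrite !addr0 path_ext0 addr0. Qed.

Lemma path_extM : {morph ext : x y / x * y}.
Proof.
have wd v s : ext (word W v s) = if is_walk v s then fv v * \prod_(a <- s) fa a else 0.
  case: ifP => [/ext_word//|/negbT/word_eq0 ->]; exact: path_ext0.
move=> x y; elim/(word_span W): x => [x1 x2 H1 H2|c v s].
  by rewrite mulrDl !path_extD mulrDl H1 H2.
rewrite -scalerAl !path_extZ -scalerAl; congr (_ *: _).
elim/(word_span W): y => [x1 x2 H1 H2|{}c w t].
  by rewrite mulrDr !path_extD mulrDr H1 H2.
rewrite -scalerAr !path_extZ -scalerAr; congr (_ *: _).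
rewrite wordM (fun_if ext) path_ext0 !wd is_walk_cat.
case: (boolP (is_walk v s)) => [vs|_] /=; last by rewrite mul0r if_same.
case: eqP => [<-|/eqP nvw].
  case: ifP => vt; last by rewrite mulr0.
  by rewrite big_cat /= [RHS]mulrA fv_prod // mulrA.
case: ifP => wt; last by rewrite mulr0.
by rewrite -(fv_prod vs) -[RHS]mulrA [fv _ * (fv w * _)]mulrA fvM (negbTE nvw) mul0r mulr0.
Qed.

Lemma path_ext_vx v : ext (vx W v) = fv v.
Proof. by rewrite ext_word // big_nil mulr1. Qed.
Lemma path_ext_ar a : ext (ar W a) = fa a.
Proof. by rewrite ext_word /= ?eqxx // big_seq1. Qed.

Lemma path_ext1 : ext 1 = 1.
Proof.
rewrite -(sum_vx W) (big_morph ext path_extD path_ext0) -fv1.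
by apply: eq_bigr => v _; exact: path_ext_vx.
Qed.

End Multiplicative.

(** A path algebra is generated by its vertices and arrows, subject to the
    relations that hold between fv and fa by assumption. *)
Lemma path_universal : exists f : {rmorphism A -> R},
  [/\ forall (c : k) x, f (c *: x) = c *: f x,
      forall v, f (vx W v) = fv v & forall a, f (ar W a) = fa a].
Proof.
have [ext ext_lin ext_word] := word_ext W (fun v s => fv v * \prod_(a <- s) fa a).
have fB : zmod_morphism ext.
  move=> x y; rewrite (path_extD ext_lin) -scaleN1r (path_extZ ext_lin).
  by rewrite scaleN1r.
have fM : monoid_morphism ext.
  by split; [exact: path_ext1 | exact: path_extM].
pose f : {rmorphism A -> R} := HB.pack ext
  (GRing.isZmodMorphism.Build _ _ ext fB) (GRing.isMonoidMorphism.Build _ _ ext fM).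
exists f; split; [exact: path_extZ | exact: path_ext_vx | exact: path_ext_ar].
Qed.
End UniversalProperty.

(** * Connected components of a quiver *)
Section QuiverComponents.
Variable Q : quiver.
Local Notation V := (vertex Q).
Local Notation E := (arrow Q).
Local Notation tgt v s := (last v (map (@target Q) s)).

Definition adjacent : rel V := fun u v =>
  [exists a : E, ((source a == u) && (target a == v)) || ((source a == v) && (target a == u))].

(** Connectedness forgets the orientation of the arrows. *)
Definition linked (u v : V) : bool := connect adjacent u v.

Lemma linked_sym : symmetric linked.
Proof.
by apply: sym_connect_sym => u v; apply: eq_existsb => x; rewrite orbC.
Qed.

Lemma linked_refl u : linked u u. Proof. exact: connect0. Qed.

Lemma linked_arrow u a : linked u (source a) = linked u (target a).
Proof.
have st : linked (source a) (target a).
  by apply/connect1/existsP; exists a; rewrite !eqxx.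
apply/idP/idP => [us|ut]; first exact: connect_trans us st.
by apply: connect_trans ut _; rewrite -/(linked _ _) linked_sym.
Qed.

Lemma linked_trans : transitive linked. Proof. exact: connect_trans. Qed.

Lemma linked_ind (P : V -> Prop) u :
    (forall a, linked u (source a) -> (P (source a) <-> P (target a))) ->
    P u -> forall v, linked u v -> P v.
Proof.
move=> Pa Pu v /connectP[p]; elim/last_ind: p v => [|p w IHp] v; first by move=> _ ->.
rewrite rcons_path last_rcons => /andP[up adj ->].
have Pl := IHp _ up erefl.
have ul : linked u (last u p) by apply/connectP; exists p.
case/existsP: adj => a /orP[] /andP[/eqP sa /eqP ta].
  by rewrite -ta; apply/Pa; rewrite ?sa.
by rewrite -sa; apply/Pa; rewrite ?ta // linked_arrow ta.
Qed.

(** There is exactly one arrow out of v and at most one arrow into v. If this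
    holds on a whole component, the component is an oriented cycle, and exactly
    one arrow enters each vertex. *)
Definition thin (v : V) : Prop :=
  [/\ exists a : E, source a = v, forall a b : E, source a = v -> source b = v -> a = b
    & forall a b : E, target a = v -> target b = v -> a = b].

Definition cyclic_at (u : V) : Prop := forall v, linked u v -> thin v.

Definition out (v : V) : option E := [pick a | source a == v].
Definition next (v : V) : V := if out v is Some a then target a else v.
(** The walk of length m that follows the only arrow out of each vertex. *)
Fixpoint run (v : V) (m : nat) : seq E :=
  if m is m'.+1 then if out v is Some a then a :: run (target a) m' else [::] else [::].

(** The cycle through u has length n. *)
Definition period_at (u : V) (n : nat) : Prop :=
  [/\ (0 < n)%N, forall v, linked u v -> exists2 m, (m < n)%N & v = iter m next u,
      forall v, linked u v -> iter n next v = v &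
      forall m, iter m next u = u -> (n %| m)%N].

Section CyclicComponent.
Variable u : V.
Hypothesis cyc : cyclic_at u.

Lemma outP v : linked u v ->
  exists a, [/\ out v = Some a, source a = v, next v = target a & forall b, source b = v -> b = a].
Proof.
move=> uv; have [[b bv] uniq_out _] := cyc uv; rewrite /next /out.
case: pickP => [a /eqP av|/(_ b)]; last by rewrite bv eqxx.
by exists a; split=> // c cv; exact: uniq_out.
Qed.

Lemma linked_next v : linked u v -> linked u (next v).
Proof. by move=> uv; have [a [_ av -> _]] := outP uv; rewrite -linked_arrow av. Qed.

Lemma linked_iter m v : linked u v -> linked u (iter m next v).
Proof. by move=> uv; elim: m => //= m; exact: linked_next. Qed.

Lemma next_inj v w : linked u v -> linked u w -> next v = next w -> v = w.
Proof.
move=> uv uw vw; have [a [_ av na _]] := outP uv; have [b [_ bw nb _]] := outP uw.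
have [_ _ uniq_in] := cyc (linked_next uv).
by rewrite -av -bw; congr (source _); apply: uniq_in; [rewrite na | rewrite vw nb].
Qed.

Lemma iter_next_inj m v w : linked u v -> linked u w ->
  iter m next v = iter m next w -> v = w.
Proof.
by move=> uv uw; elim: m => //= m IHm /next_inj vw; apply/IHm/vw; exact: linked_iter.
Qed.

Lemma run_walk m v : linked u v ->
  [/\ is_walk v (run v m), size (run v m) = m & tgt v (run v m) = iter m next v].
Proof.
elim: m v => [//|m IHm] v uv; have [a [oa av na _]] := outP uv.
have := IHm _ (linked_next uv); rewrite na => -[rw rs rt].
by rewrite /= oa /= av eqxx rw rs rt -na -iterSr.
Qed.

Lemma walk_run v s : linked u v -> is_walk v s -> s = run v (size s).
Proof.
elim: s v => //= a s IHs v uv /andP[/eqP av ws].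
have [b [ob bv nb uniq_out]] := outP uv; rewrite ob.
by rewrite -(uniq_out a av) -(IHs (target a)) // -linked_arrow av.
Qed.

Lemma run_add i j v : linked u v -> run v (i + j) = run v i ++ run (iter i next v) j.
Proof.
elim: i v => [//|i IHi] v uv; have [a [oa av na _]] := outP uv.
by rewrite addSn /= oa -na IHi ?linked_next // -iterSr.
Qed.

(** The iterates of next on a finite set repeat, and next is injective, so u comes
    back to itself. The set of iterates of u is closed under moving along an arrow
    in either direction, hence is the whole component. *)
Lemma cyclic_period : exists n, period_at u n.
Proof.
have uu := linked_refl u.
have ex_n : exists n, (0 < n)%N && (iter n next u == u).
  (* Pigeonhole among the first #|V| + 1 iterates. *)
  have [f_inj|] := boolP (injectiveb (fun i : 'I_#|V|.+1 => iter i next u)).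
    have := leq_card _ (injectiveP _ f_inj); rewrite card_ord ltnn //.
  case/injectivePn => i [j]; wlog ij : i j / (i < j)%N => [H nij eij|_ eij].
    have [lt|lt|/val_inj ne] := ltngtP i j; first exact: (H i j).
      by apply: (H j i) => //; rewrite eq_sym.
    by rewrite ne eqxx in nij.
  exists (j - i)%N; rewrite subn_gt0 ij /=; apply/eqP/esym.
  apply: (@iter_next_inj i) => //; first exact: linked_iter.
  by rewrite -iterD subnKC // ltnW.
case: (ex_minnP ex_n) => n /andP[n0 /eqP nu] min_n.
have iter_mul q m : iter (q * n + m) next u = iter m next u.
  rewrite addnC iterD; congr (iter m _ _); elim: q => // q IHq.
  by rewrite mulSn addnC iterD nu.
have dvd m : iter m next u = u -> (n %| m)%N.
  rewrite (divn_eq m n) iter_mul => mu; apply/dvdn_add; first exact: dvdn_mull.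
  suff -> : (m %% n = 0)%N by [].
  apply/eqP; rewrite -leqn0 leqNgt; apply/negP => r0.
  have := min_n (m %% n)%N; rewrite r0 mu eqxx => /(_ isT).
  by rewrite leqNgt ltn_pmod.
have orbit v : linked u v -> exists2 m, (m < n)%N & v = iter m next u.
  suff H : linked u v -> linked u v /\ exists m, v = iter m next u.
    move=> /H[_ [m ->]]; exists (m %% n)%N; first by rewrite ltn_pmod.
    by rewrite {1}(divn_eq m n) iter_mul.
  apply: (linked_ind (P := fun v => linked u v /\ exists m, v = iter m next u)).
    move=> a ua; have ta : linked u (target a) by rewrite -linked_arrow.
    have na : next (source a) = target a.
      by have [b [_ _ -> uniq]] := outP ua; rewrite -(uniq a).
    split=> -[_ [m vm]]; split=> //; first by exists m.+1; rewrite iterS -vm.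
    exists (m + n.-1)%N; apply: next_inj => //; first exact: linked_iter.
    by rewrite -iterS -addnS prednK // na vm iterD nu.
  by split=> //; exists 0.
exists n; split=> // v uv; have [m _ ->] := orbit v uv.
by rewrite -iterD addnC iterD nu.
Qed.
End CyclicComponent.
End QuiverComponents.

(** * Central elements of a path algebra *)
Lemma horner_alg_sum (k : fieldType) (A : algType k) (x : A) f :
  horner_alg x f = \sum_(i < size f) f`_i *: x ^+ i.
Proof.
rewrite -{1}(coefK f) poly_def rmorph_sum; apply: eq_bigr => i _.
by rewrite -mul_polyC rmorphM rmorphXn /= horner_algC horner_algX mulr_algl.
Qed.

Lemma horner_alg_central (k : fieldType) (A : algType k) (x : A) f :
  (forall y, x * y = y * x) -> forall y, horner_alg x f * y = y * horner_alg x f.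
Proof.
move=> cx y; rewrite horner_alg_sum mulr_suml mulr_sumr; apply: eq_bigr => i _.
rewrite -scalerAl -scalerAr; congr (_ *: _).
by apply/commr_sym/commrX; rewrite /GRing.comm cx.
Qed.

Section CentralElements.
Variables (k : fieldType) (Q : quiver) (A : algType k) (W : path_basis Q A).
Local Notation V := (vertex Q).
Local Notation tgt v s := (last v (map (@target Q) s)).
Local Notation word := (word W).
Local Notation coef := (coef W).
Local Notation vx := (vx W).
Local Notation ar := (ar W).

Lemma central_gen (z : A) :
    (forall v, z * vx v = vx v * z) -> (forall a, z * ar a = ar a * z) ->
  forall x, z * x = x * z.
Proof.
move=> zv za; apply: (pathAlg_gen (W := W)) => // [x y zx zy|c x zx|x y zx zy].
- by rewrite mulrDr mulrDl zx zy.
- by rewrite -scalerAr -scalerAl zx.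
- by rewrite mulrA zx -mulrA zy mulrA.
Qed.

Section OneCentralElement.
Variable z : A.
Hypothesis cz : forall x, z * x = x * z.

Lemma central_closed v s : coef v s z != 0 -> is_walk v s /\ tgt v s = v.
Proof.
move=> nz; split; first by apply: contraNT nz => /coef_notwalk ->.
have := coef_Mvx W v v s z; rewrite cz coef_vxM eqxx.
by case: eqP => // _ e; rewrite e eqxx in nz.
Qed.

(** Compares the coefficients of z a and of a z at the walk a s. *)
Lemma central_arrow a s : is_walk (target a) s ->
  coef (target a) s z = if last a s == a then coef (source a) (belast a s) z else 0.
Proof.
move=> ts; have := coef_arM W a (source a) a s z; rewrite !eqxx /= => <-.
rewrite -cz lastI coef_Mar; case: eqP => //= la.
suff -> : is_walk (source a) (rcons (belast a s) a) by [].
by rewrite -[X in rcons _ X]la -lastI /= eqxx.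
Qed.

Lemma central_head a : coef (target a) [::] z = coef (source a) [::] z.
Proof. by rewrite central_arrow //= eqxx. Qed.

(** A closed walk in the support of z may start with any arrow out of its source,
    so there is only one such arrow; moving it to the end gives a walk in the
    support at the next vertex. *)
Lemma central_rotate a b s : coef (source a) (b :: s) z != 0 ->
  b = a /\ coef (target a) (rcons s a) z = coef (source a) (b :: s) z.
Proof.
move=> nz; have [ws ts] := central_closed nz.
have wsa : is_walk (source a) (rcons (b :: s) a) by rewrite -cats1 is_walk_cat ws ts /= eqxx.
have := coef_Mar W a (source a) (b :: s) a z; rewrite eqxx wsa /= cz coef_arM eqxx andbT.
by case: eqP => [-> //|_ e]; rewrite -e eqxx in nz.
Qed.

(** A central element is determined on a component by its coefficients at one
    vertex, since the arrows transport coefficients. *)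
Lemma central_vanish u : (forall s, coef u s z = 0) ->
  forall v, linked u v -> forall s, coef v s z = 0.
Proof.
move=> zu; apply: (linked_ind (P := fun v => forall s, coef v s z = 0)) => // a _.
split=> [za s|za [|b s]].
- have [/central_arrow ->|/coef_notwalk ->//] := boolP (is_walk (target a) s).
  by rewrite za if_same.
- by rewrite -central_head za.
apply/eqP; apply: contraT => nz; have [_ e] := central_rotate nz.
by rewrite -e za eqxx in nz.
Qed.

Lemma central_head_linked u v : linked u v -> coef v [::] z = coef u [::] z.
Proof.
apply: (linked_ind (P := fun v => coef v [::] z = coef u [::] z)) => // a _.
by rewrite central_head.
Qed.

(** The rotations of the closed walk reach every vertex of the component, and the
    walks in the support determine the arrow that leaves a vertex and the arrow
    that enters it. *)
Lemma central_cyclic u b s : coef u (b :: s) z != 0 -> cyclic_at u.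
Proof.
move=> nz; have H : forall v, linked u v -> exists b s, coef v (b :: s) z != 0.
  apply: (linked_ind (P := fun v => exists b s, coef v (b :: s) z != 0)); last by exists b, s.
  move=> a _; split=> -[{nz}b [{}s nz]].
    have [_ e] := central_rotate nz; case: s => [|c s] in nz e *.
      by exists a, [::]; rewrite e.
    by exists c, (rcons s a); rewrite e.
  have [ws _] := central_closed nz; move: nz; rewrite central_arrow //=.
  by case: (last b s =P a) => [_ nz|_]; [exists a, (belast b s) | rewrite eqxx].
move=> v /H[{nz}b [{}s nz]]; split.
- have [/= /andP[/eqP sb _] _] := central_closed nz; by exists b.
- move=> a c av cv; have nza : coef (source a) (b :: s) z != 0 by rewrite av.
  have nzc : coef (source c) (b :: s) z != 0 by rewrite cv.
  by have [<- _] := central_rotate nza; have [<- _] := central_rotate nzc.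
- have [ws _] := central_closed nz.
  have last_in a : target a = v -> last b s = a.
    move=> av; move: nz; rewrite -av central_arrow ?av //=.
    by case: (last b s =P a) => //; rewrite eqxx.
  by move=> a c /last_in <- /last_in <-.
Qed.
End OneCentralElement.

(** The identity of the factor of A that belongs to the component of u. *)
Definition component_unit (u : V) : A := \sum_(v | linked u v) vx v.
Local Notation eps := component_unit.

Lemma vx_component_unit u v : vx v * eps u = if linked u v then vx v else 0.
Proof.
rewrite mulr_sumr; case: ifP => uv.
  rewrite (bigD1 v) //= vxM eqxx big1 ?addr0 // => w /andP[_ nw].
  by rewrite vxM eq_sym (negbTE nw).
rewrite big1 // => w uw; rewrite vxM; case: eqP => // vw.
by rewrite vw uw in uv.
Qed.

Lemma component_unit_vx u v : eps u * vx v = if linked u v then vx v else 0.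
Proof.
rewrite mulr_suml; case: ifP => uv.
  rewrite (bigD1 v) //= vxM eqxx big1 ?addr0 // => w /andP[_ nw].
  by rewrite vxM (negbTE nw).
rewrite big1 // => w uw; rewrite vxM; case: eqP => // vw.
by rewrite -vw uw in uv.
Qed.

Lemma vx_ar_id a : vx (source a) * ar a = ar a. Proof. by rewrite vx_ar eqxx. Qed.
Lemma ar_vx_id a : ar a * vx (target a) = ar a. Proof. by rewrite ar_vx eqxx. Qed.

Lemma component_unit_central u x : eps u * x = x * eps u.
Proof.
move: x; apply: central_gen => [v|a].
  by rewrite component_unit_vx vx_component_unit.
rewrite -{1}vx_ar_id mulrA component_unit_vx -{2}ar_vx_id -mulrA vx_component_unit.
by rewrite -linked_arrow; case: ifP; rewrite ?mul0r ?mulr0 ?vx_ar_id ?ar_vx_id.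
Qed.

Lemma component_unit_idem u : eps u * eps u = eps u.
Proof.
rewrite {1}/component_unit mulr_suml; apply: eq_bigr => v uv.
by rewrite vx_component_unit uv.
Qed.

Lemma coef_component_unitM u v s x :
  coef v s (eps u * x) = if linked u v then coef v s x else 0.
Proof.
rewrite mulr_suml wcoef_sum; case: ifP => uv.
  rewrite (bigD1 v) //= coef_vxM eqxx big1 ?addr0 // => w /andP[_ nw].
  by rewrite coef_vxM (negbTE nw).
by rewrite big1 // => w uw; rewrite coef_vxM; case: eqP => // wv; rewrite -wv uw in uv.
Qed.

Lemma acyclic_central u z : (forall x, z * x = x * z) -> ~ cyclic_at u ->
  eps u * z = coef u [::] z *: eps u.
Proof.
move=> cz nc; apply: (coef_inj W) => v s.
rewrite coef_component_unitM wcoefZ -[eps u]mulr1 coef_component_unitM.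
case: ifP => uv; last by rewrite mulr0.
have coef1 : coef v s 1 = (s == [::])%:R.
  rewrite -(sum_vx W) wcoef_sum (bigD1 v) //= coef_word eqxx andbT /=.
  by rewrite big1 ?addr0 // => w nw; rewrite coef_word eq_sym (negbTE nw).
rewrite coef1; case: s {coef1} => [|b s]; first by rewrite mulr1 (central_head_linked cz uv).
rewrite mulr0; apply/eqP; apply: contraT => /(central_cyclic cz) cv; case: nc => w uw.
by apply: cv; apply: linked_trans uw; rewrite linked_sym.
Qed.

Section CyclicCenter.
Variable u : V.
Hypothesis cyc : cyclic_at u.
Variable n : nat.
Hypothesis n_gt0 : (0 < n)%N.
Hypothesis orbit : forall v, linked u v -> exists2 m, (m < n)%N & v = iter m (@next Q) u.
Hypothesis period : forall v, linked u v -> iter n (@next Q) v = v.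
Hypothesis min_period : forall m, iter m (@next Q) u = u -> (n %| m)%N.

(** The generator of the center of the component; the cycle based at a single
    vertex is not central. *)
Definition cycle_sum : A := \sum_(v | linked u v) word v (run v n).
Local Notation x := cycle_sum.

Lemma word_runM v i w j : linked u v ->
  word v (run v i) * word w (run w j) =
  if iter i (@next Q) v == w then word v (run v (i + j)) else 0.
Proof.
move=> uv; have [_ _ tv] := run_walk cyc i uv.
by rewrite wordM tv; case: eqP => // <-; rewrite (run_add cyc).
Qed.

Lemma word_run_cycle_sum v i : linked u v ->
  word v (run v i) * x = word v (run v (i + n)).
Proof.
move=> uv; have ui := linked_iter cyc i uv.
rewrite mulr_sumr (bigD1 (iter i (@next Q) v)) //= big1.
  by rewrite addr0 word_runM // eqxx.
by move=> w /andP[_ nw]; rewrite word_runM // eq_sym (negbTE nw).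
Qed.

Lemma cycle_sum_word_run v i : linked u v ->
  x * word v (run v i) = word v (run v (n + i)).
Proof.
move=> uv; rewrite mulr_suml (bigD1 v) //= big1.
  by rewrite addr0 word_runM // period // eqxx.
by move=> w /andP[uw nw]; rewrite word_runM // period // (negbTE nw).
Qed.

Lemma vx_run v : vx v = word v (run v 0). Proof. by []. Qed.

Lemma ar_run v : linked u v ->
  exists a, [/\ source a = v, ar a = word v (run v 1) & forall b, source b = v -> b = a].
Proof.
move=> uv; have [a [oa sa _ uniq]] := outP cyc uv.
by exists a; rewrite /= oa arE sa.
Qed.

Lemma cycle_sum_unit : eps u * x = x.
Proof.
rewrite mulr_sumr; apply: eq_bigr => v uv.
have vw : vx v * word v (run v n) = word v (run v n) by rewrite vx_word eqxx.
by rewrite -vw mulrA component_unit_vx uv.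
Qed.

Lemma vx_cycle_sum v : linked u v -> vx v * x = word v (run v n).
Proof. by move=> uv; rewrite vx_run word_run_cycle_sum. Qed.

Lemma cycle_sum_central y : x * y = y * x.
Proof.
have ex : x * eps u = x by rewrite -component_unit_central cycle_sum_unit.
move: y; apply: central_gen => [v|a].
  have [uv|nuv] := boolP (linked u v).
    by rewrite vx_cycle_sum // vx_run cycle_sum_word_run // addn0.
  rewrite -{1}ex -mulrA component_unit_vx (negbTE nuv) mulr0.
  by rewrite -cycle_sum_unit mulrA vx_component_unit (negbTE nuv) mul0r.
have [ua|nua] := boolP (linked u (source a)).
  have [b [_ bE uniq]] := ar_run ua; rewrite (uniq a erefl) bE.
  by rewrite cycle_sum_word_run // word_run_cycle_sum // addnC.
rewrite -{1}ex -mulrA -{1}vx_ar_id [eps u * (_ * _)]mulrA component_unit_vx (negbTE nua).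
rewrite mul0r mulr0 -cycle_sum_unit mulrA -component_unit_central.
by rewrite -{1}vx_ar_id [eps u * (_ * _)]mulrA component_unit_vx (negbTE nua) !mul0r.
Qed.

Lemma vx_cycle_sumX i : vx u * x ^+ i = word u (run u (i * n)).
Proof.
elim: i => [|i IHi]; first by rewrite expr0 mulr1.
by rewrite exprSr mulrA IHi word_run_cycle_sum ?linked_refl // mulSn addnC.
Qed.

Lemma vx_horner_cycle_sum f :
  vx u * horner_alg x f = \sum_(i < size f) f`_i *: word u (run u (i * n)).
Proof.
rewrite horner_alg_sum mulr_sumr; apply: eq_bigr => i _.
by rewrite -scalerAr vx_cycle_sumX.
Qed.

Lemma horner_cycle_sum_central f y : horner_alg x f * y = y * horner_alg x f.
Proof. exact/horner_alg_central/cycle_sum_central. Qed.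

Lemma coef_vx_horner f i : coef u (run u (i * n)) (vx u * horner_alg x f) = f`_i.
Proof.
rewrite vx_horner_cycle_sum wcoef_sum.
have cw (j : nat) : coef u (run u (i * n)) (word u (run u (j * n))) = (i == j)%:R.
  have [wj sj _] := run_walk cyc (j * n) (linked_refl u).
  have [_ si _] := run_walk cyc (i * n) (linked_refl u).
  rewrite coef_word eqxx wj andbT /=; congr (nat_of_bool _)%:R.
  apply/eqP/eqP => [e|-> //]; apply/eqP.
  by rewrite -(eqn_pmul2r n_gt0) -si e sj.
have [lt|le] := ltnP i (size f).
  rewrite (bigD1 (Ordinal lt)) //= wcoefZ cw eqxx mulr1 big1 ?addr0 // => j nj.
  rewrite wcoefZ cw; case: eqP => [ij|]; rewrite ?mulr0 //.
  by case/eqP: nj; apply: val_inj.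
rewrite nth_default // big1 // => j _; rewrite wcoefZ cw; case: eqP => [ij|]; rewrite ?mulr0 //.
by have := ltn_ord j; rewrite -ij ltnNge le.
Qed.

(** The closed walks at u are the powers of the cycle based at u, so the corner of A
    at u is a polynomial ring in the cycle. *)
Lemma loop_horner y : exists f, vx u * y * vx u = vx u * horner_alg x f.
Proof.
elim/(word_span W): y => [y z [f fy] [g gz]|c v s].
  by exists (f + g); rewrite mulrDr mulrDl fy gz rmorphD mulrDr.
rewrite -scalerAr -scalerAl vx_word; case: eqP => [<-|_]; last first.
  by exists 0; rewrite rmorph0 mul0r scaler0 mulr0.
have [ws|/(word_eq0 W)->] := boolP (is_walk u s); last first.
  by exists 0; rewrite rmorph0 mul0r scaler0 mulr0.
rewrite word_vx; case: eqP => [ts|_]; last by exists 0; rewrite rmorph0 scaler0 mulr0.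
have sr := walk_run cyc (linked_refl u) ws.
have [_ _ tr] := run_walk cyc (size s) (linked_refl u).
have /min_period/dvdnP[i si] : iter (size s) (@next Q) u = u by rewrite -tr -sr.
exists (c *: 'X^i); rewrite -mul_polyC rmorphM rmorphXn /= horner_algC horner_algX.
by rewrite mulr_algl -scalerAr vx_cycle_sumX -si -sr.
Qed.

(** By centrality it suffices to compare coefficients at u, where z agrees with a
    polynomial in the cycle. *)
Lemma cyclic_central z : (forall y, z * y = y * z) ->
  exists f, eps u * z = eps u * horner_alg x f.
Proof.
move=> cz; have [f fz] := loop_horner z; exists f; apply/eqP.
rewrite -subr_eq0 -mulrBr; apply/eqP/(coef_inj W) => v s.
have czf y : (z - horner_alg x f) * y = y * (z - horner_alg x f).
  by rewrite mulrBl mulrBr cz horner_cycle_sum_central.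
rewrite coef_component_unitM wcoef0; case: ifP => // uv; move: s.
apply: (central_vanish czf) uv => s.
have zu : vx u * (z - horner_alg x f) = 0.
  by rewrite mulrBr -fz -mulrA cz mulrA vxM eqxx subrr.
by have := coef_vxM W u u s (z - horner_alg x f); rewrite eqxx zu wcoef0.
Qed.

Lemma component_horner_inj f : eps u * horner_alg x f = 0 -> f = 0.
Proof.
move=> e0; have vf : vx u * horner_alg x f = 0.
  by have := vx_component_unit u u; rewrite linked_refl => <-; rewrite -mulrA e0 mulr0.
by apply/polyP => i; rewrite -coef_vx_horner vf wcoef0 poly.coef0.
Qed.

(** The two arcs between u and v on the cycle: their products are the cycles based
    at u and at v. *)
Lemma cycle_paths v : linked u v -> exists p q,
  [/\ vx u * p = p, p * vx v = p, q * vx u = q, p * q = vx u * x & q * p = vx v * x].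
Proof.
move=> uv; have [m mn vm] := orbit uv; have uu := linked_refl u.
exists (word u (run u m)), (word v (run v (n - m))).
have vu : iter (n - m) (@next Q) v = u by rewrite vm -iterD subnK ?period // ltnW.
have [_ _ tu] := run_walk cyc m uu; have [_ _ tv] := run_walk cyc (n - m) uv.
split.
- by rewrite vx_word eqxx.
- by rewrite word_vx tu -vm eqxx.
- by rewrite word_vx tv vu eqxx.
- by rewrite word_runM // -vm eqxx subnKC ?vx_cycle_sum // ltnW.
- by rewrite word_runM // vu eqxx subnK ?vx_cycle_sum // ltnW.
Qed.

End CyclicCenter.
End CentralElements.

(** * Modules that detect the vertices of a cycle *)
(** The corner of the center at e is presented as the ring T embedded by g. *)
Lemma corner_projection (A T : nzRingType) (e : center A) (g : {rmorphism T -> A}) :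
    e * e = e -> (forall f x, g f * x = x * g f) ->
    (forall f, val e * g f = 0 -> f = 0) ->
    (forall z : center A, exists f, val e * val z = val e * g f) ->
  exists rho : {rmorphism center A -> T},
  [/\ forall z, val e * val z = val e * g (rho z), rho e = 1,
      forall z, rho z = 0 -> e * z = 0 & forall t, exists z, rho z = t].
Proof.
move=> ee cg inj_g /choice[r rE].
have uniq f f' : val e * g f = val e * g f' -> f = f'.
  by move=> ff'; apply/eqP; rewrite -subr_eq0; apply/eqP/inj_g; rewrite rmorphB mulrBr ff' subrr.
have rB : zmod_morphism r.
  move=> x y; apply: uniq; rewrite [in RHS]rmorphB mulrBr -!rE -mulrBr.
  by congr (_ * _); exact: (rmorphB (@center_val A)).
have rM : monoid_morphism r.
  split=> [|x y]; apply: uniq; rewrite -rE.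
    by rewrite rmorph1; congr (_ * _); exact: (rmorph1 (@center_val A)).
  have -> : val (x * y) = val x * val y by exact: (rmorphM (@center_val A)).
  by rewrite [in RHS]rmorphM !mulrA rE centerP -!mulrA rE.
pose rho : {rmorphism center A -> T} := HB.pack r
  (GRing.isZmodMorphism.Build _ _ r rB) (GRing.isMonoidMorphism.Build _ _ r rM).
exists rho; split=> //.
- apply: uniq; rewrite -rE rmorph1 mulr1 -[in RHS]ee.
  by apply/esym; exact: (rmorphM (@center_val A)).
- move=> z rz; apply: val_inj; apply: etrans (rmorphM (@center_val A) _ _) _.
  by apply: etrans (rE z) _; rewrite -[r z]/(rho z) rz rmorph0 mulr0.
move=> t; exists (mk_center (cg t)); apply: uniq; rewrite -rE.
by congr (_ * _); exact: mk_centerE.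
Qed.

Section ModuleTools.
Variable R : nzRingType.

Lemma element_map_linear (M : lmodType R) (m : M) : linear (fun r : R^o => r *: m).
Proof. by move=> a x y; rewrite scalerDl scalerA. Qed.

(** The elements of M are the morphisms from R to M. *)
Lemma mono_injective (M N : lmodType R) (f : {linear M -> N}) m :
  mono (f : @hom (leftMod R) M N) -> f m = 0 -> m = 0.
Proof.
move=> mf fm; pose g := mk_linear (element_map_linear m).
have gg : g = lin_zero R^o M.
  apply: (mf R^o); apply: linear_ext => r; rewrite /= linear0.
  by apply: etrans (linearZ_LR _ _ _) _; rewrite fm; exact: scaler0.
have := congr1 (fun h : {linear R^o -> M} => h 1) gg.
by rewrite /= scale1r.
Qed.

Lemma injective_mono (M N : lmodType R) (f : {linear M -> N}) :
  (forall m, f m = 0 -> m = 0) -> mono (f : @hom (leftMod R) M N).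
Proof.
move=> inj_f W g h fgh; apply: linear_ext => w; apply/eqP; rewrite -subr_eq0; apply/eqP/inj_f.
have := congr1 (fun l : {linear W -> N} => l w) fgh => /= e.
by rewrite linearB e subrr.
Qed.

Lemma lmod_neq0 (M : leftMod R) : idm M <> lin_zero M M -> exists m : M, m != 0.
Proof.
move=> M0; apply: contrapT => nex; apply: M0; apply: linear_ext => m /=.
by apply/eqP; apply: contrapT => m0; apply: nex; exists m; apply/negP.
Qed.

Section PairSpan.
Variables (M N : lmodType R) (m : M) (n : N).
(** The cyclic submodule of M x N generated by (m, n). It embeds in both M and N
    when m and n have the same annihilator. *)
Definition pair_span : {pred (M * N)%type} := fun y => `[< exists r : R, y = (r *: m, r *: n) >].
Fact pair_span_submod : submod_closed pair_span.
Proof.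
split=> [|a x y /asboolP[r ->] /asboolP[s ->]]; apply/asboolP.
  by exists 0; rewrite !scale0r.
by exists (a * r + s); rewrite !scalerDl -!scalerA.
Qed.
HB.instance Definition _ := GRing.isSubmodClosed.Build R (M * N)%type pair_span pair_span_submod.
Definition pair_span_mod := {y : (M * N)%type | y \in pair_span}.
HB.instance Definition _ := SubChoice.on pair_span_mod.
HB.instance Definition _ := [SubChoice_isSubLmodule of pair_span_mod by <:].
Definition pair_span_type : lmodType R := pair_span_mod.
Definition pair_span_val : {linear pair_span_type -> (M * N)%type} := val.

Lemma same_annihilator_monos :
    (forall r : R, r *: m = 0 <-> r *: n = 0) ->
  exists (f : @hom (leftMod R) pair_span_type M) (g : @hom (leftMod R) pair_span_type N),
    mono f /\ mono g.
Proof.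
move=> ann; have l1 : linear (fun y : pair_span_type => (pair_span_val y).1).
  by move=> a x y; rewrite linearP.
have l2 : linear (fun y : pair_span_type => (pair_span_val y).2).
  by move=> a x y; rewrite linearP.
exists (mk_linear l1), (mk_linear l2); split; apply: injective_mono => y /= y0;
  have /asboolP[r yr] := valP y; apply: val_inj; rewrite yr; rewrite /pair_span_val /= yr /= in y0.
  by have := (ann r).1 y0 => ->; rewrite y0.
by have := (ann r).2 y0 => ->; rewrite y0.
Qed.
End PairSpan.
End ModuleTools.

Lemma center_poly_act (R : nzRingType) (p : {poly center R}) (L : lmodType {poly R}^c) (l : L) :
  center_act (center_poly p) L l = (map_poly (@center_val R) p : {poly R}^c) *: l.
Proof. by rewrite -center_polyE. Qed.

Section TwinModules.
Variables (k : fieldType) (Q : quiver) (A : algType k) (W : path_basis Q A).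
Local Notation V := (vertex Q).
Local Notation vx := (vx W).
Local Notation coef := (coef W).
Local Notation Rc := ({poly A}^c).
Local Notation cval := (@center_val A).

Definition vertex_eval (u : V) : {rmorphism {poly A} -> {poly k}} := map_poly (head_coef W u).
(** k[t], on which the walks of positive length and the other vertices act by
    zero. *)
Definition vertex_module (u : V) : leftMod Rc :=
  (restr (conv (vertex_eval u)) ({poly k}^c)^o : lmodType Rc).

Lemma vertex_module_act u (r : Rc) (m : vertex_module u) :
  r *: m = (m : {poly k}) * vertex_eval u (r : {poly A}).
Proof. by []. Qed.

(** A central element has the same constant coefficient at u and at w, and it acts
    on both modules through it. On a common submodule the vertex u would be both
    the identity and zero. *)
Lemma vertex_module_twin u w : linked u w -> u != w ->
  twin (vertex_module u) (vertex_module w).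
Proof.
move=> uw nuw.
have neq0 v : idm (vertex_module v) <> lin_zero (vertex_module v) (vertex_module v).
  move=> /(congr1 (fun h : {linear vertex_module v -> vertex_module v} => h (1 : {poly k}))) /=.
  by move/eqP; change ((1 : {poly k}) == 0 -> False); rewrite oner_eq0.
split; [exact: neq0 | exact: neq0 | |].
  move=> z; have [p <-] := center_poly_surj z.
  have same : vertex_eval u (map_poly cval p) = vertex_eval w (map_poly cval p).
    apply/polyP => i; rewrite !coef_map /=; apply/esym.
    by apply: central_head_linked uw => y; exact: centerP.
  have actE v m : center_act (center_poly p) (vertex_module v) m =
      (m : {poly k}) * vertex_eval v (map_poly cval p).
    by rewrite -center_polyE.
  have [z0|z0] := eqVneq (vertex_eval u (map_poly cval p)) 0.
    by left; split; apply: linear_ext => m; rewrite actE -?same z0 mulr0.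
  right; split; apply: injective_mono => m; rewrite actE -?same => /eqP;
    by rewrite mulf_eq0 (negbTE z0) orbF => /eqP.
move=> X f g mf mg; apply: linear_ext => x /=.
have eval_vx (v t : V) : vertex_eval t ((vx v)%:P) = if v == t then 1 else 0.
  rewrite /vertex_eval /= map_polyC /= /head_coef coef_word !andbT eq_sym.
  by case: eqP.
have fx : ((vx u)%:P : Rc) *: x = x.
  apply/eqP; rewrite -subr_eq0; apply/eqP/(mono_injective mf).
  rewrite linearB linearZ; apply/eqP; rewrite subr_eq0; apply/eqP.
  by rewrite /= vertex_module_act eval_vx eqxx mulr1.
have gx : ((vx u)%:P : Rc) *: x = 0.
  apply: (mono_injective mg); rewrite linearZ /= vertex_module_act eval_vx (negbTE nuw).
  by rewrite mulr0.
by rewrite -[LHS]fx gx.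
Qed.

End TwinModules.

Section TwinsOverCycles.
Variables (k : fieldType) (Q : quiver) (A : algType k) (W : path_basis Q A).
Local Notation V := (vertex Q).
Local Notation vx := (vx W).
Local Notation coef := (coef W).
Local Notation Rc := ({poly A}^c).
Local Notation cval := (@center_val A).
Local Notation eps := (component_unit W).

Variable u : V.
Hypothesis cyc : cyclic_at u.
Variable n : nat.
Hypothesis n_gt0 : (0 < n)%N.
Hypothesis orbit : forall v, linked u v -> exists2 m, (m < n)%N & v = iter m (@next Q) u.
Hypothesis period : forall v, linked u v -> iter n (@next Q) v = v.
Hypothesis min_period : forall m, iter m (@next Q) u = u -> (n %| m)%N.
Local Notation x := (cycle_sum W u n).

Definition cst (a : A) : Rc := a%:P.

Lemma act_mul (M : lmodType Rc) (m : M) (r s : {poly A}) :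
  (s : Rc) *: ((r : Rc) *: m) = ((r * s : {poly A}) : Rc) *: m.
Proof. by rewrite scalerA. Qed.

Lemma act_cst_mul (M : lmodType Rc) (m : M) (a b : A) :
  cst b *: (cst a *: m) = cst (a * b) *: m.
Proof. by rewrite scalerA; congr (_ *: m); apply/esym/polyCM. Qed.

Lemma act_cst_sum (M : lmodType Rc) (m : M) (F : V -> A) (P : pred V) :
  cst (\sum_(v | P v) F v) *: m = \sum_(v | P v) cst (F v) *: m.
Proof.
rewrite -scaler_suml; congr (_ *: _).
exact: (big_morph (fun a : A => a%:P : {poly A}) (fun a b => polyCD a b) erefl).
Qed.

Variables (M N : leftMod Rc).
Hypothesis twMN : twin M N.
Hypothesis eM : forall m : M, cst (eps u) *: m = m.

Let x_center : center A := mk_center (cycle_sum_central W cyc period).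
Let e_center : center A := mk_center (component_unit_central W u).

(** The element 1 - e kills M, which is not zero, so it is not injective on M and
    kills N as well. *)
Lemma twin_support (m : N) : cst (eps u) *: m = m.
Proof.
have [M0 _ dich _] := twMN.
have actE (L : leftMod Rc) (l : L) : center_act (center_poly (1 - e_center%:P)) L l =
    l - cst (eps u) *: l.
  have val1e : map_poly cval (1 - e_center%:P) = 1 - (eps u)%:P.
    rewrite rmorphB rmorph1; congr (_ - _); apply: etrans (map_polyC _ _) _.
    by congr _%:P; exact: mk_centerE.
  rewrite center_poly_act val1e.
  by apply: etrans (scalerBl (1 : Rc) (cst (eps u)) l) _; rewrite scale1r.
have [[_ zN]|[zM _]] := dich (center_poly (1 - e_center%:P)).
  apply/esym/eqP; rewrite -subr_eq0 -actE zN //.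
case: M0; apply: zM; apply: linear_ext => m' /=.
by apply: etrans (actE M m') _; rewrite eM subrr scaler0.
Qed.

(** Otherwise x is injective on both modules. Going around the cycle then moves a
    nonzero element of each of them to the vertex u. Such an element has an
    annihilator that can be read off from the central elements that kill the
    module, because the corner of A at u comes from the center; hence it is the
    same in M and in N, and both contain the same cyclic module. *)
Lemma twin_cycle_sum (m : M) : cst x *: m = 0.
Proof.
have [M0 N0 dich noX] := twMN.
have actE (L : leftMod Rc) (l : L) : center_act (center_poly x_center%:P) L l = cst x *: l.
  have valx : map_poly cval x_center%:P = x%:P.
    by apply: etrans (map_polyC _ _) _; congr _%:P; exact: mk_centerE.
  by rewrite center_poly_act valx.
have [[zM _]|[zM zN]] := dich (center_poly x_center%:P).
  by rewrite -actE zM.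
have xM (l : M) : cst x *: l = 0 -> l = 0 by rewrite -actE; exact: mono_injective.
have xN (l : N) : cst x *: l = 0 -> l = 0 by rewrite -actE; exact: mono_injective.
(* A nonzero element is nonzero at some vertex v; following the arc from v to u
   keeps it nonzero, because the full turn acts injectively. *)
have at_u (L : leftMod Rc) (eL : forall l : L, cst (eps u) *: l = l)
    (xL : forall l : L, cst x *: l = 0 -> l = 0) (l : L) : l != 0 ->
    exists2 l' : L, l' != 0 & cst (vx u) *: l' = l'.
  move=> l0; have [v uv lv] : exists2 v, linked u v & cst (vx v) *: l != 0.
    apply: contrapT => nex; case/eqP: l0; rewrite -(eL l) act_cst_sum big1 // => v uv.
    by apply/eqP; apply: contrapT => lv; apply: nex; exists v => //; apply/negP.
  have [p [q [_ _ qu _ qp]]] := cycle_paths W cyc orbit period uv.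
  exists (cst q *: (cst (vx v) *: l)); last by rewrite act_cst_mul qu.
  apply: contraNneq lv => q0; apply/eqP/xL.
  rewrite act_cst_mul.
  have -> : vx v * x = vx v * (q * p) by rewrite qp mulrA vxM eqxx.
  by rewrite mulrA -!act_cst_mul q0 scaler0.
have [m0 /(at_u M eM xM)[v v0 vu]] := lmod_neq0 M0.
have [n0 /(at_u N twin_support xN)[w w0 wu]] := lmod_neq0 N0.
have ann (L L' : leftMod Rc) (l : L) (l' : L')
    (eL' : forall l : L', cst (eps u) *: l = l)
    (xL' : forall l : L', cst x *: l = 0 -> l = 0)
    (dich' : forall z : center Rc,
      (forall l : L', center_act z L' l = 0) \/ mono (center_act z L : hom L L)) :
    l != 0 -> cst (vx u) *: l = l -> cst (vx u) *: l' = l' ->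
    forall r : Rc, r *: l = 0 -> r *: l' = 0.
  move=> l0 lu lu' r rl.
  rewrite -(eL' (r *: l')) act_cst_sum big1 // => v' uv'.
  have [p [q [_ _ qu pq qp]]] := cycle_paths W cyc orbit period uv'.
  have /choice[f fE] : forall i, exists f,
      vx u * ((r : {poly A})`_i * q) * vx u = vx u * horner_alg x f.
    by move=> i; exact: (loop_horner W cyc min_period).
  (* The central element z acts on elements at u as r followed by the arc q back
     to u. *)
  pose z : {poly center A} := \poly_(i < size (r : {poly A}))
    mk_center (horner_cycle_sum_central W cyc period (f i)).
  have zE : (vx u)%:P * map_poly cval z = (vx u)%:P * (r : {poly A}) * q%:P.
    apply/polyP => i; rewrite coefCM coef_map coefMC coefCM coef_poly.
    case: ltnP => [_|le].
      apply: etrans (congr1 (fun y => vx u * y) (mk_centerE _)) _.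
      by rewrite -fE -!mulrA qu.
    apply: etrans (congr1 (fun y => vx u * y) (rmorph0 cval)) _.
    by rewrite [in RHS]nth_default // !mulr0 mul0r.
  have zL (K : leftMod Rc) (y : K) : cst (vx u) *: y = y ->
      center_act (center_poly z) K y = cst q *: (r *: y).
    move=> yu; rewrite center_poly_act -[in LHS]yu.
    apply: etrans (act_mul y (vx u)%:P (map_poly cval z)) _; rewrite zE.
    apply: etrans (esym (act_mul y ((vx u)%:P * (r : {poly A})) q%:P)) _.
    congr (_ *: _); apply: etrans (esym (act_mul y (vx u)%:P (r : {poly A}))) _.
    exact: (congr1 (fun y : K => r *: y) yu).
  have zl' : center_act (center_poly z) L' l' = 0.
    case: (dich' (center_poly z)) => // mz.
    have zl : center_act (center_poly z) L l = 0.
      apply: etrans (zL L l lu) _; apply: etrans (congr1 (fun y : L => cst q *: y) rl) _.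
      exact: scaler0.
    by have l00 := mono_injective mz zl; rewrite l00 eqxx in l0.
  apply: xL'; rewrite act_cst_mul -qp -act_cst_mul.
  apply: etrans (congr1 (fun y : L' => cst p *: y) (esym (zL L' l' lu'))) _.
  by rewrite zl' scaler0.
have dichM z : (forall l : N, center_act z N l = 0) \/ mono (center_act z M : hom M M).
  by case: (dich z) => [[_ zN0]|[zM0 _]]; [left=> l; rewrite zN0 | right].
have dichN z : (forall l : M, center_act z M l = 0) \/ mono (center_act z N : hom N N).
  by case: (dich z) => [[zM0 _]|[_ zN0]]; [left=> l; rewrite zM0 | right].
have annvw (r : Rc) : r *: v = 0 <-> r *: w = 0.
  split; first exact: (ann M N v w twin_support xN dichM v0 vu wu r).
  exact: (ann N M w v eM xM dichN w0 wu vu r).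
have [f [g [mf mg]]] := same_annihilator_monos annvw.
have X0 := noX _ f g mf mg.
have vw_in : (v, w) \in pair_span v w.
  by apply/asboolP; exists 1; rewrite !scale1r.
pose y : pair_span_mod v w := Sub (v, w) vw_in.
have := congr1 (fun h : {linear pair_span_type v w -> pair_span_type v w} => (val (h y)).1) X0.
rewrite /= => v00; by rewrite v00 eqxx in v0.
Qed.
End TwinsOverCycles.

(** * Coordinates on each component *)
Section ComponentData.
Variables (k : fieldType) (Q : quiver) (A : algType k) (W : path_basis Q A).
Local Notation V := (vertex Q).
Local Notation D2 := {poly {poly k}}.
Local Notation vx := (vx W).
Local Notation ar := (ar W).
Local Notation coef := (coef W).
Local Notation eps := (component_unit W).
Local Notation cval := (@center_val A).

(** Replaces the variable x of k[x][t] by an element of A. *)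
Definition eval_at (x : A) : {rmorphism D2 -> {poly A}} := map_poly (horner_alg x).

(** Says that x is a polynomial in the vertices and in the arrows of the component
    of u, in terms of the morphisms out of A. *)
Definition supported_on (u : V) (x : A) : Prop :=
  forall (R : nzRingType) (f g : {rmorphism A -> R}),
    (forall v, f (vx v) = g (vx v)) ->
    (forall e, linked u (source e) -> f (ar e) = g (ar e)) -> f x = g x.

(** On the component of u, S is s(x, t) for a polynomial s such that (h, s) is a
    coordinate system of the plane: the line s = 0 is parametrized by (a, b) with
    coordinate h. Only for a loop, whose arrow is x itself, may h differ from
    x. A component that is not an oriented cycle is treated with x = 0. *)
Definition component_split (S : {poly A}) (u : V) (x : A) (h : D2) (a b : {poly k})
    (is_loop : bool) : Prop :=
  [/\ forall y, x * y = y * x, supported_on u x,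
      exists s, [/\ (eps u)%:P * S = (eps u)%:P * eval_at x s, subst2 a b s = 0,
        exists w, subst1 h a - 'X%:P = s * w & exists w, subst1 h b - 'X = s * w],
      subst2 a b h = 'X &
      if is_loop then
        [/\ eps u = vx u, exists e, linked u (source e) &
          forall e, linked u (source e) -> [/\ source e = u, target e = u & ar e = x]]
      else h = 'X%:P /\ a = 'X].

Definition unit_center (u : V) : center A := mk_center (component_unit_central W u).
Lemma unit_centerE u : val (unit_center u) = eps u. Proof. exact: mk_centerE. Qed.
Lemma unit_center_idem u : unit_center u * unit_center u = unit_center u.
Proof.
apply: val_inj; apply: etrans (rmorphM cval _ _) _.
by apply: etrans (component_unit_idem W u) _; rewrite -unit_centerE.
Qed.

Variables (B : nzRingType) (Phi : {rmorphism {poly center B} -> {poly center A}}).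
Hypothesis inj_Phi : injective Phi.
Hypothesis surj_Phi : forall f, exists p, Phi p = f.
Let S : {poly A} := map_poly cval (Phi 'X).

Lemma coef_component_unit u : coef u [::] (eps u) = 1.
Proof.
rewrite -[eps u]mulr1 coef_component_unitM linked_refl.
exact: (rmorph1 (head_coef W u)).
Qed.

Lemma acyclic_split u : ~ cyclic_at u ->
  exists x h a b, component_split S u x h a b false.
Proof.
move=> nc; pose e := unit_center u.
have inj_g (f : k) : val e * in_alg A f = 0 -> f = 0.
  rewrite unit_centerE /= mulr_algr => /(congr1 (coef u [::])).
  by rewrite wcoefZ coef_component_unit mulr1 wcoef0.
have cg (f : k) (y : A) : in_alg A f * y = y * in_alg A f by rewrite /= mulr_algl mulr_algr.
have gz (z : center A) : exists f : k, val e * val z = val e * in_alg A f.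
  exists (coef u [::] (val z)); rewrite unit_centerE /= mulr_algr.
  by apply: acyclic_central => // y; exact: centerP.
have [rho [rhoE rho1 rho0 rhoS]] := corner_projection (unit_center_idem u) cg inj_g gz.
have [b [sb [w Xb]]] := component_line inj_Phi surj_Phi (unit_center_idem u) rho1 rho0 rhoS.
set s := map_poly rho (Phi 'X) in sb Xb.
exists 0, 'X%:P, 'X, b%:P; split=> //.
- by move=> y; rewrite mulr0 mul0r.
- by move=> R f g _ _; rewrite !rmorph0.
- exists (map_poly polyC s); split.
  + apply/polyP => i; rewrite !coefCM coef_map /=.
    have -> : (eval_at 0 (map_poly polyC s))`_i = in_alg A (rho (Phi 'X)`_i).
      by rewrite /eval_at /= !coef_map /= horner_algC.
    by have := rhoE (Phi 'X)`_i; rewrite unit_centerE.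
  + rewrite /subst2 /= /horner_eval -map_poly_comp.
    rewrite (eq_map_poly (g := polyC)); last by move=> c /=; rewrite comp_polyC.
    by rewrite horner_map /= sb polyC0.
  + by exists 0; rewrite subst1X subrr mulr0.
  + exists (- map_poly polyC w); rewrite subst1C mulrN -rmorphM -Xb rmorphB /=.
    by rewrite map_polyX map_polyC /= opprB.
- by rewrite subst2Y.
Qed.

Lemma cycle_sum_supported u n : cyclic_at u -> supported_on u (cycle_sum W u n).
Proof.
move=> cyc R f g fv fa; rewrite !rmorph_sum; apply: eq_bigr => v.
move: (run v n) => s; elim: s v => [|e s IHs] v uv; first exact: fv.
rewrite word_cons; case: eqP => [ev|_]; last by rewrite !rmorph0.
by rewrite !rmorphM fa ?ev // IHs // -linked_arrow ev.
Qed.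

(** A cycle with at least two vertices has a vertex w different from u, to which
    the hypothesis on translates applies; the coefficients of a central element at
    the trivial path of u being zero means that it is divisible by x. *)
Lemma cyclic_split u :
    cyclic_at u ->
    (forall w n p (x : center A), linked u w -> u != w -> period_at u n ->
       val x = cycle_sum W u n -> Phi p = x%:P ->
       forall b i, coef u [::] (val (Phi (p \Po ('X + b%:P)))`_i) = 0) ->
  exists x h a b is_loop, component_split S u x h a b is_loop.
Proof.
move=> cyc trans; pose e := unit_center u.
have [n [n_gt0 orbit period min_period]] := cyclic_period cyc.
pose x := cycle_sum W u n.
have inj_g f : val e * horner_alg x f = 0 -> f = 0.
  by rewrite unit_centerE; exact: (component_horner_inj cyc n_gt0).
have gz (z : center A) : exists f, val e * val z = val e * horner_alg x f.
  by rewrite unit_centerE; apply: (cyclic_central W cyc) => // y; exact: centerP.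
have [rho [rhoE rho1 rho0 rhoS]] := corner_projection (unit_center_idem u)
  (horner_cycle_sum_central W cyc period) inj_g gz.
pose xc : center A := mk_center (cycle_sum_central W cyc period).
have rho_x : rho xc = 'X.
  apply/eqP; rewrite -subr_eq0; apply/eqP/inj_g; rewrite rmorphB mulrBr -rhoE.
  apply/eqP; rewrite subr_eq0; apply/eqP; congr (_ * _).
  by apply: etrans (mk_centerE _) _; apply/esym; exact: horner_algX.
have [p px] := surj_Phi xc%:P.
pose is_loop := [forall v, linked u v ==> (v == u)].
have [|h [a [b [habX s0 aw bw noloop]]]] := component_plane inj_Phi surj_Phi
    (fixY := ~~ is_loop) (unit_center_idem u) rho1 rho0 rhoS rho_x px.
  case/forallPn => w; rewrite negb_imply eq_sym => /andP[uw nwu] c.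
  apply: (@polyC_dvd_coefs k 'X) => i; rewrite -[X in X %| _]subr0 dvdp_XsubCl.
  apply/rootP; rewrite horner_coef0 coef_map.
  set z := (Phi _)`_i; rewrite -(coef_vx_horner W cyc n_gt0 (rho z) 0).
  have vue : vx u * eps u = vx u by rewrite vx_component_unit linked_refl.
  rewrite -[in LHS]vue -mulrA -{1}unit_centerE -rhoE unit_centerE mulrA vue coef_vxM eqxx.
  by apply: (trans w n p xc) => //; exact: mk_centerE.
exists x, h, a, b, is_loop; split=> //.
- exact: cycle_sum_central.
- exact: cycle_sum_supported.
- exists (map_poly rho (Phi 'X)); split=> //.
  apply/polyP => i; rewrite !coefCM coef_map /=.
  have -> : (eval_at x (map_poly rho (Phi 'X)))`_i = horner_alg x (rho (Phi 'X)`_i).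
    by rewrite /eval_at /= !coef_map.
  by have := rhoE (Phi 'X)`_i; rewrite unit_centerE.
case: ifP => [/forallP loop|/negbT/noloop //].
have only v : linked u v -> v = u by move=> uv; apply/eqP; have := loop v; rewrite uv.
have eu : eps u = vx u.
  rewrite /component_unit (bigD1 u) ?linked_refl //= big1 ?addr0 // => v /andP[uv].
  by rewrite (only v uv) eqxx.
have [c0 [oc0 sc0 _ _]] := outP cyc (linked_refl u).
split=> //; first by exists c0; rewrite sc0 linked_refl.
move=> c uc; have ct : linked u (target c) by rewrite -linked_arrow.
split; [exact: only | exact: only |].
have [c' [oc sc nc uniq]] := outP cyc (linked_refl u).
have n1 : n = 1%N.
  apply/eqP; rewrite -dvdn1; apply: min_period.
  by rewrite /= (only _ (linked_next cyc (linked_refl u))).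
rewrite /x /cycle_sum (bigD1 u) ?linked_refl //= big1 ?addr0 => [|v /andP[uv]].
  by rewrite n1 /= oc (uniq c (only _ uc)) arE sc.
by rewrite (only v uv) eqxx.
Qed.
End ComponentData.

(** * The splitting of the quotient *)
Section Splitting.
Variables (k : fieldType) (Q : quiver) (A : algType k) (W : path_basis Q A).
Local Notation V := (vertex Q).
Local Notation D2 := {poly {poly k}}.
Local Notation vx := (vx W).
Local Notation ar := (ar W).
Local Notation eps := (component_unit W).
Local Notation cval := (@center_val A).

Lemma eval_at_central (x : A) (f : D2) :
  (forall y, x * y = y * x) -> forall g, eval_at x f * g = g * eval_at x f.
Proof.
move=> cx g; apply/polyP => i; rewrite coefM coefMr; apply: eq_bigr => j _.
by rewrite coef_map /= horner_alg_central.
Qed.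

Lemma path_morph_eq (R : nzRingType) (f g : {rmorphism A -> R}) :
    (forall c : k, f c%:A = g c%:A) -> (forall v, f (vx v) = g (vx v)) ->
    (forall e, f (ar e) = g (ar e)) -> f =1 g.
Proof.
move=> fc fv fe; apply: (pathAlg_gen (W := W)) => // [x y fx fy|c x fx|x y fx fy].
- by rewrite !rmorphD fx fy.
- by rewrite -mulr_algl !rmorphM fc fx.
- by rewrite !rmorphM fx fy.
Qed.

(** One vertex is chosen in each component, so that all the vertices of a component
    use the same coordinates. *)
Definition rep (v : V) : V := fingraph.root (@adjacent Q) v.
Lemma linked_rep v : linked (rep v) v.
Proof. rewrite linked_sym; exact: connect_root. Qed.
Lemma rep_linked v w : linked v w -> rep v = rep w.
Proof. by move=> vw; apply/eqP; rewrite root_connect //; exact: linked_sym. Qed.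
Lemma rep_rep v : rep (rep v) = rep v. Proof. exact: rep_linked (linked_rep v). Qed.

Variables (Z : {poly center A}).
Let S := map_poly cval Z.
Variables (x : V -> A) (h : V -> D2) (a b : V -> {poly k}) (lp : V -> bool).
Hypothesis data : forall u, component_split W S u (x u) (h u) (a u) (b u) (lp u).

Lemma x_central u y : x u * y = y * x u. Proof. by case: (data u) => ->. Qed.

Lemma S_central f : S * f = f * S.
Proof. exact: esym (center_poly_central Z f). Qed.

Lemma loop_component u : lp u -> eps u = vx u.
Proof. by case: (data u) => _ _ _ _; case: (lp u) => // -[]. Qed.
Lemma loop_arrow u e : lp u -> linked u (source e) ->
  [/\ source e = u, target e = u & ar e = x u].
Proof. by case: (data u) => _ _ _ _; case: (lp u) => // -[_ _ H] _; exact: H. Qed.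

(** The loop of a component with one vertex and one arrow goes to h(loop, t); the
    other arrows are fixed. *)
Lemma splitting_sg : exists sg : {rmorphism A -> {poly A}},
  [/\ forall c : k, sg c%:A = c%:A%:P, forall v, sg (vx v) = (vx v)%:P &
      forall e, sg (ar e) = if lp (rep (source e))
        then eval_at (x (rep (source e))) (h (rep (source e))) * (vx (source e))%:P
        else (ar e)%:P].
Proof.
pose fa e : polyAlg A := if lp (rep (source e))
  then eval_at (x (rep (source e))) (h (rep (source e))) * (vx (source e))%:P
  else (ar e)%:P.
have vv v : (vx v)%:P * (vx v)%:P = (vx v)%:P :> {poly A} by rewrite -polyCM vxM eqxx.
have [||||f [fZ fv fae]] := @path_universal k Q A (polyAlg A) W (fun v => (vx v)%:P) fa.
- move=> v w; change ((vx v)%:P * (vx w)%:P = (if v == w then (vx v)%:P else 0) :> {poly A}).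
  by rewrite -polyCM vxM; case: eqP.
- change (\sum_v (vx v)%:P = 1 :> {poly A}).
  by rewrite -(rmorph_sum polyC) sum_vx.
- move=> e; rewrite /fa; case: ifP => _.
    set f := eval_at _ _.
    change ((vx (source e))%:P * (f * (vx (source e))%:P) = f * (vx (source e))%:P :> {poly A}).
    by rewrite mulrA -eval_at_central ?vv -?mulrA ?vv //; exact: x_central.
  change ((vx (source e))%:P * (ar e)%:P = (ar e)%:P :> {poly A}).
  by rewrite -polyCM vx_ar_id.
- move=> e; rewrite /fa; case: ifP => loop.
    have [se te _] := loop_arrow loop (linked_rep (source e)).
    set f := eval_at _ _.
    change (f * (vx (source e))%:P * (vx (target e))%:P = f * (vx (source e))%:P :> {poly A}).
    by rewrite te -se -mulrA vv.
  change ((ar e)%:P * (vx (target e))%:P = (ar e)%:P :> {poly A}).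
  by rewrite -polyCM ar_vx_id.
exists f; split=> // c; rewrite fZ rmorph1.
by change (c%:A *: (1 : {poly A}) = c%:A%:P); rewrite alg_polyC.
Qed.

(** The inverse substitution modulo S on the coefficients: the loop x goes to its
    image a(x), while t goes to b(x), which is the element tau below. *)
Lemma splitting_th0 : exists th0 : {rmorphism A -> A},
  [/\ forall c : k, th0 c%:A = c%:A, forall v, th0 (vx v) = vx v &
      forall e, th0 (ar e) = if lp (rep (source e))
        then horner_alg (x (rep (source e))) (a (rep (source e))) * vx (source e) else ar e].
Proof.
pose fa e := if lp (rep (source e))
  then horner_alg (x (rep (source e))) (a (rep (source e))) * vx (source e) else ar e.
have vv v : vx v * vx v = vx v by rewrite vxM eqxx.
have [||||f [fZ fv fae]] := @path_universal k Q A A W vx fa.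
- exact: vxM.
- exact: sum_vx.
- move=> e; rewrite /fa; case: ifP => _; last exact: vx_ar_id.
  by rewrite mulrA -horner_alg_central -?mulrA ?vv //; exact: x_central.
- move=> e; rewrite /fa; case: ifP => loop; last exact: ar_vx_id.
  have [se te _] := loop_arrow loop (linked_rep (source e)).
  by rewrite te -se -mulrA vv.
by exists f; split=> // c; rewrite fZ rmorph1.
Qed.
(** The image of t under th: the polynomial b(x) on each component. *)
Definition tau : A := \sum_v vx v * horner_alg (x (rep v)) (b (rep v)).

Lemma vx_tau v : vx v * tau = vx v * horner_alg (x (rep v)) (b (rep v)).
Proof.
rewrite mulr_sumr (bigD1 v) //= mulrA vxM eqxx big1 ?addr0 // => w nw.
by rewrite mulrA vxM eq_sym (negbTE nw) mul0r.
Qed.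

Lemma tau_vx v : tau * vx v = vx v * horner_alg (x (rep v)) (b (rep v)).
Proof.
have xc u : forall f y, horner_alg (x u) f * y = y * horner_alg (x u) f.
  by move=> f; apply: horner_alg_central; exact: x_central.
rewrite mulr_suml (bigD1 v) //= -mulrA xc mulrA vxM eqxx big1 ?addr0 // => w nw.
by rewrite -mulrA xc mulrA vxM (negbTE nw) mul0r.
Qed.

Lemma tau_central y : tau * y = y * tau.
Proof.
move: y; apply: (central_gen (W := W)) => [v|e]; first by rewrite tau_vx vx_tau.
rewrite -{1}vx_ar_id mulrA tau_vx -[in RHS]ar_vx_id -[RHS]mulrA vx_tau.
have <- : rep (source e) = rep (target e).
  by apply: rep_linked; rewrite -linked_arrow linked_refl.
have cx := horner_alg_central (b (rep (source e))) (x_central (rep (source e))).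
by rewrite -[LHS]mulrA cx [LHS]mulrA vx_ar_id [RHS]mulrA ar_vx_id.
Qed.

Lemma unit_tau v : eps (rep v) * tau = eps (rep v) * horner_alg (x (rep v)) (b (rep v)).
Proof.
rewrite /component_unit !mulr_suml; apply: eq_bigr => w vw.
by rewrite vx_tau -(rep_linked vw) rep_rep.
Qed.

Variables (sg : {rmorphism A -> {poly A}}) (th0 : {rmorphism A -> A}).
Hypothesis sgC : forall c : k, sg c%:A = c%:A%:P.
Hypothesis sgV : forall v, sg (vx v) = (vx v)%:P.
Hypothesis sgA : forall e, sg (ar e) = if lp (rep (source e))
        then eval_at (x (rep (source e))) (h (rep (source e))) * (vx (source e))%:P
        else (ar e)%:P.
Hypothesis th0C : forall c : k, th0 c%:A = c%:A.
Hypothesis th0V : forall v, th0 (vx v) = vx v.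
Hypothesis th0A : forall e, th0 (ar e) = if lp (rep (source e))
        then horner_alg (x (rep (source e))) (a (rep (source e))) * vx (source e) else ar e.

Fact tau_comm : commr_rmorph th0 tau.
Proof. by move=> y; rewrite /GRing.comm tau_central. Qed.

Definition splitting_th : {rmorphism {poly A} -> A} := horner_morph tau_comm.
Local Notation th := splitting_th.

Lemma thC c : th c%:P = th0 c. Proof. exact: horner_morphC. Qed.
Lemma thX : th 'X = tau. Proof. exact: horner_morphX. Qed.

Lemma th0_unit u : th0 (eps u) = eps u.
Proof. by rewrite /component_unit rmorph_sum; apply: eq_bigr => v _; exact: th0V. Qed.
Lemma sg_unit u : sg (eps u) = (eps u)%:P.
Proof.
rewrite /component_unit !rmorph_sum; apply: eq_bigr => v _; exact: sgV.
Qed.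

Lemma unit_th0_x v : eps (rep v) * th0 (x (rep v)) =
  eps (rep v) * horner_alg (x (rep v)) (a (rep v)).
Proof.
set r := rep v; have rr : rep r = r by exact: rep_rep.
have [_ supp _ _] := data r; case: (boolP (lp r)) => lpr.
  case=> er [e re] /(_ e re)[se te ae].
  rewrite er -{1}ae th0A se rr lpr mulrA.
  have cx := horner_alg_central (a r) (x_central r).
  by rewrite -cx -mulrA vxM eqxx cx.
case=> _ ->; rewrite horner_algX; congr (_ * _).
apply: (supp A th0 idfun) => [w|e re]; first exact: th0V.
by rewrite th0A -(rep_linked re) rr (negbTE lpr).
Qed.

Lemma unit_sg_x v : (eps (rep v))%:P * sg (x (rep v)) =
  (eps (rep v))%:P * eval_at (x (rep v)) (h (rep v)).
Proof.
set r := rep v; have rr : rep r = r by exact: rep_rep.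
have [_ supp _ _] := data r; case: (boolP (lp r)) => lpr.
  case=> er [e re] /(_ e re)[se te ae].
  rewrite er -{1}ae sgA se rr lpr mulrA.
  have cx := eval_at_central (h r) (x_central r).
  by rewrite -cx -mulrA -polyCM vxM eqxx cx.
case=> -> _; congr (_ * _); apply: etrans (_ : (x r)%:P = _).
  apply: (supp {poly A} sg polyC) => [w|e re]; first exact: sgV.
  by rewrite sgA -(rep_linked re) rr (negbTE lpr).
by rewrite /eval_at /= map_polyC /= horner_algX.
Qed.

Lemma unit_th_eval v f : eps (rep v) * th (eval_at (x (rep v)) f) =
  eps (rep v) * horner_alg (x (rep v)) (subst2 (a (rep v)) (b (rep v)) f).
Proof.
set r := rep v.
apply: (@eq_rmorph_poly2 k A (eps r) (th \o eval_at (x r))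
  (horner_alg (x r) \o subst2 (a r) (b r))).
- exact: component_unit_central.
- move=> c; congr (_ * _); rewrite [LHS]/= [RHS]/= subst2C horner_algC.
  by rewrite /eval_at /= !map_polyC /= horner_algC thC th0C.
- rewrite [X in _ * X = _]/= [X in _ = _ * X]/= subst2Y.
  rewrite [eval_at _ _](_ : _ = (x r)%:P) ?thC ?unit_th0_x //.
  by rewrite /eval_at /= map_polyC /= horner_algX.
- rewrite [X in _ * X = _]/= [X in _ = _ * X]/= subst2X.
  by rewrite [eval_at _ _](_ : _ = 'X) ?thX ?unit_tau // /eval_at /= map_polyX.
Qed.

Lemma polyC_central c f : (forall y : A, c * y = y * c) -> c%:P * f = f * c%:P.
Proof. by move=> cc; apply/polyP => i; rewrite coefCM coefMC cc. Qed.

Lemma unit_sg_horner v f : (eps (rep v))%:P * sg (horner_alg (x (rep v)) f) =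
  (eps (rep v))%:P * eval_at (x (rep v)) (subst1 (h (rep v)) f).
Proof.
set r := rep v.
apply: (@eq_rmorph_poly k {poly A} (eps r)%:P (sg \o horner_alg (x r))
  (eval_at (x r) \o subst1 (h r))).
- by move=> g; apply: polyC_central; exact: component_unit_central.
- move=> c; congr (_ * _); rewrite [LHS]/= [RHS]/= subst1C horner_algC sgC.
  by rewrite /eval_at /= !map_polyC /= horner_algC.
- rewrite [X in _ * X = _]/= [X in _ = _ * X]/= subst1X horner_algX; exact: unit_sg_x.
Qed.

Lemma th_sgK : cancel sg th.
Proof.
move=> y; apply: (path_morph_eq (f := th \o sg) (g := idfun)) => [c|v|e] /=.
- by rewrite sgC thC th0C.
- by rewrite sgV thC th0V.
rewrite sgA; case: ifP => lpr; last by rewrite thC th0A lpr.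
set r := rep (source e) in lpr *; have re : linked r (source e) by exact: linked_rep.
have [se te ae] := loop_arrow lpr re.
have er := loop_component lpr; rewrite rmorphM thC th0V se -er -component_unit_central.
have [_ _ _ hX _] := data r.
rewrite unit_th_eval hX horner_algX -ae er -se; exact: vx_ar_id.
Qed.

Lemma th_S : th S = 0.
Proof.
rewrite -[th S]mul1r -(sum_vx W) mulr_suml big1 // => v _.
set r := rep v; have vr : vx v * eps r = vx v by rewrite vx_component_unit linked_rep.
have [_ _ [s [Ss s0 _ _]] _ _] := data r.
have -> : vx v * th S = vx v * (eps r * th S) by rewrite mulrA vr.
have -> : eps r * th S = 0; last by rewrite mulr0.
rewrite -{1}th0_unit -thC -rmorphM Ss rmorphM thC th0_unit unit_th_eval s0 rmorph0 mulr0.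
by [].
Qed.

Definition congruent (f : {poly A}) := exists u, f - sg (th f) = S * u.

Lemma congruentD f g : congruent f -> congruent g -> congruent (f + g).
Proof.
move=> [u fu] [w gw]; exists (u + w); rewrite !rmorphD mulrDr -fu -gw.
by rewrite opprD addrACA.
Qed.

Lemma congruentM f g : congruent f -> congruent g -> congruent (f * g).
Proof.
move=> [u fu] [w gw]; exists (u * g + sg (th f) * w).
rewrite mulrDr !mulrA -fu S_central -mulrA -gw !rmorphM mulrBl mulrBr.
by rewrite addrA subrK.
Qed.

Lemma congruent_fixed f : sg (th f) = f -> congruent f.
Proof. by move=> ff; exists 0; rewrite ff subrr mulr0. Qed.

Lemma congruent_unit v d :
    (exists w, (eps (rep v))%:P * d = (eps (rep v))%:P * eval_at (x (rep v)) w /\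
      exists s w', (eps (rep v))%:P * S = (eps (rep v))%:P * eval_at (x (rep v)) s /\
        w = s * w') ->
  exists u, (eps (rep v))%:P * d = S * u.
Proof.
case=> w [-> [s [w' [Ss ->]]]]; exists ((eps (rep v))%:P * eval_at (x (rep v)) w').
by rewrite rmorphM mulrA -Ss -S_central -mulrA.
Qed.

(** The elements f congruent to sg (th f) modulo S form a subring. It contains t
    and the loops, by the congruences b(h) = t and a(h) = x modulo s, and the other
    generators are fixed. *)
Lemma congruent_all f : congruent f.
Proof.
elim/poly_ind: f => [|f c IHf]; first by apply: congruent_fixed; rewrite !rmorph0.
apply: congruentD; first apply: congruentM => //.
  have /choice[u uE] : forall v, exists u, (vx v)%:P * ('X - sg (th 'X)) = S * u.
    move=> v; have vr : vx v * eps (rep v) = vx v by rewrite vx_component_unit linked_rep.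
    have [|u uE] := @congruent_unit v ('X - sg (th 'X)).
      have [_ _ [s [Ss _ _ [w bw]]] _ _] := data (rep v).
      exists ('X - subst1 (h (rep v)) (b (rep v))); split.
        rewrite mulrBr rmorphB mulrBr thX; congr (_ - _).
          by congr (_ * _); rewrite /eval_at /= map_polyX.
        by rewrite -sg_unit -rmorphM unit_tau rmorphM sg_unit unit_sg_horner.
      by exists s, (- w); split=> //; rewrite mulrN -bw opprB.
    exists ((vx v)%:P * u); rewrite mulrA S_central -mulrA -uE mulrA -polyCM vr.
    by [].
  exists (\sum_v u v); rewrite mulr_sumr -(eq_bigr _ (fun v _ => uE v)) -mulr_suml.
  by rewrite -(rmorph_sum polyC) sum_vx mul1r.
move: c; apply: (pathAlg_gen (W := W)) => [c d Pc Pd|c d Pd|c d Pc Pd|v|e].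
- by rewrite polyCD; exact: congruentD.
- rewrite -mulr_algl polyCM; apply: congruentM => //.
  by apply: congruent_fixed; rewrite thC th0C sgC.
- by rewrite polyCM; exact: congruentM.
- by apply: congruent_fixed; rewrite thC th0V sgV.
case: (boolP (lp (rep (source e)))) => lpr; last first.
  by apply: congruent_fixed; rewrite thC th0A (negbTE lpr) sgA (negbTE lpr).
set r := rep (source e) in lpr *; have re : linked r (source e) by exact: linked_rep.
have [se te ae] := loop_arrow lpr re; have er := loop_component lpr.
have [_ _ [s [Ss _ [w aw] _]] _ _] := data r.
have [|u uE] := @congruent_unit (source e) ((ar e)%:P - sg (th (ar e)%:P)).
  exists ('X%:P - subst1 (h r) (a r)); split.
    rewrite -/r mulrBr rmorphB mulrBr thC th0A -/r lpr; congr (_ - _).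
      by congr (_ * _); rewrite /eval_at /= map_polyC /= horner_algX ae.
    rewrite -unit_sg_horner se -er rmorphM sg_unit.
    have ce := polyC_central (sg (horner_alg (x r) (a r))) (component_unit_central W r).
    by rewrite -ce mulrA -polyCM component_unit_idem rep_rep.
  by exists s, (- w); split=> //; rewrite mulrN -aw opprB.
have ea : eps r * ar e = ar e by rewrite er -{1}se vx_ar_id.
exists u; rewrite -uE -/r mulrBr -polyCM ea; congr (_ - _).
by rewrite thC -{1}ea rmorphM th0_unit rmorphM sg_unit.
Qed.

Lemma splitting_quotient : split_quotient (conv sg) (conv th) (center_poly Z).
Proof.
split; first exact: th_sgK.
  by rewrite center_polyE; exact: th_S.
move=> r; have [u ru] := congruent_all r; exists u.
by apply: etrans ru _; rewrite S_central center_polyE.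
Qed.

End Splitting.

(** * Cancellation *)
Section MoritaCancellation.
Variables (k : fieldType) (Q : quiver) (A B : algType k) (W : path_basis Q A).
Variables (F : functor (rightMod (polyAlg A)) (rightMod (polyAlg B)))
  (G : functor (rightMod (polyAlg B)) (rightMod (polyAlg A))).
Hypothesis FG : quasi_inverse F G.
Local Notation Rc := ({poly A}^c).
Variable Phi : {rmorphism {poly center B} -> {poly center A}}.
Hypothesis inj_Phi : injective Phi.
Hypothesis surj_Phi : forall f, exists p, Phi p = f.
Hypothesis FPhi : forall p (M : lmodType {poly A}^c),
  fmap F (center_act (center_poly (Phi p)) M : @hom (rightMod (polyAlg A)) M M) =
  center_act (center_poly p) (F M).

(** The vertices u and w give twins, which the translation by b turns into twins M
    and N. The idempotent of the component corresponds to a constant of Z(B)[t],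
    which no translation moves, so M is supported on the cycle and is killed by
    x. Translating back, the image of p(t + b) kills the module of u. *)
Lemma translated_cycle_sum u w n p (x : center A) :
    cyclic_at u -> linked u w -> u != w -> period_at u n ->
    val x = cycle_sum W u n -> Phi p = x%:P ->
  forall b i, coef W u [::] (val (Phi (p \Po ('X + b%:P)))`_i) = 0.
Proof.
move=> cyc uw nuw [n0 orbit period min_period] xE px b i.
have tw := vertex_module_twin W uw nuw.
have [M [N [twMN acts]]] := translated_twin FG FPhi b tw.
have [q qe] := surj_Phi (unit_center W u)%:P.
have [c qc _] : exists2 c, q = c%:P & c * c = c.
  by apply: idempotent_poly_const; apply: inj_Phi; rewrite rmorphM qe -polyCM unit_center_idem.
have cstE (z : center A) (L : leftMod Rc) (l : L) :
    center_act (center_poly z%:P) L l = cst (val z) *: l.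
  by rewrite center_poly_act; congr (_ *: _); exact: map_polyC.
have act1 (L : leftMod Rc) (l : L) : center_act (center_poly 1) L l = l.
  by rewrite center_poly_act rmorph1 scale1r.
have unit_act (L : leftMod Rc) (l : L) :
    center_act (center_poly (Phi q)) L l = cst (component_unit W u) *: l.
  by rewrite qe; apply: etrans (cstE _ _ l) _; rewrite unit_centerE.
have unit_eval : vertex_eval W u (component_unit W u)%:P = 1.
  by rewrite /vertex_eval /= map_polyC /= /head_coef coef_component_unit.
have eM (m : M) : cst (component_unit W u) *: m = m.
  have qM : center_act (center_poly (Phi q)) M = center_act (center_poly (Phi 1)) M.
    have -> : 1 = (1 : center B)%:P by [].
    apply/acts; rewrite qc !comp_polyC -qc rmorph1; apply: linear_ext => l.
    apply: etrans (unit_act _ l) _; apply: etrans _ (esym (act1 _ l)).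
    apply: etrans (vertex_module_act _ _) _.
    apply: etrans (congr1 (fun f : {poly k} => (l : {poly k}) * f) unit_eval) _.
    exact: mulr1.
  apply: etrans (esym (unit_act M m)) _; apply: etrans (act1 M m).
  by rewrite -(rmorph1 Phi) qM.
have xM := twin_cycle_sum cyc orbit period min_period twMN eM.
have actx : center_act (center_poly (Phi p)) M = center_act (center_poly (Phi 0)) M.
  apply: linear_ext => m; rewrite px cstE xE xM rmorph0 -polyC0 cstE.
  by apply/esym; exact: scale0r.
have /acts := actx; rewrite comp_poly0 rmorph0.
move/(congr1 (fun h : {linear vertex_module W u -> vertex_module W u} => h (1 : {poly k}))).
rewrite !center_poly_act !vertex_module_act rmorph0.
rewrite rmorph0 mulr0 mul1r => /(congr1 (fun f : {poly k} => f`_i)).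
by rewrite poly.coef0 !coef_map.
Qed.

Lemma path_basis_splits : exists (sg : {rmorphism A -> {poly A}}) (th : {rmorphism {poly A} -> A}),
  [/\ split_quotient (conv sg) (conv th) (center_poly (Phi 'X)),
      forall c : k, sg c%:A = c%:A%:P & forall c : k, th (c%:A%:P) = c%:A].
Proof.
have data u : exists d : A * {poly {poly k}} * {poly k} * {poly k} * bool,
    component_split W (map_poly (@center_val A) (Phi 'X)) u d.1.1.1.1 d.1.1.1.2 d.1.1.2 d.1.2 d.2.
  have [cyc|ncyc] := pselect (cyclic_at u).
    have [x [h [a [b [lp H]]]]] := cyclic_split inj_Phi surj_Phi cyc
      (fun w n p x uw nuw per xE px => translated_cycle_sum cyc uw nuw per xE px).
    by exists (x, h, a, b, lp).
  have [x [h [a [b H]]]] := acyclic_split W inj_Phi surj_Phi ncyc.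
  by exists (x, h, a, b, false).
have {data}/choice[d dE] := data.
have [sg [sgC sgV sgA]] := splitting_sg dE.
have [th0 [th0C th0V th0A]] := splitting_th0 dE.
exists sg, (splitting_th dE th0); split=> //.
- exact: splitting_quotient.
- by move=> c; rewrite thC.
Qed.

End MoritaCancellation.

Theorem theorem0p5 (k : fieldType) (Q : quiver) :
  morita_cancellative (pathAlg k Q) /\
  linearly_morita_cancellative (pathAlg k Q).
Proof.
have W := pathAlg_basis k Q.
split=> B [F [G]].
  move=> FG; have [Phi [inj surj FPhi]] := equivalence_poly_center FG.
  have [sg [th [quo _ _]]] := path_basis_splits W FG inj surj FPhi.
  exact: (cancel_equivalent FG (FPhi _) quo).
case=> kF kG FG; have [Phi [inj surj FPhi]] := equivalence_poly_center FG.
have [sg [th [quo sgC thC]]] := path_basis_splits W FG inj surj FPhi.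
exact: (cancel_linearly_equivalent FG (FPhi _) quo sgC thC kF kG).
Qed.
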